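(* Let $\Sigma$ be a compact Riemann surface, $ds^2$ a conformal metric on $\Sigma$, and $A:\Sigma\to\mathbb{C}\mathrm{P}^n$, $n\ge 2$, a full (possibly branched) complex curve. Then for every $a$ with $0\le a<1/2$ the point $\frac{1}{n+1}I$ lies in the image of the center of mass map $\Phi_a:\mathrm{int}\,\mathcal H\to HM_1(n+1)$; that is, there is $P\in\mathrm{int}\,\mathcal H$ with $\Phi_a(P)=\frac{1}{n+1}I$.
   Context: Hermitian model. $HM(n+1)$ is the real vector space of $(n+1)\times(n+1)$ complex Hermitian matrices with inner product $\langle A,B\rangle=2\,\mathrm{tr}(AB)$; $HM_1(n+1)$ is the affine hyperplane of trace $1$; $I$ is the identity matrix. $\mathbb{C}\mathrm{P}^n$ is identified with $\{A\in HM_1(n+1): A^2=A\}$ via $[z]\mapsto \frac{1}{|z|^2}\bar z^{t}z$, where $z\in\mathbb{C}^{n+1}\setminus\{0\}$ is a row vector. $\mathcal H=\{A\in HM_1(n+1): A\ge 0\}$ is its convex hull, with interior (in $HM_1(n+1)$) $\mathrm{int}\,\mathcal H=\{A\in HM_1(n+1): A>0\}$. Complex projective lines in $\mathbb{C}\mathrm{P}^n$ are round $2$-spheres of radius one in $HM_1(n+1)$. Curves. $\Sigma$ is a compact connected Riemann surface. A complex curve is a nonconstant holomorphic map $A:\Sigma\to\mathbb{C}\mathrm{P}^n$, viewed as a map into $HM_1(n+1)$; it may have (isolated) branch points. It is full if its image lies in no hyperplane $\mathbb{C}\mathrm{P}^{n-1}$. Gauss map. At an unbranched point, let $A^-$ be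 the point antipodal to $A$ on the tangent projective line of the curve at $A$ (a unit $2$-sphere), and put $B=A^--A\in HM(n+1)$. At a branch point the tangent line is defined by extension: in a local coordinate $w$ centered at the point and with suitable projective coordinates, the curve is $z(w)=(1,z_1(w),\dots,z_n(w))$ with $z_i$ holomorphic and $z'(w)=w^m h(w)$, $h(0)\ne0$, and the tangent line is the projective line determined by $\mathrm{span}\{z(0),h(0)\}$. Thus $B:\Sigma\to HM(n+1)$ is defined everywhere. Center of mass map. For $P\in\mathrm{int}\,\mathcal H$ let $f_P:\mathbb{C}\mathrm{P}^n\to\mathbb{C}\mathrm{P}^n$, $f_P([z])=[zP]$, let $A_P=f_P\circ A$, and let $B_P$ be the Gauss map of the curve $A_P$. A conformal metric $ds^2$ is a smooth Riemannian metric compatible with the complex structure of $\Sigma$, and $d\mu$ is its Riemannian measure. Then $$\Phi_a(P)=\frac{1}{\mathrm{Area}(ds^2)}\int_\Sigma (A_P+aB_P)\,d\mu .$$ *)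

(* Defs.v *)
(* MathComp / MathComp-Analysis *)
From HB Require Import structures.
From mathcomp Require Import all_boot all_order all_algebra.
From mathcomp Require Import complex.
From mathcomp Require Import all_classical all_reals all_analysis.

Set Implicit Arguments.
Unset Strict Implicit.
Unset Printing Implicit Defensive.

Import Order.TTheory GRing.Theory Num.Theory.
Import numFieldNormedType.Exports.

Local Open Scope classical_set_scope.
Local Open Scope complex_scope.
Local Open Scope ring_scope.
Local Open Scope sesquilinear_scope.

(* R[i] seen as a numClosedFieldType, so that it carries the topology and the
   normed-module structure over itself given by its norm; [derivable f w 1] on
   this type is complex differentiability. *)
Definition Cx (R : realType) : numClosedFieldType := R[i].

(* Smoothness of real functions of x + iy, in the sense of real calculus in
   the plane. *)
Section Smooth.
Variable R : realType.
Implicit Types (U : set (Cx R)) (f : Cx R -> R) (v z : Cx R).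

Definition along f v z : R -> R := fun t => f (z + t%:C * v).

Definition partial v f : Cx R -> R := fun z => derive1 (along f v z) 0.

Fixpoint Ck (k : nat) U f : Prop :=
  (forall z, U z -> {for z, continuous f}) /\
  (if k is k'.+1 then
     forall v, v = 1 \/ v = 'i%C ->
       (forall z, U z -> derivable (along f v z) 0 1) /\ Ck k' U (partial v f)
   else True).

Definition smooth_on U f : Prop := forall k, Ck k U f.

End Smooth.

(* chart_inv i is only meaningful on the image chart i @` chart_dom i. *)
Record riemann_surface (R : realType) (T : ptopologicalType) := RiemannSurface {
  chart_index : Type;
  chart_dom : chart_index -> set T;
  chart : chart_index -> T -> Cx R;
  chart_inv : chart_index -> Cx R -> T;
  surface_hausdorff : hausdorff_space T;
  surface_connected : connected [set: T];
  chart_dom_open : forall i, open (chart_dom i);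
  chart_img_open : forall i, open (chart i @` chart_dom i);
  chart_cover : forall x, exists i, chart_dom i x;
  chartK : forall i x, chart_dom i x -> chart_inv i (chart i x) = x;
  chart_continuous : forall i x, chart_dom i x ->
    {for x, continuous (chart i)};
  chart_inv_continuous : forall i x, chart_dom i x ->
    {for chart i x, continuous (chart_inv i)};
  transition_holomorphic : forall i j x, chart_dom i x -> chart_dom j x ->
    derivable (chart j \o chart_inv i) (chart i x) 1
}.

Section ConformalMetric.
Variables (R : realType) (T : ptopologicalType) (S : riemann_surface R T).

(* metric i x is the inner product on the tangent space at x, where a tangent
   vector is written in chart i as the complex number
   v = dx(v) + 'i dy(v); multiplication by 'i is then the complex structure,
   and the differential of a change of charts is multiplication by its complex
   derivative. *)
Record conformal_metric := ConformalMetric {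
  metric : chart_index S -> T -> Cx R -> Cx R -> R;
  metric_sym : forall i x v w, chart_dom i x ->
    metric i x v w = metric i x w v;
  metric_linear : forall i x (t : R) u v w, chart_dom i x ->
    metric i x (t%:C * u + v) w = t * metric i x u w + metric i x v w;
  metric_pos : forall i x v, chart_dom i x -> v != 0 -> 0 < metric i x v v;
  metric_smooth : forall i v w,
    smooth_on (chart i @` chart_dom i)
              (fun z => metric i (chart_inv i z) v w);
  metric_change : forall i j x v w, chart_dom i x -> chart_dom j x ->
    let d := derive1 (chart j \o chart_inv i) (chart i x) in
    metric i x v w = metric j x (d * v) (d * w);
  metric_conformal : forall i x v w, chart_dom i x ->
    metric i x ('i%C * v) ('i%C * w) = metric i x v w
}.

(* sqrt (E G - F^2) at the point of coordinate p.1 + 'i p.2 in chart i *)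
Definition area_density (g : conformal_metric) (i : chart_index S)
    (p : R * R) : R :=
  let gx := metric g i (chart_inv i (p.1 +i* p.2)) in
  Num.sqrt (gx 1 1 * gx 'i%C 'i%C - gx 1 'i%C ^+ 2).

Local Notation borelT := (g_sigma_algebraType (@open T)).

(* The Borel measure given in every chart by sqrt (E G - F^2) dx dy; it is
   unique because chart domains cover T. *)
Definition is_riemannian_measure (g : conformal_metric)
    (mu : {measure set borelT -> \bar R}) : Prop :=
  forall (i : chart_index S) (E : set borelT),
    measurable E -> E `<=` chart_dom i ->
    mu E = (\int[(@lebesgue_measure R \x @lebesgue_measure R)%E]_(p in
              [set (complex.Re (chart i x), complex.Im (chart i x)) | x in E])
              (area_density g i p)%:E)%E.

End ConformalMetric.

Section Projective.
Variables (R : realType) (n : nat).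
Local Notation C := (Cx R).
Local Notation vec := 'rV[C]_n.+1.
Local Notation mat := 'M[C]_n.+1.

Definition HM : set mat := [set A | A \is hermsymmx].

Definition HM_inner (A B : mat) : R := complex.Re (2 * \tr (A *m B)).

Definition HM1 : set mat := [set A | HM A /\ \tr A = 1].

Definition posdefmx (A : mat) : Prop :=
  forall v : vec, v != 0 -> 0 < (v *m A *m v ^t*) 0 0.

Definition intH : set mat := [set A | HM1 A /\ posdefmx A].

(* The point [z] of CP^n, as a Hermitian projection; only meaningful for
   z != 0. *)
Definition CPpt (z : vec) : mat := ((z *m z ^t*) 0 0)^-1 *: (z ^t* *m z).

Definition hyperplane (c : 'cV[C]_n.+1) : set mat :=
  [set CPpt z | z in [set z : vec | z != 0 /\ z *m c = 0]].

Definition proj_line (u v : vec) : set mat :=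
  [set CPpt y | y in [set y : vec | y != 0 /\ (y <= col_mx u v)%MS]].

(* [z] |-> [z P]. Here and below xget picks the unique element of the set
   described; the default value 0 is only for degenerate arguments. *)
Definition proj_map (P A : mat) : mat :=
  xget 0 [set A' | exists z : vec,
    [/\ z != 0, A = CPpt z & A' = CPpt (z *m P)]].

(* The segment from A to A' is a diameter of the unit sphere L: both ends lie
   on L and the midpoint is at distance one from every point of L. *)
Definition antipodal (L : set mat) (A A' : mat) : Prop :=
  [/\ L A, L A' & forall X, L X ->
    let D := X - 2^-1 *: (A + A') in HM_inner D D = 1].

End Projective.

Section Curves.
Variables (R : realType) (T : ptopologicalType) (S : riemann_surface R T).
Variable n : nat.
Local Notation C := (Cx R).
Local Notation vec := 'rV[C]_n.+1.
Local Notation mat := 'M[C]_n.+1.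
Implicit Types (F : T -> mat) (x : T).

(* Near x, in chart i, F is [z(w)] with z holomorphic and k-th homogeneous
   coordinate equal to 1: F is holomorphic in the k-th affine chart of CP^n. *)
Definition affine_lift F x (i : chart_index S) (k : 'I_n.+1) (z : C -> vec) :
    Prop :=
  chart_dom i x /\
  \forall w \near chart i x,
    [/\ derivable z w 1, z w 0 k = 1 & F (chart_inv i w) = CPpt (z w)].

Definition holomorphic_curve F : Prop :=
  forall x, exists i k z, affine_lift F x i k z.

Definition complex_curve F : Prop :=
  holomorphic_curve F /\ exists x y, F x <> F y.

Definition full F : Prop :=
  forall c : 'cV[C]_n.+1, c != 0 -> ~ (range F `<=` hyperplane c).

(* The case m = 0 is that of an unbranched point. *)
Definition tangent_line F x (L : set mat) : Prop :=
  exists i k z (m : nat) (h : C -> vec),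
    [/\ affine_lift F x i k z,
        \forall w \near chart i x,
          derivable h w 1 /\ derive1 z w = (w - chart i x) ^+ m *: h w,
        h (chart i x) != 0 &
        L = proj_line (z (chart i x)) (h (chart i x))].

Definition gauss_map F x : mat :=
  xget 0 [set B | exists L A',
    [/\ tangent_line F x L, antipodal L (F x) A' & B = A' - F x]].

Local Notation borelT := (g_sigma_algebraType (@open T)).

(* entrywise, over real and imaginary parts *)
Definition mx_integral (mu : {measure set borelT -> \bar R}) (F : T -> mat) :
    mat :=
  \matrix_(i, j)
    ((\int[mu]_(x in [set: borelT]) complex.Re (F x i j))%R +i*
     (\int[mu]_(x in [set: borelT]) complex.Im (F x i j))%R).

Definition center_of_mass (mu : {measure set borelT -> \bar R})
    (A : T -> mat) (a : R) (P : mat) : mat :=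
  let AP := fun x => proj_map P (A x) in
  ((fine (mu [set: borelT]))^-1)%:C *:
    mx_integral mu (fun x => AP x + a%:C *: gauss_map AP x).

End Curves.

(* Main.v *)
Require Import Defs.
From HB Require Import structures.
From mathcomp Require Import all_boot all_order all_algebra.
From mathcomp Require Import complex.
From mathcomp Require Import all_classical all_reals all_analysis.
From mathcomp Require Import ring lra.
Set Implicit Arguments.
Unset Strict Implicit.
Unset Printing Implicit Defensive.
Import Order.TTheory GRing.Theory Num.Theory.
Import numFieldNormedType.Exports.
Local Open Scope classical_set_scope.
Local Open Scope complex_scope.
Local Open Scope ring_scope.
Local Open Scope sesquilinear_scope.

(** Let z be a local holomorphic lift of the curve, and h a second vector such that
    z and h span the tangent line.  Since A and the antipodal point A^- are Hermitian
    projectors on orthogonal lines, A + A^- is the projector Pi on the tangent plane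
    span(z, h), and

      A + a B = (1 - 2a) A + a Pi.

    This combination of projectors is the gradient of a potential.  For an
    invertible matrix G put

      f(G) = (1 - 2a) ln (|zG|^2 / |z|^2) + a ln (|zG ^ hG|^2 / |z ^ h|^2),

    a function on the surface that depends neither on the lift nor on the frame
    ([loggrow]), and let F(G) be its integral ([growth]).  The function
    F(G) - (Area/(n+1)) ln |det G|^2 is invariant under scaling G and under
    multiplying it by a unitary matrix on the right ([scaled_growth]).  If it has
    a minimum at G, then moving G to G (1 + d v^* v) for a unit row v turns the
    minimality into

      (Area/(n+1)) ln r <= (r - 1) q(v)    for all r = (1 + d)^2 > 0,

    where q(v) is the integral of v ((1 - 2a) A + a Pi) v^* along the moved curve
    ([slope_ineq]).  Both sides vanish at r = 1, so they are tangent there and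
    q(v) = Area/(n+1) for every v ([slope_integ]); by polarization the integral of
    A + a B is then Area/(n+1) times the identity ([total_scalar]).

    A minimum exists because the potential is convex along one-parameter groups
    and proper.  By the spectral theorem it suffices to consider
    G = U diag(exp(x_j/2)) with U unitary and sum x = 0 ([polar]).  There |zG|^2
    and |zG ^ hG|^2 are sums of exponentials of linear functions of x, so f is a
    combination of logarithms of sums of exponentials, convex along the rays
    t x ([loggrow_ray]) and growing along the ray at a rate of at least
    (1 - 2a) x_i + a (x_i + x_j), outside the points where the i-th coordinate of
    zU or the (i, j) minor of (zU, hU) vanishes.  Fullness makes these points
    isolated, hence finite in number ([finite_hyperplane], [finite_minor]), and for
    three or more coordinates and a < 1/2 the indices can be chosen so that the
    rate is positive ([growth_rate]).  So F is eventually positive on each ray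
    ([coercive]); by compactness of the set of directions (U, x) it is
    positive outside a ball ([escape]), and it vanishes at the centre, so the
    minimum over the ball is a global one ([minimiser]).  The Hermitian matrix
    P = U diag(exp(x_j/2)) U^* divided by its trace is the required point.

    The geometric input is that the tangent line at a point, branched or not, is
    well defined, that it is carried along by projective maps, and that it varies
    continuously ([frame_unique], [frame_proj], [frames_local]).  This rests on
    the local theory of holomorphic functions of one variable, developed from
    complex differentiability through Cauchy's theorem on rectangles: isolated
    zeros, factorization at a zero ([holo_factor]), and holomorphy of the
    derivative ([holo_derive]). *)

(** * The modulus of a complex number as a real number *)
Section ComplexModulus.
Variable R : realType.
Local Notation C := (Cx R).
Implicit Types (z w : C) (x y : R).

Definition cabs z : R := complex.Re `|z|.

Lemma normE z : `|z| = (cabs z)%:C.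
Proof. by rewrite /cabs normc_def. Qed.

Lemma cabsE z : cabs z = Num.sqrt (complex.Re z ^+ 2 + complex.Im z ^+ 2).
Proof. by rewrite /cabs normc_def. Qed.

Lemma cabs_ge0 z : 0 <= cabs z.
Proof. by rewrite cabsE sqrtr_ge0. Qed.

Lemma cabsM z w : cabs (z * w) = cabs z * cabs w.
Proof. by apply: (@complexI R); rewrite rmorphM /= -!normE normrM. Qed.

Lemma cabsV z : cabs z^-1 = (cabs z)^-1.
Proof. by apply: (@complexI R); rewrite fmorphV /= -!normE normfV. Qed.

Lemma cabsX z n : cabs (z ^+ n) = cabs z ^+ n.
Proof. by apply: (@complexI R); rewrite rmorphXn /= -!normE normrX. Qed.

Lemma cabsN z : cabs (- z) = cabs z.
Proof. by rewrite /cabs normrN. Qed.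

Lemma cabsB z w : cabs (z - w) = cabs (w - z).
Proof. by rewrite /cabs distrC. Qed.

Lemma cabs0 : cabs 0 = 0.
Proof. by rewrite /cabs normr0. Qed.

Lemma cabs1 : cabs 1 = 1.
Proof. by rewrite /cabs normr1. Qed.

Lemma cabs_eq0 z : (cabs z == 0) = (z == 0).
Proof. by rewrite -[RHS]normr_eq0 normE -(inj_eq (@complexI R)). Qed.

Lemma cabs_gt0 z : (0 < cabs z) = (z != 0).
Proof. by rewrite lt_def cabs_ge0 andbT cabs_eq0. Qed.

Lemma cabsD z w : cabs (z + w) <= cabs z + cabs w.
Proof. by rewrite -lecR rmorphD /= -!normE ler_normD. Qed.

Lemma cabs_real x : cabs x%:C = `|x|.
Proof. by rewrite cabsE /= expr0n /= addr0 sqrtr_sqr. Qed.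

Lemma cabs_sq z : cabs z ^+ 2 = complex.Re z ^+ 2 + complex.Im z ^+ 2.
Proof. by rewrite cabsE sqr_sqrtr // addr_ge0 // sqr_ge0. Qed.

Lemma Re_le_cabs z : `|complex.Re z| <= cabs z.
Proof. by rewrite -ler_sqr ?nnegrE ?cabs_ge0 // cabs_sq real_normK ?num_real // lerDl sqr_ge0. Qed.

Lemma Im_le_cabs z : `|complex.Im z| <= cabs z.
Proof. by rewrite -ler_sqr ?nnegrE ?cabs_ge0 // cabs_sq real_normK ?num_real // lerDr sqr_ge0. Qed.

Lemma cabs_le_ReIm z : cabs z <= `|complex.Re z| + `|complex.Im z|.
Proof.
rewrite -ler_sqr ?nnegrE ?cabs_ge0 ?addr_ge0 // cabs_sq sqrrD !real_normK ?num_real //.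
by rewrite -addrA lerD2l lerDr mulrn_wge0 // mulr_ge0.
Qed.

Lemma cabs_i : cabs ('i%C : C) = 1.
Proof. by rewrite cabsE /= expr0n expr1n add0r sqrtr1. Qed.

Lemma cxReD z w : complex.Re (z + w) = complex.Re z + complex.Re w.
Proof. by case: z; case: w. Qed.

Lemma cxImD z w : complex.Im (z + w) = complex.Im z + complex.Im w.
Proof. by case: z; case: w. Qed.

Lemma cxReN z : complex.Re (- z) = - complex.Re z.
Proof. by case: z. Qed.

Lemma cxImN z : complex.Im (- z) = - complex.Im z.
Proof. by case: z. Qed.

Lemma cxReM z w :
  complex.Re (z * w) = complex.Re z * complex.Re w - complex.Im z * complex.Im w.
Proof. by case: z; case: w. Qed.

Lemma cxImM z w :
  complex.Im (z * w) = complex.Re z * complex.Im w + complex.Im z * complex.Re w.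
Proof. by case: z; case: w. Qed.

Lemma cx_eqP z w :
  complex.Re z = complex.Re w -> complex.Im z = complex.Im w -> z = w.
Proof. by case: z; case: w => a b c d /= -> ->. Qed.

Lemma nbhs_cabsP w (P : set C) :
  nbhs w P <-> exists2 r : R, 0 < r & forall v, cabs (v - w) < r -> P v.
Proof.
rewrite nbhs_ballP; split=> [[e /= e0 eP]|[r r0 rP]].
  have /complex_realP[r er] : e \is Num.real by rewrite gtr0_real.
  rewrite er in e0 eP; exists r; first by rewrite ltcR in e0.
  by move=> v vr; apply: eP; rewrite -ball_normE /= distrC normE ltcR.
exists r%:C; first by rewrite /= ltcR.
by move=> v; rewrite -ball_normE /= distrC normE ltcR => /rP.
Qed.

Lemma cvg_cabsP (T : Type) (F : set_system T) (FF : Filter F) (f : T -> C) (l : C) :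
  f x @[x --> F] --> l <-> forall r, 0 < r -> \forall x \near F, cabs (f x - l) < r.
Proof.
split=> [fl r r0|H].
  by apply: (fl [set v | cabs (v - l) < r]); apply/nbhs_cabsP; exists r.
move=> P /nbhs_cabsP[r r0 rP];
by have := H r r0; apply: filterS => x; apply: rP.
Qed.

Lemma cvg_realP (T : Type) (F : set_system T) (FF : Filter F) (f : T -> R) (l : R) :
  f x @[x --> F] --> l <-> forall e, 0 < e -> \forall x \near F, `|f x - l| < e.
Proof.
split=> [/cvgrPdist_lt fl e /fl|fl]; first by apply: filterS => x; rewrite distrC.
by apply/cvgrPdist_lt => e /fl; apply: filterS => x; rewrite distrC.
Qed.

Lemma continuous_Re : continuous (@complex.Re R : C -> R).
Proof.
move=> z; apply/(cvg_realP (nbhs_filter z)) => e e0.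
have : nbhs z [set v | cabs (v - z) < e] by apply/nbhs_cabsP; exists e.
apply: filterS => v; rewrite -cxReN -cxReD; apply: le_lt_trans; exact: Re_le_cabs.
Qed.

Lemma continuous_Im : continuous (@complex.Im R : C -> R).
Proof.
move=> z; apply/(cvg_realP (nbhs_filter z)) => e e0.
have : nbhs z [set v | cabs (v - z) < e] by apply/nbhs_cabsP; exists e.
apply: filterS => v; rewrite -cxImN -cxImD; apply: le_lt_trans; exact: Im_le_cabs.
Qed.

Lemma continuous_cabs : continuous cabs.
Proof.
move=> z; apply/(cvg_realP (nbhs_filter z)) => e e0.
have : nbhs z [set v | cabs (v - z) < e] by apply/nbhs_cabsP; exists e.
apply: filterS => v; apply: le_lt_trans; rewrite ler_norml; apply/andP; split.
  rewrite lerBrDl -lerBrDr opprK.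
  by have := cabsD (z - v) v; rewrite subrK cabsB addrC.
by have := cabsD (v - z) z; rewrite subrK lerBlDr.
Qed.

Lemma cvg_complex (T : Type) (F : set_system T) (FF : Filter F) (f : T -> C) (l : C) :
  (complex.Re (f x) @[x --> F] --> complex.Re l) ->
  (complex.Im (f x) @[x --> F] --> complex.Im l) -> f x @[x --> F] --> l.
Proof.
move=> /cvg_realP fRe /cvg_realP fIm; apply/cvg_cabsP => r r0.
have r20 : 0 < r / 2 by rewrite divr_gt0.
have := fRe _ r20; have := fIm _ r20; apply: filterS2 => x xI xR.
apply: le_lt_trans (cabs_le_ReIm _) _.
by rewrite (splitr r) cxReD cxReN cxImD cxImN ltrD.
Qed.

Lemma continuous_complex (T : topologicalType) (f : T -> C) t :
  {for t, continuous (fun s => complex.Re (f s))} ->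
  {for t, continuous (fun s => complex.Im (f s))} ->
  {for t, continuous f}.
Proof. exact: cvg_complex. Qed.

Section PointwiseContinuity.
Variables (T : topologicalType) (t : T).
Implicit Types f g : T -> C.

Lemma contD f g : {for t, continuous f} -> {for t, continuous g} ->
  {for t, continuous (fun s => f s + g s)}.
Proof. exact: continuousD. Qed.

Lemma contB f g : {for t, continuous f} -> {for t, continuous g} ->
  {for t, continuous (fun s => f s - g s)}.
Proof. exact: continuousB. Qed.

Lemma contM f g : {for t, continuous f} -> {for t, continuous g} ->
  {for t, continuous (fun s => f s * g s)}.
Proof. exact: continuousM. Qed.

Lemma contV f : {for t, continuous f} -> f t != 0 ->
  {for t, continuous (fun s => (f s)^-1)}.
Proof. by move=> cf f0; exact: continuousV. Qed.

Lemma cont_cst (k : C) : {for t, continuous (fun=> k)}.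
Proof. exact: cst_continuous. Qed.

End PointwiseContinuity.

Lemma cont_id z : {for z, continuous (fun v : C => v)}.
Proof. exact: cvg_id. Qed.

Lemma contX (f : C -> C) z n : {for z, continuous f} -> {for z, continuous (fun v : C => f v ^+ n : C)}.
Proof.
move=> cf; elim: n => [|n IH]; first exact: cont_cst.
have := contM cf IH; congr continuous_at.
by apply/funext => v; rewrite exprS.
Qed.

End ComplexModulus.

(** * Complex integrals over real segments *)
Section ComplexIntegral.
Variable R : realType.
Local Notation C := (Cx R).
Local Notation leb := (@lebesgue_measure R).
Implicit Types (f g : R -> C) (a b m : R).

Definition cint f a b : C :=
  (\int[leb]_(t in `[a, b]) complex.Re (f t))%R +i*
  (\int[leb]_(t in `[a, b]) complex.Im (f t))%R.

(** Two-sided continuity is asked at the end points too; it keeps the side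
    conditions stable when a segment is cut. *)
Definition seg_continuous a b f := forall t, a <= t <= b -> {for t, continuous f}.

Lemma seg_integrable (u : R -> R) a b :
  (forall t, a <= t <= b -> {for t, continuous u}) ->
  leb.-integrable `[a, b] (EFin \o u).
Proof.
move=> cu; apply: continuous_compact_integrable; first exact: segment_compact.
by apply: continuous_in_subspaceT => t; rewrite inE /= in_itv /=; exact: cu.
Qed.

Lemma seg_integrable_Re f a b : seg_continuous a b f ->
  leb.-integrable `[a, b] (EFin \o (fun t => complex.Re (f t))).
Proof.
move=> cf; apply: seg_integrable => t /cf ft.
exact: (@continuous_comp _ _ _ f (@complex.Re R) t ft (@continuous_Re R _)).
Qed.

Lemma seg_integrable_Im f a b : seg_continuous a b f ->
  leb.-integrable `[a, b] (EFin \o (fun t => complex.Im (f t))).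
Proof.
move=> cf; apply: seg_integrable => t /cf ft.
exact: (@continuous_comp _ _ _ f (@complex.Im R) t ft (@continuous_Im R _)).
Qed.

Lemma Rintegral_split (u : R -> R) a m b : a <= m -> m <= b ->
  leb.-integrable `[a, b] (EFin \o u) ->
  (\int[leb]_(t in `[a, b]) u t)%R =
  (\int[leb]_(t in `[a, m]) u t + \int[leb]_(t in `[m, b]) u t)%R.
Proof.
move=> am mb iu; have := @Rintegral_itvB _ u (BLeft a) (BRight b) m iu.
rewrite !bnd_simp => /(_ am mb) /eqP; rewrite subr_eq addrC => /eqP ->; congr (_ + _).
rewrite Rintegral_itv_obnd_cbnd //.
apply: integrableS iu => //; apply: subset_itvr; rewrite bnd_simp //.
Qed.

Lemma cint_split f a m b : a <= m -> m <= b -> seg_continuous a b f ->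
  cint f a b = cint f a m + cint f m b.
Proof.
move=> am mb cf; apply: cx_eqP; rewrite ?cxReD ?cxImD /cint /=.
  by apply: Rintegral_split => //; exact: seg_integrable_Re.
by apply: Rintegral_split => //; exact: seg_integrable_Im.
Qed.

Lemma cintD f g a b : seg_continuous a b f -> seg_continuous a b g ->
  cint (fun t => f t + g t) a b = cint f a b + cint g a b.
Proof.
move=> cf cg; apply: cx_eqP; rewrite ?cxReD ?cxImD /cint /=.
  under eq_Rintegral do rewrite cxReD.
  by apply: RintegralD => //; exact: seg_integrable_Re.
under eq_Rintegral do rewrite cxImD.
by apply: RintegralD => //; exact: seg_integrable_Im.
Qed.

Lemma integrable_scale (u : R -> R) k a b :
  leb.-integrable `[a, b] (EFin \o u) ->
  leb.-integrable `[a, b] (EFin \o (fun t => k * u t)).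
Proof.
by move=> iu; apply: eq_integrable (integrableZl _ k iu).
Qed.

Lemma cintZ f k a b : seg_continuous a b f ->
  cint (fun t => k * f t) a b = k * cint f a b.
Proof.
move=> cf; have iR := seg_integrable_Re cf; have iI := seg_integrable_Im cf.
apply: cx_eqP; rewrite ?cxReM ?cxImM /cint /= -!RintegralZl //.
  rewrite -RintegralB //; try exact: integrable_scale.
  by apply: eq_Rintegral => t _; rewrite cxReM.
rewrite -RintegralD //; try exact: integrable_scale.
by apply: eq_Rintegral => t _; rewrite cxImM.
Qed.

Lemma eq_cint f g a b : (forall t, a <= t <= b -> f t = g t) ->
  cint f a b = cint g a b.
Proof.
move=> fg; congr Complex; apply: eq_Rintegral => t; rewrite inE /= in_itv /= => tab;
  by rewrite fg.
Qed.

Lemma fine_leb_itv a b : a <= b -> fine (leb `[a, b]) = b - a.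
Proof.
move=> ab; rewrite lebesgue_measure_itv /= lte_fin.
by case: ltgtP ab => // ->; rewrite subrr.
Qed.

(** The factor 2 comes from bounding the real and imaginary parts separately. *)
Lemma cint_le f a b M : a <= b -> seg_continuous a b f ->
  (forall t, a <= t <= b -> cabs (f t) <= M) ->
  cabs (cint f a b) <= 2 * M * (b - a).
Proof.
move=> ab cf fM.
have bnd (u : R -> R) : leb.-integrable `[a, b] (EFin \o u) ->
    (forall t, a <= t <= b -> `|u t| <= M) ->
    `|(\int[leb]_(t in `[a, b]) u t)%R| <= M * (b - a).
  move=> iu uM; apply: le_trans (le_normr_Rintegral _ iu) _ => //.
  rewrite -fine_leb_itv // -Rintegral_cst //; apply: le_Rintegral => //.
  - exact: integrable_norm.
  - by apply: (@seg_integrable (fun=> M)) => t _; exact: cst_continuous.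
apply: le_trans (cabs_le_ReIm _) _ => /=; rewrite -mulrA [2]mulr2n mulrDl mul1r.
apply: lerD; apply: bnd; [exact: seg_integrable_Re| |exact: seg_integrable_Im|].
  by move=> t /fM; apply: le_trans; exact: Re_le_cabs.
by move=> t /fM; apply: le_trans; exact: Im_le_cabs.
Qed.

Lemma cint_cst k a b : a <= b -> cint (fun=> k) a b = k * (b - a)%:C.
Proof.
move=> ab; apply: cx_eqP; rewrite ?cxReM ?cxImM /cint /= Rintegral_cst // fine_leb_itv //.
  by rewrite mulr0 subr0.
by rewrite mulr0 add0r.
Qed.

Lemma Rintegral_id a b : a <= b ->
  (\int[leb]_(t in `[a, b]) t)%R = (b ^+ 2 - a ^+ 2) / 2.
Proof.
rewrite le_eqVlt => /predU1P[->|ab].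
  by rewrite set_itv1 Rintegral_set1 subrr mul0r.
pose F : R -> R := 2^-1 *: (id ^+ 2 : R -> R).
have FE t : F t = 2^-1 * t ^+ 2 by [].
have dF (t : R) : is_derive t 1 F t.
  by apply: is_derive_eq; rewrite /GRing.scale /= expr1; lra.
have cF (t : R) : {for t, continuous F}.
  exact/differentiable_continuous/derivable1_diffP.
rewrite /Rintegral (@continuous_FTC2 _ id F) //.
- by rewrite -EFinB /= !FE -mulrBr mulrC.
- by apply: continuous_in_subspaceT => t _; exact: cvg_id.
- split; first by move=> t _.
    by apply: cvg_at_right_filter; exact: cF.
  by apply: cvg_at_left_filter; exact: cF.
- by move=> t _; rewrite derive1E; exact: derive_val.
Qed.

Lemma cint_real a b : a <= b ->
  cint (fun t => t%:C) a b = ((b ^+ 2 - a ^+ 2) / 2)%:C.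
Proof.
move=> ab; congr Complex; rewrite /= ?Rintegral_id //.
by rewrite Rintegral_cst // mul0r.
Qed.

End ComplexIntegral.

(** * Induction on rectangles by quartering *)
Section Bisection.
Variable R : realType.
Implicit Types (x y s a c W H p q : R).

Lemma nested_point (u : nat -> R) W : 0 <= W ->
  (forall n, u n <= u n.+1 <= u n + 2^-1 ^+ n.+1 * W) ->
  exists p, forall n, u n <= p <= u n + 2^-1 ^+ n * W.
Proof.
move=> W0 uS.
have lo n m : u n <= u (n + m)%N.
  elim: m => [|m]; rewrite ?addn0 // addnS => /le_trans; apply.
  by have /andP[] := uS (n + m)%N.
have hi n m : u (n + m)%N + 2^-1 ^+ (n + m) * W <= u n + 2^-1 ^+ n * W.
  elim: m => [|m]; rewrite ?addn0 // addnS; apply: le_trans.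
  have /andP[_] := uS (n + m)%N; rewrite exprS.
  set v := u _.+1; set t := 2^-1 ^+ _ * W; rewrite -!mulrA -/t; lra.
have pos n : 0 <= 2^-1 ^+ n * W by rewrite mulr_ge0 // exprn_ge0 // invr_ge0.
have bd n m : u m <= u n + 2^-1 ^+ n * W.
  apply: le_trans (lo m n) _; rewrite addnC.
  by apply: le_trans (hi n m); rewrite lerDl.
exists (sup (range u)) => n; apply/andP; split.
  apply: ub_le_sup; last by exists n.
  by exists (u 0%N + 2^-1 ^+ 0 * W) => _ [m _ <-].
by apply: ge_sup; [exists (u 0%N), 0%N|move=> _ [m _ <-]].
Qed.

Lemma exists_half_exp e : 0 < e -> exists n, 2^-1 ^+ n < e :> R.
Proof.
move=> e0; have : (2^-1 ^+ n : R) @[n --> \oo] --> 0.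
  by apply: cvg_expr; rewrite ger0_norm ?invr_ge0 // invf_lt1 // ltr1n.
move=> /cvgrPdist_lt /(_ e e0) [n _ /(_ n)] /= /(_ (leqnn n)).
rewrite sub0r normrN ger0_norm ?exprn_ge0 ?invr_ge0 //; by exists n.
Qed.

(** Induction on similar rectangles: a property that passes from the four
    quarters of a rectangle to the rectangle, and that holds for all small
    rectangles around each point, holds for the whole rectangle; otherwise
    repeated quartering would produce a point contradicting the second
    hypothesis. *)
Lemma rectangle_induction (P : R -> R -> R -> Prop) a c W H : 0 <= W -> 0 <= H ->
  (forall x y s, 0 < s -> a <= x -> x + s * W <= a + W ->
     c <= y -> y + s * H <= c + H ->
     P x y (2^-1 * s) -> P (x + 2^-1 * s * W) y (2^-1 * s) ->
     P x (y + 2^-1 * s * H) (2^-1 * s) ->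
     P (x + 2^-1 * s * W) (y + 2^-1 * s * H) (2^-1 * s) -> P x y s) ->
  (forall p q, a <= p <= a + W -> c <= q <= c + H -> exists2 d, 0 < d &
     forall x y s, 0 < s < d -> a <= x -> x + s * W <= a + W ->
     c <= y -> y + s * H <= c + H -> x <= p <= x + s * W ->
     y <= q <= y + s * H -> P x y s) ->
  P a c 1.
Proof.
move=> W0 H0 Pstep Ploc; apply: contrapT => nP.
pose step (z : R * R) s : R * R :=
  if pselect (P z.1 z.2 (2^-1 * s)) then
    if pselect (P (z.1 + 2^-1 * s * W) z.2 (2^-1 * s)) then
      if pselect (P z.1 (z.2 + 2^-1 * s * H) (2^-1 * s)) then
        (z.1 + 2^-1 * s * W, z.2 + 2^-1 * s * H)
      else (z.1, z.2 + 2^-1 * s * H)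
    else (z.1 + 2^-1 * s * W, z.2)
  else z.
pose u := fix u n := if n is n'.+1 then step (u n') (2^-1 ^+ n') else (a, c).
have pw n : 0 < 2^-1 ^+ n :> R by rewrite exprn_gt0 // invr_gt0.
have inv n : [/\ ~ P (u n).1 (u n).2 (2^-1 ^+ n), a <= (u n).1,
    (u n).1 + 2^-1 ^+ n * W <= a + W, c <= (u n).2 &
    (u n).2 + 2^-1 ^+ n * H <= c + H].
  elim: n => [|n [nPn axn xnb cyn ynd]]; first by rewrite expr0 !mul1r /=; split.
  have Ps := Pstep _ _ _ (pw n) axn xnb cyn ynd.
  have [hW hH] : 0 <= 2^-1 ^+ n * W /\ 0 <= 2^-1 ^+ n * H.
    by split; rewrite mulr_ge0 // ltW.
  rewrite /= /step exprS; move: (u n) Ps nPn axn xnb cyn ynd => [x y] /= Ps nPn *.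
  have EW : 2^-1 * 2^-1 ^+ n * W = 2^-1 * (2^-1 ^+ n * W) by rewrite mulrA.
  have EH : 2^-1 * 2^-1 ^+ n * H = 2^-1 * (2^-1 ^+ n * H) by rewrite mulrA.
  case: pselect => P1 /=; last by split=> //; rewrite ?EW ?EH; lra.
  case: pselect => P2 /=; last by split=> //; rewrite ?EW ?EH; lra.
  case: pselect => P3 /=; last by split=> //; rewrite ?EW ?EH; lra.
  split; rewrite ?EW ?EH; try lra.
  by move=> P4; apply: nPn; apply: Ps => //; rewrite EW EH.
have uS n : (u n).1 <= (u n.+1).1 <= (u n).1 + 2^-1 ^+ n.+1 * W /\
            (u n).2 <= (u n.+1).2 <= (u n).2 + 2^-1 ^+ n.+1 * H.
  have [hW hH] : 0 <= 2^-1 ^+ n * W /\ 0 <= 2^-1 ^+ n * H.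
    by split; rewrite mulr_ge0 // ltW.
  rewrite exprS /= /step -!mulrA.
  by do 3 (case: pselect => ? /=; last (split; apply/andP; split; lra));
    split; apply/andP; split; lra.
have [p pP] := nested_point W0 (fun n => proj1 (uS n)).
have [q qP] := nested_point H0 (fun n => proj2 (uS n)).
have := pP 0%N; have := qP 0%N; rewrite /= !mul1r => qI pI.
have [d d0 dP] := Ploc p q pI qI; have [n nd] := exists_half_exp d0.
have [nPn ? ? ? ?] := inv n; apply: nPn; apply: dP => //.
by rewrite pw.
Qed.

End Bisection.

(** * Contour integrals along rectangles *)
Section RectangleIntegral.
Variable R : realType.
Local Notation C := (Cx R).
Implicit Types (f g : C -> C) (a b c d : R).

Lemma continuous_hline c : continuous (fun x : R => (x +i* c) : C).
Proof.
by move=> t; apply: continuous_complex => /=; [exact: cvg_id|exact: cst_continuous].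
Qed.

Lemma continuous_vline a : continuous (fun y : R => (a +i* y) : C).
Proof.
by move=> t; apply: continuous_complex => /=; [exact: cst_continuous|exact: cvg_id].
Qed.

Definition bdry a b c d : set C := [set z |
  [/\ a <= complex.Re z <= b, c <= complex.Im z <= d &
    [\/ complex.Re z = a, complex.Re z = b | complex.Im z = c]
    \/ complex.Im z = d]].

Definition bcont a b c d f := forall z, bdry a b c d z -> {for z, continuous f}.

Definition rint f a b c d : C :=
  cint (fun x => f (x +i* c)) a b + 'i%C * cint (fun y => f (b +i* y)) c d
  - cint (fun x => f (x +i* d)) a b - 'i%C * cint (fun y => f (a +i* y)) c d.

Lemma seg_hline f a b c :
  (forall x, a <= x <= b -> {for (x +i* c : C), continuous f}) ->
  seg_continuous a b (fun x => f (x +i* c)).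
Proof.
move=> cf t /cf ft.
exact: (@continuous_comp _ _ _ (fun x : R => (x +i* c : C)) f t
  (@continuous_hline c t) ft).
Qed.

Lemma seg_vline f a c d :
  (forall y, c <= y <= d -> {for (a +i* y : C), continuous f}) ->
  seg_continuous c d (fun y => f (a +i* y)).
Proof.
move=> cf t /cf ft.
exact: (@continuous_comp _ _ _ (fun y : R => (a +i* y : C)) f t
  (@continuous_vline a t) ft).
Qed.

Lemma bcont_segs f a b c d : a <= b -> c <= d -> bcont a b c d f ->
  [/\ seg_continuous a b (fun x => f (x +i* c)),
      seg_continuous c d (fun y => f (b +i* y)),
      seg_continuous a b (fun x => f (x +i* d)) &
      seg_continuous c d (fun y => f (a +i* y))].
Proof.
move=> ab cd cf; split; [apply: seg_hline|apply: seg_vline|apply: seg_hline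
  |apply: seg_vline] => t tI; apply: cf; split=> //=; rewrite ?lexx ?ab ?cd //.
- by left; apply: Or33.
- by left; apply: Or32.
- by right.
- by left; apply: Or31.
Qed.

Lemma rintD f g a b c d : a <= b -> c <= d -> bcont a b c d f -> bcont a b c d g ->
  rint (fun z => f z + g z) a b c d = rint f a b c d + rint g a b c d.
Proof.
move=> ab cd cf cg; have [f1 f2 f3 f4] := bcont_segs ab cd cf.
have [g1 g2 g3 g4] := bcont_segs ab cd cg.
by rewrite /rint !cintD //; ring.
Qed.

Lemma rintZ f k a b c d : a <= b -> c <= d -> bcont a b c d f ->
  rint (fun z => k * f z) a b c d = k * rint f a b c d.
Proof.
move=> ab cd cf; have [f1 f2 f3 f4] := bcont_segs ab cd cf.
by rewrite /rint !cintZ //; ring.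
Qed.

Lemma eq_rint f g a b c d : a <= b -> c <= d ->
  (forall z, bdry a b c d z -> f z = g z) -> rint f a b c d = rint g a b c d.
Proof.
move=> ab cd fg; rewrite /rint.
congr (_ + 'i%C * _ - _ - 'i%C * _); apply: eq_cint => t tI; apply: fg;
  split=> //=; rewrite ?lexx ?ab ?cd //.
- by left; apply: Or33.
- by left; apply: Or32.
- by right.
- by left; apply: Or31.
Qed.

Lemma rint_le f a b c d M : a <= b -> c <= d -> bcont a b c d f ->
  (forall z, bdry a b c d z -> cabs (f z) <= M) ->
  cabs (rint f a b c d) <= 4 * M * ((b - a) + (d - c)).
Proof.
move=> ab cd cf fM; have [f1 f2 f3 f4] := bcont_segs ab cd cf.
have h1 : cabs (cint (fun x => f (x +i* c)) a b) <= 2 * M * (b - a).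
  apply: cint_le => // t tI; apply: fM; split=> //=; rewrite ?lexx ?ab ?cd //.
  by left; apply: Or33.
have h2 : cabs (cint (fun y => f (b +i* y)) c d) <= 2 * M * (d - c).
  apply: cint_le => // t tI; apply: fM; split=> //=; rewrite ?lexx ?ab ?cd //.
  by left; apply: Or32.
have h3 : cabs (cint (fun x => f (x +i* d)) a b) <= 2 * M * (b - a).
  apply: cint_le => // t tI; apply: fM; split=> //=; rewrite ?lexx ?ab ?cd //.
  by right.
have h4 : cabs (cint (fun y => f (a +i* y)) c d) <= 2 * M * (d - c).
  apply: cint_le => // t tI; apply: fM; split=> //=; rewrite ?lexx ?ab ?cd //.
  by left; apply: Or31.
rewrite /rint; apply: le_trans (cabsD _ _) _; rewrite cabsN cabsM cabs_i mul1r.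
have := cabsD (cint (fun x => f (x +i* c)) a b + 'i%C * cint (fun y => f (b +i* y)) c d)
  (- cint (fun x => f (x +i* d)) a b).
rewrite cabsN.
have := cabsD (cint (fun x => f (x +i* c)) a b) ('i%C * cint (fun y => f (b +i* y)) c d).
rewrite cabsM cabs_i mul1r; lra.
Qed.

Lemma rint_splitx f a m b c d : a <= m -> m <= b -> c <= d ->
  bcont a m c d f -> bcont m b c d f ->
  rint f a b c d = rint f a m c d + rint f m b c d.
Proof.
move=> am mb cd cf1 cf2.
have hl y : (y = c) \/ (y = d) -> seg_continuous a b (fun x => f (x +i* y)).
  move=> yE; apply: seg_hline => x /andP[ax xb].
  have [xm|/ltW mx] := leP x m; [apply: cf1|apply: cf2]; split=> /=.
  - by rewrite ax.
  - by case: yE => ->; rewrite lexx cd.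
  - by case: yE => ->; [left; apply: Or33|right].
  - by rewrite mx.
  - by case: yE => ->; rewrite lexx cd.
  - by case: yE => ->; [left; apply: Or33|right].
rewrite /rint (cint_split am mb (hl c _)); last by left.
rewrite (cint_split am mb (hl d _)); last by right.
by ring.
Qed.

Lemma rint_splity f a b c m d : a <= b -> c <= m -> m <= d ->
  bcont a b c m f -> bcont a b m d f ->
  rint f a b c d = rint f a b c m + rint f a b m d.
Proof.
move=> ab cm md cf1 cf2.
have hl x : (x = a) \/ (x = b) -> seg_continuous c d (fun y => f (x +i* y)).
  move=> xE; apply: seg_vline => y /andP[cy yd].
  have [ym|/ltW my] := leP y m; [apply: cf1|apply: cf2]; split=> /=.
  - by case: xE => ->; rewrite lexx ab.
  - by rewrite cy.
  - by left; case: xE => ->; [apply: Or31|apply: Or32].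
  - by case: xE => ->; rewrite lexx ab.
  - by rewrite my.
  - by left; case: xE => ->; [apply: Or31|apply: Or32].
rewrite /rint (cint_split cm md (hl a _)); last by left.
rewrite (cint_split cm md (hl b _)); last by right.
by ring.
Qed.

(** Affine functions are integrated explicitly, so that no primitive and no
    fundamental theorem of calculus along paths is involved. *)
Lemma rint_affine (k l : C) a b c d : a <= b -> c <= d ->
  rint (fun z => k + l * z) a b c d = 0.
Proof.
move=> ab cd.
have cr : continuous (fun t : R => t%:C : C) by exact: (@continuous_hline 0).
have H (k' l' : C) s t : s <= t -> cint (fun x : R => k' + l' * (x%:C : C)) s t =
    k' * (t - s)%:C + l' * ((t ^+ 2 - s ^+ 2) / 2)%:C.
  move=> st; rewrite cintD; last 2 first.
  - by move=> *; exact: cst_continuous.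
  - by move=> u _; exact: (cvgM (cvg_cst l') (cr u)).
  by rewrite cint_cst // cintZ ?cint_real // => u _; exact: cr.
have E (x y : R) : (x +i* y : C) = x%:C + 'i%C * (y%:C : C) by exact: complexE.
have Hh y : cint (fun x => k + l * ((x +i* y) : C)) a b =
    (k + l * ('i%C * (y%:C : C))) * (b - a)%:C + l * ((b ^+ 2 - a ^+ 2) / 2)%:C.
  rewrite -H //; apply: eq_cint => x _; rewrite E; ring.
have Hv x : cint (fun y => k + l * ((x +i* y) : C)) c d =
    (k + l * (x%:C : C)) * (d - c)%:C + l * 'i%C * ((d ^+ 2 - c ^+ 2) / 2)%:C.
  rewrite -H //; apply: eq_cint => y _; rewrite E; ring.
rewrite /rint !Hh !Hv; move: (_ / 2)%:C (_ / 2)%:C => B D.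
by rewrite !rmorphB /=; ring.
Qed.

End RectangleIntegral.

(** * Complex derivatives and Cauchy-Goursat on rectangles *)
Section Goursat.
Variable R : realType.
Local Notation C := (Cx R).
Implicit Types (f g : C -> C) (a b c d : R) (z w D : C).

(** The inequality includes the point itself, which spares the punctured
    neighbourhoods of the difference quotient. *)
Lemma derive_approxP f z D :
  is_derive z 1 f D <->
  forall e : R, 0 < e -> exists2 r : R, 0 < r &
    forall v, cabs (v - z) < r -> cabs (f v - f z - D * (v - z)) <= e * cabs (v - z).
Proof.
have quot (h : C) : h != 0 ->
    cabs (h^-1 *: (f (h *: (1 : C) + z) - f z) - D) =
    cabs (f (h + z) - f z - D * h) / cabs h.
  move=> h0; rewrite -cabsV -cabsM /GRing.scale /= mulr1; congr cabs.
  by rewrite mulrBl mulfK // mulrC.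
split=> [dfz e e0|H].
  have : (fun h : C => h^-1 *: (f (h *: (1 : C) + z) - f z)) @ 0^' --> D.
    have [df <-] := dfz; exact: df.
  move=> /cvg_cabsP /(_ e e0) [] /= s s0 sP.
  have /nbhs_cabsP [r r0 rP] : nbhs (0 : C) (ball_ Num.Def.normr (0 : C) s).
    by apply/nbhs_ballP; exists s => //= y; rewrite -ball_normE.
  exists r => // v vr; have [->|vz] := eqVneq v z.
    by rewrite !subrr mulr0 subrr cabs0 mulr0.
  have h0 : v - z != 0 by rewrite subr_eq0.
  have := sP (v - z); rewrite /ball_ /= => /(_ _ h0); rewrite quot // subrK.
  have hs : ball_ Num.Def.normr (0 : C) s (v - z) by apply: rP; rewrite subr0.
  by move=> /(_ hs); rewrite ltr_pdivrMr ?cabs_gt0 // => /ltW.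
suff cv : (fun h : C => h^-1 *: (f (h *: (1 : C) + z) - f z)) @ 0^' --> D.
  by apply: DeriveDef; [apply/cvg_ex; exists D|exact: cvg_lim].
apply/cvg_cabsP => e e0; have [r r0 rP] := H _ (divr_gt0 e0 (ltr0Sn R 1)).
have : nbhs (0 : C) [set v | cabs (v - 0) < r] by apply/nbhs_cabsP; exists r.
rewrite /dnbhs; apply: filterS => h /=; rewrite subr0 => hr h0; rewrite quot //.
rewrite ltr_pdivrMr ?cabs_gt0 //.
have := rP (h + z); rewrite addrK => /(_ hr) /le_lt_trans; apply.
rewrite ltr_pM2r ?cabs_gt0 //; lra.
Qed.

Lemma is_derive1P f z D : is_derive z 1 f D <-> derivable f z 1 /\ derive1 f z = D.
Proof. by rewrite derive1E; split=> [[]|[? ?]] //; exact: DeriveDef. Qed.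

Section PointwiseDerivation.
Variables (z : C).

Lemma derD f g df dg : is_derive z 1 f df -> is_derive z 1 g dg ->
  is_derive z 1 (fun v => f v + g v) (df + dg).
Proof. by move=> hf hg; exact: is_deriveD. Qed.

Lemma derB f g df dg : is_derive z 1 f df -> is_derive z 1 g dg ->
  is_derive z 1 (fun v => f v - g v) (df - dg).
Proof. by move=> hf hg; exact: is_deriveB. Qed.

Lemma derM f g df dg : is_derive z 1 f df -> is_derive z 1 g dg ->
  is_derive z 1 (fun v => f v * g v) (df * g z + f z * dg).
Proof.
move=> hf hg; have := @is_deriveM _ _ f g z 1 df dg hf hg.
by rewrite /GRing.scale /= addrC [g z * df]mulrC.
Qed.

Lemma derV f df : is_derive z 1 f df -> f z != 0 ->
  is_derive z 1 (fun v => (f v)^-1) (- (df / f z ^+ 2)).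
Proof.
move=> /is_derive1P[hf fd] f0; apply/is_derive1P; split; first exact: derivableV.
rewrite derive1E deriveV // -derive1E fd /GRing.scale /= mulNr mulrC; congr (- (_ * _)).
Qed.

Lemma der_cst (k : C) : is_derive z 1 (fun=> k) (0 : C).
Proof. exact: is_derive_cst. Qed.

Lemma der_id : is_derive z 1 (fun v : C => v) (1 : C).
Proof. exact: is_derive_id. Qed.

Lemma derX f df n : is_derive z 1 f df ->
  is_derive z 1 (fun v => f v ^+ n) (n%:R * f z ^+ n.-1 * df).
Proof.
move=> hf; elim: n => [|n IH].
  by rewrite mul0r mul0r; exact: der_cst.
have := derM hf IH; congr is_derive; first by apply/funext => v; rewrite exprS.
case: n {IH} => [|n]; first by rewrite /= expr0; ring.
by rewrite /= !exprS -[n.+2]addn1 natrD; ring.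
Qed.

Lemma near_der f g df : (\forall v \near z, f v = g v) -> is_derive z 1 f df ->
  is_derive z 1 g df.
Proof.
move=> fg /is_derive1P[hf fd]; apply/is_derive1P; split; first exact: near_eq_derivable fg hf.
by rewrite -fd !derive1E; apply/esym; exact: near_eq_derive.
Qed.

Lemma der_comp f g df dg : is_derive z 1 g dg -> is_derive (g z) 1 f df ->
  is_derive z 1 (fun v => f (g v)) (df * dg).
Proof.
move=> /derive_approxP Hg /derive_approxP Hf; apply/derive_approxP => e e0.
pose K := cabs dg + 1; have K0 : 0 < K by rewrite ltr_wpDl ?cabs_ge0.
pose L := cabs df + 1; have L0 : 0 < L by rewrite ltr_wpDl ?cabs_ge0.
have [r1 r10 h1] := Hf (e / (2 * K)) (divr_gt0 e0 (mulr_gt0 (ltr0Sn R 1) K0)).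
have m0 : 0 < Num.min 1 (e / (2 * L)) by rewrite lt_min ltr01 divr_gt0 // mulr_gt0.
have [r2 r20 h2] := Hg _ m0.
exists (Num.min r2 (r1 / K)); first by rewrite lt_min r20 divr_gt0.
move=> v; rewrite lt_min => /andP[vr2]; rewrite ltr_pdivlMr // => vr1.
set h := v - z in vr2 vr1 *; have hv := h2 v vr2; rewrite -/h in hv.
have hh0 := cabs_ge0 h.
have hv1 : cabs (g v - g z - dg * h) <= cabs h.
  by apply: le_trans hv _; rewrite -[leRHS]mul1r ler_wpM2r // ge_min lexx.
have hv2 : cabs (g v - g z - dg * h) <= e / (2 * L) * cabs h.
  by apply: le_trans hv _; rewrite ler_wpM2r // ge_min lexx orbT.
have gd : cabs (g v - g z) <= K * cabs h.
  have := cabsD (g v - g z - dg * h) (dg * h); rewrite subrK cabsM /K; move: hv1.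
  by move: (cabs _) (cabs _) (cabs _) => x y t; nra.
have gr1 : cabs (g v - g z) < r1 by apply: le_lt_trans gd _; rewrite mulrC.
have fd := h1 (g v) gr1.
have -> : f (g v) - f (g z) - df * dg * h =
    (f (g v) - f (g z) - df * (g v - g z)) + df * (g v - g z - dg * h) by ring.
apply: le_trans (cabsD _ _) _; rewrite cabsM.
have k1 : cabs (f (g v) - f (g z) - df * (g v - g z)) <= e / 2 * cabs h.
  apply: le_trans fd _; apply: le_trans (_ : e / (2 * K) * (K * cabs h) <= _).
    by rewrite ler_wpM2l // divr_ge0 ?mulr_ge0 ?ltW.
  by rewrite le_eqVlt; apply/orP; left; apply/eqP; field; rewrite gt_eqF.
have k2 : cabs df * cabs (g v - g z - dg * h) <= e / 2 * cabs h.
  apply: le_trans (_ : L * (e / (2 * L) * cabs h) <= _).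
    apply: ler_pM; rewrite ?cabs_ge0 //; by rewrite /L lerDl.
  by rewrite le_eqVlt; apply/orP; left; apply/eqP; field; rewrite gt_eqF.
rewrite (splitr e) mulrDl; exact: lerD.
Qed.

End PointwiseDerivation.

Lemma derivable_continuous f z : derivable f z 1 -> {for z, continuous f}.
Proof. by move=> /derivable1_diffP/differentiable_continuous. Qed.

Lemma rint_quarters f x y u v : 0 <= u -> 0 <= v ->
  (forall z, x <= complex.Re z <= x + u + u -> y <= complex.Im z <= y + v + v ->
     {for z, continuous f}) ->
  rint f x (x + u + u) y (y + v + v) =
    rint f x (x + u) y (y + v) + rint f x (x + u) (y + v) (y + v + v) +
    (rint f (x + u) (x + u + u) y (y + v) +
     rint f (x + u) (x + u + u) (y + v) (y + v + v)).
Proof.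
move=> u0 v0 cf.
have [xu xuu] : x <= x + u /\ x + u <= x + u + u by split; rewrite lerDl.
have [yv yvv] : y <= y + v /\ y + v <= y + v + v by split; rewrite lerDl.
have bc x1 x2 y1 y2 : x <= x1 -> x2 <= x + u + u -> y <= y1 -> y2 <= y + v + v ->
    bcont x1 x2 y1 y2 f.
  move=> h1 h2 h3 h4 z [/andP[h5 h6] /andP[h7 h8] _]; apply: cf.
    by rewrite (le_trans h1 h5) (le_trans h6 h2).
  by rewrite (le_trans h3 h7) (le_trans h8 h4).
rewrite (@rint_splitx _ f x (x + u) (x + u + u)) //; try exact: bc.
- rewrite (@rint_splity _ f x (x + u) y (y + v)) //; try exact: bc.
  by rewrite (@rint_splity _ f (x + u) (x + u + u) y (y + v)) //; exact: bc.
- exact: le_trans yvv.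
Qed.

(** Goursat's argument: with f replaced by f minus its tangent affine function
    at a point, whose contour integral is zero, the integral over a rectangle of
    relative size s around the point is at most e s^2.  This bound adds up
    over the four quarters, so it spreads to the whole rectangle. *)
Lemma goursat f a b c d : a <= b -> c <= d ->
  (forall z, a <= complex.Re z <= b -> c <= complex.Im z <= d -> derivable f z 1) ->
  rint f a b c d = 0.
Proof.
move=> ab cd df; pose W := b - a; pose H := d - c.
have [W0 H0] : 0 <= W /\ 0 <= H by rewrite !subr_ge0.
have bE : b = a + W by rewrite /W; lra.
have dE : d = c + H by rewrite /H; lra.
suff small e : 0 < e -> cabs (rint f a b c d) <= e.
  apply/eqP; rewrite -cabs_eq0 eq_le cabs_ge0 andbT; apply/ler_addgt0Pr => e e0.
  by rewrite add0r small.
move=> e0; pose P x y s := cabs (rint f x (x + s * W) y (y + s * H)) <= e * s ^+ 2.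
suff : P a c 1 by rewrite /P !mul1r -bE -dE expr1n mulr1.
have bc x y s : 0 < s -> a <= x -> x + s * W <= a + W -> c <= y ->
    y + s * H <= c + H -> bcont x (x + s * W) y (y + s * H) f.
  move=> s0 ax xb cy yd z [/andP[? ?] /andP[? ?] _]; apply: derivable_continuous.
  by apply: df; apply/andP; split; lra.
apply: (@rectangle_induction _ P a c W H) => //.
  move=> x y s s0 ax xb cy yd; rewrite /P.
  have hs0 : 0 < 2^-1 * s by rewrite mulr_gt0 // invr_gt0.
  have hW : 0 <= s * W by rewrite mulr_ge0 // ltW.
  have hH : 0 <= s * H by rewrite mulr_ge0 // ltW.
  set u := 2^-1 * s * W; set v := 2^-1 * s * H.
  have uE : s * W = 2 * u by rewrite /u; field.
  have vE : s * H = 2 * v by rewrite /v; field.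
  have u0 : 0 <= u by lra.
  have v0 : 0 <= v by lra.
  have E1 : x + s * W = x + u + u by lra.
  have E2 : y + s * H = y + v + v by lra.
  have -> : e * (2^-1 * s) ^+ 2 = e * s ^+ 2 / 4 by field.
  move=> h1 h2 h3 h4.
  rewrite E1 E2 rint_quarters //; last first.
    move=> z zx zy; apply: derivable_continuous.
    rewrite -E1 in zx; rewrite -E2 in zy; move: zx zy => /andP[x1 x2] /andP[y1 y2].
    apply: df; rewrite ?bE ?dE.
      by rewrite (le_trans ax x1) (le_trans x2 xb).
    by rewrite (le_trans cy y1) (le_trans y2 yd).
  set I1 := rint f x _ y _ in h1 *; set I3 := rint f (x + u) _ y _ in h2 *.
  set I2 := rint f x _ (y + v) _ in h3 *; set I4 := rint f (x + u) _ (y + v) _ in h4 *.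
  move: h1 h2 h3 h4; move: I1 I2 I3 I4 => I1 I2 I3 I4 h1 h2 h3 h4.
  have T1 := cabsD (I1 + I2) (I3 + I4); have T2 := cabsD I1 I2.
  have T3 := cabsD I3 I4.
  by lra.
move=> p q /andP[ap pb] /andP[cq qd]; pose z0 : C := p +i* q.
have /derivableP/derive_approxP df0 : derivable f z0 1.
  by apply: df => /=; apply/andP; split; lra.
(* Every point of a rectangle of relative size s that contains z0 is within s K of z0. *)
pose K := W + H + 1; have K0 : 0 < K by rewrite /K; lra.
have e'0 : 0 < e / (4 * K ^+ 2) by rewrite divr_gt0 // mulr_gt0 // exprn_gt0.
have [r r0 rP] := df0 _ e'0; set D := 'D_1 f z0 in rP.
exists (r / K); first by rewrite divr_gt0.
move=> x y s /andP[s0]; rewrite ltr_pdivlMr // => sr ax xb cy yd.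
move=> /andP[xp px] /andP[yq qy]; rewrite /P.
have hW : 0 <= s * W by rewrite mulr_ge0 // ltW.
have hH : 0 <= s * H by rewrite mulr_ge0 // ltW.
have xx : x <= x + s * W by lra.
have yy : y <= y + s * H by lra.
have caff (k : C) : bcont x (x + s * W) y (y + s * H) (fun z => k + (- D) * (z - z0) : C).
  move=> z _; apply: contD; first exact: cont_cst.
  apply: contM; first exact: cont_cst.
  by apply: contB; [exact: cont_id|exact: cont_cst].
have dist z : bdry x (x + s * W) y (y + s * H) z -> cabs (z - z0) <= s * K.
  move=> [/andP[h1 h2] /andP[h3 h4] _]; apply: le_trans (cabs_le_ReIm _) _.
  rewrite cxReD cxReN cxImD cxImN /= /K mulrDr mulr1 mulrDr.
  have : `|complex.Re z - p| <= s * W by rewrite ler_norml; apply/andP; split; lra.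
  have : `|complex.Im z - q| <= s * H by rewrite ler_norml; apply/andP; split; lra.
  by lra.
have E : rint f x (x + s * W) y (y + s * H) =
    rint (fun z => f z - f z0 - D * (z - z0)) x (x + s * W) y (y + s * H).
  rewrite (@eq_rint _ (fun z => f z - f z0 - D * (z - z0))
    (fun z => f z + (- f z0 + (- D) * (z - z0)))) //; last by move=> z _; ring.
  rewrite rintD //; last exact: bc.
  rewrite (@eq_rint _ (fun z => - f z0 + (- D) * (z - z0))
    (fun z => (- f z0 + D * z0) + (- D) * z)) //; last by move=> z _; ring.
  by rewrite rint_affine // addr0.
rewrite E; apply: le_trans.
  apply: (@rint_le _ _ _ _ _ _ (e / (4 * K ^+ 2) * (s * K))) => //.
    move=> z zb; have := caff (- f z0) z zb.
    have /(_ z zb) := bc x y s s0 ax xb cy yd.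
    move=> cz caz; have := contD cz caz; congr continuous_at.
    by apply/funext => t /=; ring.
  move=> z zb; have zs := dist z zb; have zr : cabs (z - z0) < r by lra.
  by apply: le_trans (rP z zr) _; rewrite ler_wpM2l // ltW.
have -> : 4 * (e / (4 * K ^+ 2) * (s * K)) * (x + s * W - x + (y + s * H - y)) =
    e * s ^+ 2 * ((W + H) / K) by rewrite /K; field; rewrite -/K; lra.
apply: ler_piMr; first by rewrite mulr_ge0 ?sqr_ge0 // ltW.
by rewrite ler_pdivrMr // /K mul1r lerDl.
Qed.

End Goursat.

(** * Cauchy's formula on a rectangle *)
Section Cauchy.
Variable R : realType.
Local Notation C := (Cx R).
Implicit Types (f g : C -> C) (z w : C) (a b c d : R).

(** The region between two nested rectangles is cut into four rectangles on
    which Goursat applies. *)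
Lemma rint_frame f a a' b' b c c' d' d :
  a <= a' -> a' <= b' -> b' <= b -> c <= c' -> c' <= d' -> d' <= d ->
  (forall z, a <= complex.Re z <= b -> c <= complex.Im z <= d ->
     ~ (a' < complex.Re z < b' /\ c' < complex.Im z < d') -> derivable f z 1) ->
  rint f a b c d = rint f a' b' c' d'.
Proof.
move=> aa ab bb cc cd dd df.
have ab' := le_trans ab bb; have aab := le_trans aa ab.
have cd' := le_trans cd dd; have ccd := le_trans cc cd.
have cD := le_trans ccd dd; have aB := le_trans aab bb.
have bc1 x1 x2 : a <= x1 -> x2 <= b -> (x2 <= a' \/ b' <= x1) ->
    forall z, x1 <= complex.Re z <= x2 -> c <= complex.Im z <= d -> derivable f z 1.
  move=> h1 h2 h3 z /[dup] zI /andP[h5 h6] zJ; apply: df => //.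
    by rewrite (le_trans h1 h5) (le_trans h6 h2).
  move=> [/andP[h7 h8] _]; case: h3 => h3.
    by have := lt_le_trans h7 (le_trans h6 h3); rewrite ltxx.
  by have := lt_le_trans h8 (le_trans h3 h5); rewrite ltxx.
have bc2 x1 x2 y1 y2 : a <= x1 -> x2 <= b -> c <= y1 -> y2 <= d ->
    (y2 <= c' \/ d' <= y1) ->
    forall z, x1 <= complex.Re z <= x2 -> y1 <= complex.Im z <= y2 -> derivable f z 1.
  move=> k1 k2 h1 h2 h3 z /[dup] zJ /andP[k5 k6] /[dup] zI /andP[h5 h6]; apply: df.
  - by rewrite (le_trans k1 k5) (le_trans k6 k2).
  - by rewrite (le_trans h1 h5) (le_trans h6 h2).
  move=> [_ /andP[h7 h8]]; case: h3 => h3.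
    by have := lt_le_trans h7 (le_trans h6 h3); rewrite ltxx.
  by have := lt_le_trans h8 (le_trans h3 h5); rewrite ltxx.
have bco x1 x2 y1 y2 : (forall z, x1 <= complex.Re z <= x2 ->
    y1 <= complex.Im z <= y2 -> derivable f z 1) -> bcont x1 x2 y1 y2 f.
  by move=> H z [zx zy _]; apply: derivable_continuous; exact: H.
have bcm y1 y2 : c <= y1 -> y2 <= d -> y1 <= c' \/ y1 = d' -> y2 = c' \/ d' <= y2 ->
    bcont a' b' y1 y2 f.
  move=> h1 h2 h3 h4 z [/[dup] zI /andP[x1 x2] /[dup] zJ /andP[y1z zy2] zb].
  apply: derivable_continuous; apply: df.
  - by rewrite (le_trans aa x1) (le_trans x2 bb).
  - by rewrite (le_trans h1 y1z) (le_trans zy2 h2).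
  move=> [/andP[k1 k2] /andP[k3 k4]].
  case: zb => [[e|e|e]|e].
  - by move: k1; rewrite e ltxx.
  - by move: k2; rewrite e ltxx.
  - case: h3 => h3; first by move: k3; rewrite e => /lt_le_trans/(_ h3); rewrite ltxx.
    by move: k4; rewrite e h3 ltxx.
  - case: h4 => h4; first by move: k3; rewrite e h4 ltxx.
    by move: k4; rewrite e => /lt_le_trans/(_ h4); rewrite ltxx.
have dl : forall z, a <= complex.Re z <= a' -> c <= complex.Im z <= d -> derivable f z 1.
  by apply: bc1 => //; left.
have dr : forall z, b' <= complex.Re z <= b -> c <= complex.Im z <= d -> derivable f z 1.
  by apply: bc1 => //; right.
have db : forall z, a' <= complex.Re z <= b' -> c <= complex.Im z <= c' -> derivable f z 1.
  by apply: bc2 => //; left.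
have dt : forall z, a' <= complex.Re z <= b' -> d' <= complex.Im z <= d -> derivable f z 1.
  by apply: bc2 => //; right.
have bcl : bcont a' b c d f.
  move=> z [/andP[x1 x2] zy zb]; apply: derivable_continuous; apply: df => //.
    by rewrite (le_trans aa x1).
  move=> [/andP[k1 k2] /andP[k3 k4]]; case: zb => [[e|e|e]|e].
  - by move: k1; rewrite e ltxx.
  - by have := lt_le_trans k2 bb; rewrite e ltxx.
  - by have := le_lt_trans cc k3; rewrite e ltxx.
  - by have := lt_le_trans k4 dd; rewrite e ltxx.
rewrite (@rint_splitx _ f a a' b) //; last exact: bco dl.
rewrite goursat // add0r (@rint_splitx _ f a' b' b) //; last 2 first.
- by apply: bcm => //; [left|right].
- exact: bco dr.
rewrite (goursat _ _ dr) // addr0 (@rint_splity _ f a' b' c c' d) //; last 2 first.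
- exact: bco db.
- by apply: bcm => //; [left|right].
rewrite (goursat _ _ db) // add0r (@rint_splity _ f a' b' c' d' d) //; last 2 first.
- by apply: bcm => //; [left|right].
- exact: bco dt.
by rewrite (goursat _ _ dt) // addr0.
Qed.

(** An isolated singularity near which the function stays bounded does not
    contribute: the contour can be shrunk onto it. *)
Lemma rint_punctured q w a b c d (M r : R) :
  a < complex.Re w < b -> c < complex.Im w < d -> 0 < r ->
  (forall z, a <= complex.Re z <= b -> c <= complex.Im z <= d -> z != w ->
     derivable q z 1) ->
  (forall z, z != w -> cabs (z - w) < r -> cabs (q z) <= M) ->
  rint q a b c d = 0.
Proof.
move=> /andP[aw wb] /andP[cw wd] r0 dq qM; set x := complex.Re w in aw wb *.
set y := complex.Im w in cw wd *.
suff small e : 0 < e -> cabs (rint q a b c d) <= e.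
  apply/eqP; rewrite -cabs_eq0 eq_le cabs_ge0 andbT; apply/ler_addgt0Pr => e e0.
  by rewrite add0r small.
move=> e0; pose N := `|M| + 1.
have N0 : 0 < N by rewrite ltr_wpDl.
pose t := Num.min (Num.min (Num.min (x - a) (b - x)) (Num.min (y - c) (d - y)))
  (Num.min (r / 3) (e / (16 * N))).
have t0 : 0 < t.
  by rewrite !lt_min !subr_gt0 aw wb cw wd !divr_gt0 // mulr_gt0.
have [t1 t2 t3 t4] : [/\ t <= x - a, t <= b - x, t <= y - c & t <= d - y].
  by rewrite /t !ge_min !lexx ?orbT.
have [t5 t6] : t <= r / 3 /\ t <= e / (16 * N) by rewrite /t !ge_min !lexx ?orbT.
have bd z : bdry (x - t) (x + t) (y - t) (y + t) z -> z != w /\ cabs (z - w) < r.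
  move=> [/andP[h1 h2] /andP[h3 h4] zb]; split.
    apply/eqP => zw; move: zb; rewrite zw -/x -/y; clear -t0.
    by move=> [[e1|e1|e1]|e1]; lra.
  apply: le_lt_trans (cabs_le_ReIm _) _; rewrite cxReD cxReN cxImD cxImN -/x -/y.
  have k1 : `|complex.Re z - x| <= t by rewrite ler_norml; apply/andP; split; lra.
  have k2 : `|complex.Im z - y| <= t by rewrite ler_norml; apply/andP; split; lra.
  by move: k1 k2 t0 t5; clear; lra.
rewrite (@rint_frame _ a (x - t) (x + t) b c (y - t) (y + t) d); last 7 first.
all: try by move: t0 t1 t2 t3 t4; clear; lra.
  move=> z zx zy nz; apply: dq => //; apply/eqP => zw; apply: nz; rewrite zw -/x -/y.
  by move: t0; clear => t0; split; apply/andP; split; lra.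
apply: le_trans (_ : 4 * N * ((x + t - (x - t)) + (y + t - (y - t))) <= _).
  apply: rint_le; try by move: t0; clear; lra.
    move=> z zb; have [zw zr] := bd z zb; apply: derivable_continuous.
    case: zb => /andP[h1 h2] /andP[h3 h4] _; apply: dq => //; apply/andP; split;
      move: h1 h2 h3 h4 t1 t2 t3 t4; clear; lra.
  move=> z /bd[zw zr]; apply: le_trans (qM z zw zr) _.
  by apply: le_trans (ler_norm _) _; rewrite lerDl.
move: t6; rewrite ler_pdivlMr ?mulr_gt0 //; clear; lra.
Qed.

(** The quotient (f z - f w)/(z - w) is bounded near w, so w does not contribute to its
    integral.  The integral of 1/(z - w) is left unevaluated: only
    that it is nonzero will matter, which avoids the number pi. *)
Lemma cauchy_formula f w a b c d :
  a < complex.Re w < b -> c < complex.Im w < d ->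
  (forall z, a <= complex.Re z <= b -> c <= complex.Im z <= d -> derivable f z 1) ->
  rint (fun z => f z * (z - w)^-1) a b c d = f w * rint (fun z => (z - w)^-1) a b c d.
Proof.
move=> /[dup] wx /andP[aw wb] /[dup] wy /andP[cw wd] df.
have [ab cd] : a <= b /\ c <= d by split; apply: ltW; [apply: lt_trans aw wb|apply: lt_trans cw wd].
have bw z : bdry a b c d z -> z - w != 0.
  move=> [_ _ zb]; apply/eqP => /eqP; rewrite subr_eq0 => /eqP zw; move: zb aw wb cw wd.
  by rewrite zw => -[[e|e|e]|e]; rewrite e ltxx.
have bV : bcont a b c d (fun z => (z - w)^-1).
  move=> z zb; apply: contV; last exact: bw.
  by apply: contB; [exact: cont_id|exact: cont_cst].
have bf : bcont a b c d f.
  by move=> z [zx zy _]; apply: derivable_continuous; exact: df.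
have wdf : derivable f w 1 by apply: df; apply/andP; split; exact: ltW.
have /derive_approxP/(_ 1 ltr01)[r r0 rP] := @derivableP _ _ _ _ _ _ wdf.
set D := 'D_1 f w in rP.
pose q z : C := (f z - f w) * (z - w)^-1.
have : rint q a b c d = 0.
  apply: (rint_punctured (M := cabs D + 1) wx wy r0).
    move=> z zx zy zw; apply: derivableM.
      by apply: derivableB; [exact: df|exact: derivable_cst].
    apply: derivableV; first by rewrite subr_eq0.
    by apply: derivableB; [exact: derivable_id|exact: derivable_cst].
  move=> z zw zr; rewrite /q cabsM cabsV ler_pdivrMr ?cabs_gt0 ?subr_eq0 //.
  have := rP z zr; have := cabsD (f z - f w - D * (z - w)) (D * (z - w)).
  by rewrite subrK cabsM; move: (cabs _) (cabs _) => *; lra.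
rewrite (@eq_rint _ q (fun z => f z * (z - w)^-1 + (- f w) * (z - w)^-1) _ _ _ _ ab cd); last first.
  by move=> z _; rewrite /q; ring.
have p1 : bcont a b c d (fun z => f z * (z - w)^-1).
  by move=> z zb; apply: contM; [exact: bf|exact: bV].
have p2 : bcont a b c d (fun z => (- f w) * (z - w)^-1).
  by move=> z zb; apply: contM; [exact: cont_cst|exact: bV].
rewrite (rintD ab cd p1 p2) (rintZ _ ab cd bV) mulNr => /eqP.
by rewrite subr_eq0 => /eqP.
Qed.

Lemma Re_inv z : complex.Re z^-1 = complex.Re z / cabs z ^+ 2.
Proof. by rewrite cabs_sq; case: z. Qed.

Lemma Im_inv z : complex.Im z^-1 = - complex.Im z / cabs z ^+ 2.
Proof. by rewrite cabs_sq; case: z => u v /=; rewrite mulNr. Qed.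

(** Each of the four sides contributes a nonnegative imaginary part, since the
    point lies on the left of each of them. *)
Lemma winding_neq0 w a b c d :
  a < complex.Re w < b -> c < complex.Im w < d ->
  rint (fun z => (z - w)^-1) a b c d != 0.
Proof.
set x := complex.Re w; set y := complex.Im w.
move=> /[dup] wx /andP[aw wb] /[dup] wy /andP[cw wd].
have [ab cd] : a < b /\ c < d by split; [apply: lt_trans aw wb|apply: lt_trans cw wd].
have bw z : bdry a b c d z -> z - w != 0.
  move=> [_ _ zb]; apply/eqP => /eqP; rewrite subr_eq0 => /eqP zw; move: zb aw wb cw wd.
  by rewrite zw -/x -/y => -[[e|e|e]|e]; rewrite e ltxx.
have bV : bcont a b c d (fun z => (z - w)^-1).
  move=> z zb; apply: contV; last exact: bw.
  by apply: contB; [exact: cont_id|exact: cont_cst].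
have [s1 s2 s3 s4] := bcont_segs (ltW ab) (ltW cd) bV.
have N0 z : 0 <= (cabs (z - w) ^+ 2)^-1 by rewrite invr_ge0 exprn_ge0 ?cabs_ge0.
have intc (k u v : R) : (@lebesgue_measure R).-integrable `[u, v] (EFin \o (fun=> k)).
  by apply: (@seg_integrable _ (fun=> k)) => t _; exact: cst_continuous.
have h1 : 0 < complex.Im (cint (fun t => ((t +i* c : C) - w)^-1) a b).
  pose K := (b - a) ^+ 2 + (d - c) ^+ 2.
  have K0 : 0 < K by rewrite ltr_wpDl ?sqr_ge0 // exprn_gt0 // subr_gt0.
  apply: (@lt_le_trans _ _ ((y - c) / K * (b - a))).
    by rewrite mulr_gt0 ?divr_gt0 // subr_gt0.
  rewrite -fine_leb_itv ?(ltW ab) // -Rintegral_cst //.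
  apply: le_Rintegral => //; first exact: seg_integrable_Im.
  move=> t; rewrite /= in_itv /= => /andP[ta tb].
  rewrite Im_inv cxImD cxImN /= -/y opprB; apply: ler_wpM2l; first by rewrite subr_ge0 ltW.
  have tw : bdry a b c d (t +i* c) by split; rewrite /= ?ta ?tb ?lexx ?(ltW cd) //; left; apply: Or33.
  rewrite lef_pV2 ?posrE ?exprn_gt0 ?cabs_gt0 ?bw //.
  rewrite cabs_sq cxReD cxReN cxImD cxImN /= -/x -/y; apply: lerD.
    by rewrite -[leLHS]real_normK ?num_real // ler_sqr ?nnegrE ?subr_ge0 //; last exact: ltW; rewrite ler_norml; apply/andP; split; lra.
  by rewrite -[leLHS]real_normK ?num_real // ler_sqr ?nnegrE ?subr_ge0 //; last exact: ltW; rewrite ler_norml; apply/andP; split; lra.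
have h2 : 0 <= complex.Re (cint (fun t => ((b +i* t : C) - w)^-1) c d).
  apply: Rintegral_ge0 => t _; rewrite Re_inv cxReD cxReN /= -/x.
  by rewrite mulr_ge0 // subr_ge0 ltW.
have le0 (u : R -> R) p q : (@lebesgue_measure R).-integrable `[p, q] (EFin \o u) ->
    (forall t, p <= t <= q -> u t <= 0) ->
    (\int[@lebesgue_measure R]_(t in `[p, q]) u t)%R <= 0.
  move=> iu u0; rewrite -[leRHS](mul0r (fine ((@lebesgue_measure R) `[p, q]))).
  by rewrite -Rintegral_cst //; apply: le_Rintegral => // t; rewrite /= in_itv /=; exact: u0.
have h3 : complex.Im (cint (fun t => ((t +i* d : C) - w)^-1) a b) <= 0.
  apply: le0; first exact: seg_integrable_Im.
  by move=> t _; rewrite Im_inv cxImD cxImN /= -/y mulNr oppr_le0 mulr_ge0 // subr_ge0 ltW.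
have h4 : complex.Re (cint (fun t => ((a +i* t : C) - w)^-1) c d) <= 0.
  apply: le0; first exact: seg_integrable_Re.
  move=> t _; rewrite Re_inv cxReD cxReN /= -/x -oppr_ge0 -mulNr.
  by rewrite mulr_ge0 // opprB subr_ge0 ltW.
move: h1 h2 h3 h4; rewrite /rint.
move: (cint _ a b) (cint _ c d) (cint _ a b) (cint _ c d) => c1 c2 c3 c4; clear.
move=> h1 h2 h3 h4; apply/eqP => /(congr1 (@complex.Im R)).
by rewrite !(cxImD, cxImN, cxImM) /=; lra.
Qed.

Lemma bdry_bounded g a b c d : a <= b -> c <= d -> bcont a b c d g ->
  exists2 M, 0 <= M & forall z, bdry a b c d z -> cabs (g z) <= M.
Proof.
move=> ab cd cg; have [s1 s2 s3 s4] := bcont_segs ab cd cg.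
have bnd p q (u : R -> C) : p <= q -> seg_continuous p q u ->
    exists2 M, 0 <= M & forall t, p <= t <= q -> cabs (u t) <= M.
  move=> pq cu; have [|t _ tM] := @EVT_max R (fun t => cabs (u t)) p q pq.
    apply: continuous_in_subspaceT => t; rewrite inE /= in_itv /= => /cu ct.
    exact: (@continuous_comp _ _ _ u (@cabs R) t ct (@continuous_cabs R _)).
  by exists (cabs (u t)); [exact: cabs_ge0|move=> v vI; apply: tM; rewrite in_itv].
have [M1 M10 b1] := bnd _ _ _ ab s1; have [M2 M20 b2] := bnd _ _ _ cd s2.
have [M3 M30 b3] := bnd _ _ _ ab s3; have [M4 M40 b4] := bnd _ _ _ cd s4.
exists (M1 + M2 + M3 + M4); first by rewrite !addr_ge0.
move=> [u v] [/= ux vy] [[e|e|e]|e]; rewrite e.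
- by apply: le_trans (b4 _ vy) _; rewrite lerDr !addr_ge0.
- by apply: le_trans (b2 _ vy) _; rewrite -!addrA addrCA lerDl !addr_ge0.
- by apply: le_trans (b1 _ ux) _; rewrite -!addrA lerDl !addr_ge0.
- by apply: le_trans (b3 _ ux) _; rewrite addrAC lerDr !addr_ge0.
Qed.

End Cauchy.

(** * Integrals of Cauchy type and their expansion at a point *)
Section CauchyKernel.
Variable R : realType.
Local Notation C := (Cx R).
Variables (a b c d : R).
Hypotheses (ab : a < b) (cd : c < d).
Implicit Types (f g : C -> C) (z w h : C).

Definition inside w := (a < complex.Re w < b) /\ (c < complex.Im w < d).

Lemma bdry_dist w : inside w ->
  exists2 r : R, 0 < r & forall z, bdry a b c d z -> r <= cabs (z - w).
Proof.
move=> [/andP[aw wb] /andP[cw wd]]; set x := complex.Re w in aw wb *.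
set y := complex.Im w in cw wd *.
exists (Num.min (Num.min (x - a) (b - x)) (Num.min (y - c) (d - y))).
  by rewrite !lt_min !subr_gt0 aw wb cw wd.
move=> z [_ _ zb]; have := Re_le_cabs (z - w); have := Im_le_cabs (z - w).
rewrite cxReD cxReN cxImD cxImN -/x -/y !ge_min => hI hR.
case: zb => [[e|e|e]|e]; rewrite e in hI hR.
- by rewrite (le_trans (_ : x - a <= _) hR) // distrC ler_norm.
- by rewrite (le_trans (_ : b - x <= _) hR) ?orbT // ler_norm.
- by rewrite (le_trans (_ : y - c <= _) hI) ?orbT // distrC ler_norm.
- by rewrite (le_trans (_ : d - y <= _) hI) ?orbT // ler_norm.
Qed.

Lemma inside_near w : inside w -> \forall v \near w, inside v.
Proof.
move=> [/andP[aw wb] /andP[cw wd]].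
have cR := @continuous_Re R w; have cI := @continuous_Im R w.
near=> v; split; apply/andP; split; near: v.
- exact: (cvgr_gt _ cR).
- exact: (cvgr_lt _ cR).
- exact: (cvgr_gt _ cI).
- exact: (cvgr_lt _ cI).
Unshelve. all: by end_near.
Qed.

Lemma bcont_subV w : (forall z, bdry a b c d z -> z - w != 0) ->
  bcont a b c d (fun z => (z - w)^-1).
Proof.
move=> zw z zb; apply: contV; last exact: zw.
by apply: contB; [exact: cont_id|exact: cont_cst].
Qed.

(** Differentiation under the contour integral, for a kernel with a second
    order Taylor estimate that is uniform on the contour. *)
Lemma rint_derive (k : C -> C -> C) (k' : C -> C) w (B r : R) : 0 < r -> 0 <= B ->
  (forall h, cabs h < r -> bcont a b c d (k (w + h))) -> bcont a b c d k' ->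
  (forall h z, cabs h < r -> bdry a b c d z ->
     cabs (k (w + h) z - k w z - k' z * h) <= B * cabs h ^+ 2) ->
  is_derive w 1 (fun v => rint (k v) a b c d) (rint k' a b c d).
Proof.
move=> r0 B0 ck ck' kB; apply/derive_approxP => e e0.
pose K := 4 * B * ((b - a) + (d - c)) + 1.
have K0 : 0 < K by rewrite ltr_wpDl // !mulr_ge0 // addr_ge0 // subr_ge0 ltW.
exists (Num.min r (e / K)); first by rewrite lt_min r0 divr_gt0.
move=> v; rewrite lt_min => /andP[vr ve]; set h := v - w in vr ve *.
have vE : v = w + h by rewrite /h addrC subrK.
have ck0 : bcont a b c d (k w) by have := ck 0; rewrite cabs0 addr0; apply.
have ckN : bcont a b c d (fun z => -1 * k w z).
  by move=> z zb; apply: contM; [exact: cont_cst|exact: ck0].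
have ckh : bcont a b c d (fun z => - h * k' z).
  by move=> z zb; apply: contM; [exact: cont_cst|exact: ck'].
have ckS : bcont a b c d (fun z => -1 * k w z + - h * k' z).
  by move=> z zb; apply: contD; [exact: ckN|exact: ckh].
have ckA : bcont a b c d (fun z => k v z + (-1 * k w z + - h * k' z)).
  by move=> z zb; apply: contD; [rewrite vE; exact: ck|exact: ckS].
have E : rint (k v) a b c d - rint (k w) a b c d - rint k' a b c d * h =
    rint (fun z => k v z + (-1 * k w z + - h * k' z)) a b c d.
  have cv : bcont a b c d (k v) by rewrite vE; exact: ck.
  rewrite (rintD (ltW ab) (ltW cd) cv ckS) (rintD (ltW ab) (ltW cd) ckN ckh).
  by rewrite (rintZ _ (ltW ab) (ltW cd) ck0) (rintZ _ (ltW ab) (ltW cd) ck'); ring.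
rewrite E; apply: (@le_trans _ _ (4 * (B * cabs h ^+ 2) * ((b - a) + (d - c)))).
  apply: rint_le; [exact: ltW|exact: ltW|exact: ckA|].
  move=> z zb; have := kB h z vr zb; rewrite -vE.
  by congr (cabs _ <= _); ring.
have h0 := cabs_ge0 h; move: ve; rewrite ltr_pdivlMr // => ve.
have -> : 4 * (B * cabs h ^+ 2) * ((b - a) + (d - c)) = cabs h * (cabs h * (K - 1)).
  by rewrite /K; ring.
rewrite mulrC; apply: ler_wpM2r => //; move: ve h0; lra.
Qed.

Definition cauchy_int g w : C := rint (fun z => g z * (z - w)^-1) a b c d.
Definition cauchy_int2 g w : C := rint (fun z => g z * (z - w)^-1 ^+ 2) a b c d.

Lemma kernel_bounds w : inside w -> exists r M : R, [/\ 0 < r, 0 <= M &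
  forall h z, cabs h < r -> bdry a b c d z ->
   [/\ z - w != 0, z - (w + h) != 0, cabs (z - w)^-1 <= M & cabs (z - (w + h))^-1 <= M]].
Proof.
move=> /bdry_dist[r r0 rP]; have r20 : 0 < r / 2 by rewrite divr_gt0.
exists (r / 2), (r / 2)^-1; split=> //; first by rewrite invr_ge0 ltW.
move=> h z hr zb; have h1 := rP z zb.
have h2 : r / 2 <= cabs (z - (w + h)).
  have := cabsD (z - (w + h)) h; rewrite opprD addrA subrK.
  by move: h1 hr; lra.
have z1 : z - w != 0 by rewrite -cabs_gt0 (lt_le_trans r0).
have z2 : z - (w + h) != 0 by rewrite -cabs_gt0 (lt_le_trans r20).
split=> //; rewrite cabsV lef_pV2 ?posrE ?cabs_gt0 //.
by move: h1 r0; lra.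
Qed.

Lemma bcont_kernel g w n : bcont a b c d g -> (forall z, bdry a b c d z -> z - w != 0) ->
  bcont a b c d (fun z => g z * (z - w)^-1 ^+ n).
Proof.
move=> cg zw z zb; apply: contM; first exact: cg.
by apply: (@contX _ (fun z => (z - w)^-1)); exact: bcont_subV.
Qed.

Lemma bcont_kernel1 g w : bcont a b c d g -> (forall z, bdry a b c d z -> z - w != 0) ->
  bcont a b c d (fun z => g z * (z - w)^-1).
Proof. by move=> cg zw z zb; apply: contM; [exact: cg|exact: bcont_subV]. Qed.

Lemma cauchy_int_derive g w : bcont a b c d g -> inside w ->
  is_derive w 1 (cauchy_int g) (cauchy_int2 g w).
Proof.
move=> cg iw; have [r [M [r0 M0 rP]]] := kernel_bounds iw.
have [N N0 NP] := bdry_bounded (ltW ab) (ltW cd) cg.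
have B0 : 0 <= N * M ^+ 3 by rewrite mulr_ge0 // exprn_ge0.
have r0' : cabs (0 : C) < r by rewrite cabs0.
have ck h : cabs h < r -> bcont a b c d (fun z => g z * (z - (w + h))^-1).
  by move=> hr; apply: bcont_kernel1 => // z /(rP h z hr)[].
have ck' : bcont a b c d (fun z => g z * (z - w)^-1 ^+ 2).
  by apply: bcont_kernel => // z /(rP 0 z r0')[].
apply: (@rint_derive (fun v z => g z * (z - v)^-1) _ w _ r r0 B0 ck ck').
move=> h z hr zb; have [z1 z2 b1 b2] := rP h z hr zb.
have -> : g z * (z - (w + h))^-1 - g z * (z - w)^-1 - g z * (z - w)^-1 ^+ 2 * h =
    g z * ((z - (w + h))^-1 * (z - w)^-1 ^+ 2) * h ^+ 2.
  by field; rewrite z1 opprD addrA in z2 *; rewrite z2.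
rewrite [cabs (_ * h ^+ 2)]cabsM cabsX ler_wpM2r ?sqr_ge0 // 2!cabsM cabsX.
apply: ler_pM; rewrite ?cabs_ge0 ?mulr_ge0 ?exprn_ge0 ?cabs_ge0 ?NP //.
by rewrite [M ^+ 3]exprS; apply: ler_pM; rewrite ?exprn_ge0 ?cabs_ge0 // lerXn2r ?nnegrE ?cabs_ge0.
Qed.

Lemma cauchy_int2_derivable g w : bcont a b c d g -> inside w ->
  derivable (cauchy_int2 g) w 1.
Proof.
move=> cg iw; have [r [M [r0 M0 rP]]] := kernel_bounds iw.
have [N N0 NP] := bdry_bounded (ltW ab) (ltW cd) cg.
pose k' z := 2 * g z * (z - w)^-1 ^+ 3.
have B0 : 0 <= N * (3 * M ^+ 4) by rewrite !mulr_ge0 // exprn_ge0.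
have r0' : cabs (0 : C) < r by rewrite cabs0.
have ck h : cabs h < r -> bcont a b c d (fun z => g z * (z - (w + h))^-1 ^+ 2).
  by move=> hr; apply: bcont_kernel => // z /(rP h z hr)[].
have ck' : bcont a b c d k'.
  apply: (@bcont_kernel (fun z => 2 * g z)); last by move=> z /(rP 0 z r0')[].
  by move=> z zb; apply: contM; [exact: cont_cst|exact: cg].
have [] // : is_derive w 1 (cauchy_int2 g) (rint k' a b c d).
apply: (@rint_derive (fun v z => g z * (z - v)^-1 ^+ 2) k' w _ r r0 B0 ck ck').
move=> h z hr zb; have [z1 z2 b1 b2] := rP h z hr zb.
have -> : g z * (z - (w + h))^-1 ^+ 2 - g z * (z - w)^-1 ^+ 2 - k' z * h =
    g z * ((z - (w + h))^-1 * (z - w)^-1 ^+ 2 * ((z - (w + h))^-1 + 2 * (z - w)^-1))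
      * h ^+ 2.
  by rewrite /k'; field; rewrite z1 opprD addrA in z2 *; rewrite z2.
rewrite [cabs (_ * h ^+ 2)]cabsM cabsX ler_wpM2r ?sqr_ge0 // 3!cabsM cabsX.
apply: ler_pM; rewrite ?cabs_ge0 ?mulr_ge0 ?exprn_ge0 ?cabs_ge0 ?NP //.
have -> : 3 * M ^+ 4 = (M * M ^+ 2) * (3 * M) by ring.
apply: ler_pM; rewrite ?mulr_ge0 ?exprn_ge0 ?cabs_ge0 //.
  by apply: ler_pM; rewrite ?exprn_ge0 ?cabs_ge0 // lerXn2r ?nnegrE ?cabs_ge0.
apply: le_trans (cabsD _ _) _; rewrite cabsM.
have -> : cabs (2 : C) = 2.
  have -> : (2 : C) = (2 : R)%:C by rewrite rmorph_nat.
  by rewrite cabs_real ger0_norm.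
by move: b1 b2; lra.
Qed.

(** The first step of the geometric series
    1/(z - w) = 1/(z - w0) + (w - w0)/((z - w0)(z - w)). *)
Lemma cauchy_int_expand g w0 w : bcont a b c d g -> inside w0 -> inside w ->
  cauchy_int g w = cauchy_int g w0 + (w - w0) * cauchy_int (fun z => g z * (z - w0)^-1) w.
Proof.
move=> cg i0 i1.
have z0 z : bdry a b c d z -> z - w0 != 0.
  by have [r r0 rP] := bdry_dist i0 => /rP h; rewrite -cabs_gt0 (lt_le_trans r0).
have z1 z : bdry a b c d z -> z - w != 0.
  by have [r r0 rP] := bdry_dist i1 => /rP h; rewrite -cabs_gt0 (lt_le_trans r0).
have c0 := bcont_kernel1 cg z0; have c1 := bcont_kernel1 c0 z1.
have c2 : bcont a b c d (fun z => (w - w0) * (g z * (z - w0)^-1 * (z - w)^-1)).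
  by move=> z zb; apply: contM; [exact: cont_cst|exact: c1].
rewrite /cauchy_int -(rintZ _ (ltW ab) (ltW cd) c1) -(rintD (ltW ab) (ltW cd) c0 c2).
apply: eq_rint; [exact: ltW|exact: ltW|] => z zb.
by field; rewrite z0 // z1.
Qed.

(** Iterating the expansion of the kernel gives
    K g w = sum_{j < m} c_j (w - w0)^j + (w - w0)^m K g_m w with c_j = K g_j w0 and
    g_j = g/(z - w0)^j.  Either some c_j is nonzero, and the first of them gives
    the order of the zero, or the remainder, which is of order
    |(w - w0)/(z - w0)|^m, tends to 0 near w0. *)
Lemma cauchy_int_order g w0 : bcont a b c d g -> inside w0 ->
  (\forall w \near w0, cauchy_int g w = 0) \/
  exists m g', [/\ bcont a b c d g', cauchy_int g' w0 != 0 &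
    forall w, inside w -> cauchy_int g w = (w - w0) ^+ m * cauchy_int g' w].
Proof.
move=> cg i0.
have z0 z : bdry a b c d z -> z - w0 != 0.
  by have [r r0 rP] := bdry_dist i0 => /rP h; rewrite -cabs_gt0 (lt_le_trans r0).
pose gm m z := g z * (z - w0)^-1 ^+ m.
have cgm m : bcont a b c d (gm m) by exact: bcont_kernel.
have gm0 : gm 0%N = g by apply/funext => z; rewrite /gm expr0 mulr1.
have step m w : inside w ->
    cauchy_int (gm m) w = cauchy_int (gm m) w0 + (w - w0) * cauchy_int (gm m.+1) w.
  move=> iw; have e : (fun z => gm m z * (z - w0)^-1) = gm m.+1.
    by apply/funext => z; rewrite /gm exprSr mulrA.
  by rewrite (cauchy_int_expand (cgm m) i0 iw) e.
have pre m : (forall j, (j < m)%N -> cauchy_int (gm j) w0 = 0) ->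
    forall w, inside w -> cauchy_int g w = (w - w0) ^+ m * cauchy_int (gm m) w.
  elim: m => [|m IH] zj w iw; first by rewrite expr0 mul1r gm0.
  rewrite IH //; last by move=> j jm; apply: zj; rewrite ltnS ltnW.
  by rewrite (step m w iw) zj // add0r exprSr mulrA.
case: (pselect (exists m, cauchy_int (gm m) w0 != 0)) => [ex|nex]; last first.
  have {}nex m : cauchy_int (gm m) w0 = 0.
    by apply/eqP; apply: contrapT => /negP h; apply: nex; exists m.
  left; have [r r0 rP] := bdry_dist i0.
  have [M M0 MP] := bdry_bounded (ltW ab) (ltW cd) cg.
  have n1 : \forall w \near w0, cabs (w - w0) < r / 2.
    by apply/nbhs_cabsP; exists (r / 2); rewrite ?divr_gt0.
  apply: filterS2 n1 (inside_near i0) => w wr iw.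
  apply/eqP; rewrite -cabs_eq0 eq_le cabs_ge0 andbT; apply/ler_addgt0Pr => e e0.
  rewrite add0r; pose K := 4 * (M * (r / 2)^-1) * ((b - a) + (d - c)) + 1.
  have r20 : 0 < r / 2 by rewrite divr_gt0.
  have K0 : 0 < K.
    have bd0 : 0 <= (b - a) + (d - c) by rewrite addr_ge0 // subr_ge0 ltW.
    by rewrite ltr_wpDl // !mulr_ge0 // invr_ge0 ltW.
  have [n nP] := exists_half_exp (divr_gt0 e0 K0).
  rewrite (pre n (fun j _ => nex j) w iw) /cauchy_int cabsM cabsX.
  have zw z : bdry a b c d z -> r / 2 <= cabs (z - w).
    move=> /rP h; have := cabsD (z - w) (w - w0); rewrite addrA subrK.
    by move: h wr; lra.
  have zw0 z : bdry a b c d z -> z - w != 0.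
    by move=> /zw h; rewrite -cabs_gt0 (lt_le_trans r20).
  have hb : cabs (cauchy_int (gm n) w) <= 4 * (M * r^-1 ^+ n * (r / 2)^-1) * ((b - a) + (d - c)).
    apply: (rint_le (ltW ab) (ltW cd) (bcont_kernel1 (cgm n) zw0)).
    move=> z zb; rewrite /gm !cabsM cabsX !cabsV.
    apply: ler_pM; rewrite ?mulr_ge0 ?exprn_ge0 ?invr_ge0 ?cabs_ge0 //.
      apply: ler_pM; rewrite ?exprn_ge0 ?invr_ge0 ?cabs_ge0 ?MP //.
      rewrite lerXn2r ?nnegrE ?invr_ge0 ?cabs_ge0 ?(ltW r0) //.
      by rewrite lef_pV2 ?posrE ?cabs_gt0 ?z0 ?rP.
    by rewrite lef_pV2 ?posrE ?cabs_gt0 ?zw0 ?zw.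
  apply: le_trans (_ : (r / 2) ^+ n * (4 * (M * r^-1 ^+ n * (r / 2)^-1) * ((b - a) + (d - c))) <= _).
    apply: ler_pM; rewrite ?exprn_ge0 ?cabs_ge0 //.
    by rewrite lerXn2r ?nnegrE ?cabs_ge0 ?(ltW r20) ?(ltW wr).
  have -> : (r / 2) ^+ n * (4 * (M * r^-1 ^+ n * (r / 2)^-1) * ((b - a) + (d - c))) =
     (r / 2 * r^-1) ^+ n * (K - 1).
    rewrite [(_ * r^-1) ^+ n]exprMn /K.
    by move: ((r / 2) ^+ n) (r^-1 ^+ n) ((r / 2)^-1) => x y t; ring.
  have -> : r / 2 * r^-1 = 2^-1 by field; rewrite gt_eqF.
  move: nP; rewrite ltr_pdivlMr // => nP.
  have : 0 <= 2^-1 ^+ n :> R by rewrite exprn_ge0.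
  by move: nP; lra.
have [m m0 mmin] := @ex_minnP (fun m => cauchy_int (gm m) w0 != 0) ex.
right; exists m, (gm m); split; [exact: cgm|exact: m0|apply: pre => j jm].
by apply/eqP; apply: contraTT jm => /mmin; rewrite -leqNgt.
Qed.

End CauchyKernel.

(** * Local structure of holomorphic functions *)
Section Holomorphic.
Variable R : realType.
Local Notation C := (Cx R).
Implicit Types (f g : C -> C) (w : C).

Definition holo f w := \forall v \near w, derivable f v 1.

(** Near each point f is a quotient of two integrals of Cauchy type with the
    same kernel, the denominator being the winding number integral. *)
Lemma local_cauchy f w0 : holo f w0 -> exists a b c d : R,
  [/\ a < b, c < d, inside a b c d w0, bcont a b c d f &
   forall w, inside a b c d w -> cauchy_int a b c d (fun=> 1) w != 0 /\
     f w = cauchy_int a b c d f w / cauchy_int a b c d (fun=> 1) w].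
Proof.
move=> /nbhs_cabsP[r r0 rP]; pose t := r / 4.
have t0 : 0 < t by rewrite divr_gt0.
set x := complex.Re w0; set y := complex.Im w0.
have df z : x - t <= complex.Re z <= x + t -> y - t <= complex.Im z <= y + t ->
    derivable f z 1.
  move=> /andP[h1 h2] /andP[h3 h4]; apply: rP.
  apply: le_lt_trans (cabs_le_ReIm _) _; rewrite cxReD cxReN cxImD cxImN -/x -/y.
  have k1 : `|complex.Re z - x| <= t by rewrite ler_norml; apply/andP; split; lra.
  have k2 : `|complex.Im z - y| <= t by rewrite ler_norml; apply/andP; split; lra.
  by move: k1 k2 r0; rewrite /t; clear; lra.
exists (x - t), (x + t), (y - t), (y + t); split; [lra|lra| | |].
- by split; apply/andP; rewrite -/x -/y; split; lra.
- by move=> z [zx zy _]; apply: derivable_continuous; exact: df.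
move=> w [wx wy]; have n0 := winding_neq0 wx wy.
have e : cauchy_int (x - t) (x + t) (y - t) (y + t) (fun=> 1) w =
    rint (fun z => (z - w)^-1) (x - t) (x + t) (y - t) (y + t).
  by apply: eq_rint => [||z _]; [lra|lra|rewrite mul1r].
by rewrite e n0 /cauchy_int (cauchy_formula wx wy df) mulfK.
Qed.

Lemma bcont_cst a b c d (k : C) : bcont a b c d (fun=> k).
Proof. by move=> z _; exact: cont_cst. Qed.

(** The numerator of the local Cauchy representation factors by its order at
    w0; dividing by the denominator keeps the cofactor holomorphic. *)
Lemma holo_factor f w0 : holo f w0 ->
  (\forall w \near w0, f w = 0) \/
  exists m h, [/\ holo h w0, h w0 != 0 & \forall w \near w0, f w = (w - w0) ^+ m * h w].
Proof.
move=> /local_cauchy[a [b [c [d [ab cd i0 cf fE]]]]].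
have nI := inside_near i0.
have [f0|[m [g [cg g0 gE]]]] := cauchy_int_order ab cd cf i0.
  by left; apply: filterS2 f0 nI => w w0' /fE[_ ->]; rewrite w0' mul0r.
right; exists m, (fun w => cauchy_int a b c d g w / cauchy_int a b c d (fun=> 1) w).
split.
- apply: filterS nI => w iw; have [J0 _] := fE w iw.
  have := derM (cauchy_int_derive ab cd cg iw)
    (derV (cauchy_int_derive ab cd (@bcont_cst a b c d 1) iw) J0).
  by move=> /is_derive1P[].
- by rewrite mulf_neq0 ?invr_eq0 //; have [] := fE _ i0.
- by apply: filterS nI => w iw; have [_ ->] := fE w iw; rewrite gE // mulrA.
Qed.

(** Integrals of Cauchy type are twice differentiable, hence so is their quotient. *)
Lemma holo_derive f w0 : holo f w0 -> holo (derive1 f) w0.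
Proof.
move=> /local_cauchy[a [b [c [d [ab cd i0 cf fE]]]]].
pose J := cauchy_int a b c d (fun=> 1); pose J2 := cauchy_int2 a b c d (fun=> 1).
pose K := cauchy_int a b c d f; pose K2 := cauchy_int2 a b c d f.
have dJ w : inside a b c d w -> is_derive w 1 J (J2 w).
  by move=> iw; exact: (cauchy_int_derive ab cd (@bcont_cst a b c d 1) iw).
have dK w : inside a b c d w -> is_derive w 1 K (K2 w).
  by move=> iw; exact: (cauchy_int_derive ab cd cf iw).
have dJ2 w : inside a b c d w -> is_derive w 1 J2 ('D_1 J2 w).
  by move=> iw; apply: derivableP; exact: (cauchy_int2_derivable ab cd (@bcont_cst a b c d 1) iw).
have dK2 w : inside a b c d w -> is_derive w 1 K2 ('D_1 K2 w).
  by move=> iw; apply: derivableP; exact: (cauchy_int2_derivable ab cd cf iw).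
have J0 w : inside a b c d w -> J w != 0 by move=> /fE[].
have dE w : inside a b c d w ->
    K2 w * (J w)^-1 + K w * - (J2 w / J w ^+ 2) = derive1 f w.
  move=> iw; have nE : \forall v \near w, K v * (J v)^-1 = f v.
    by apply: filterS (inside_near iw) => v /fE[_ ->].
  by have /is_derive1P[_ ->] := near_der nE (derM (dK w iw) (derV (dJ w iw) (J0 w iw))).
apply: filterS (inside_near i0) => w iw.
have nE : \forall v \near w, K2 v * (J v)^-1 + K v * (0 - J2 v * (J v ^+ 2)^-1) = derive1 f v.
  by apply: filterS (inside_near iw) => v /dE <-; rewrite sub0r.
have J20 : J w ^+ 2 != 0 by rewrite expf_neq0 // J0.
have := near_der nE (derD (derM (dK2 w iw) (derV (dJ w iw) (J0 w iw)))
  (derM (dK w iw) (derB (der_cst w 0)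
    (derM (dJ2 w iw) (derV (derX 2 (dJ w iw)) J20))))).
by move=> /is_derive1P[].
Qed.

End Holomorphic.

(** Sealed, so that matching two pairings never unfolds them to traces of products. *)
HB.lock Definition trp (K : numClosedFieldType) n (A B : 'M[K]_n) : K := \tr (A *m B).

(** * Points and lines of the projective space as projectors *)
Section TracePairing.
Variables (K : numClosedFieldType) (n : nat).
Implicit Types (X Y Z : 'M[K]_n) (k : K).

Lemma trpE X Y : \tr (X *m Y) = trp X Y.
Proof. by rewrite unlock. Qed.

Lemma trp_sq_sub X Y k :
  trp (X - k *: Y) (X - k *: Y) = trp X X - 2 * k * trp X Y + k ^+ 2 * trp Y Y.
Proof.
rewrite unlock mulmxBl !mulmxBr -!scalemxAl -!scalemxAr !raddfB /= !mxtraceZ.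
by rewrite [\tr (Y *m X)]mxtrace_mulC; ring.
Qed.

Lemma trp_sq_add X Y : trp (X + Y) (X + Y) = trp X X + 2 * trp X Y + trp Y Y.
Proof.
by rewrite unlock mulmxDl !mulmxDr !mxtraceD [\tr (Y *m X)]mxtrace_mulC; ring.
Qed.

Lemma trpDr X Y Z : trp X (Y + Z) = trp X Y + trp X Z.
Proof. by rewrite unlock mulmxDr mxtraceD. Qed.

End TracePairing.

Section Projectors.
Variables (R : realType) (n : nat).
Local Notation C := (Cx R).
Local Notation vec := 'rV[C]_n.+1.
Local Notation mat := 'M[C]_n.+1.
Implicit Types (u v z h y : vec) (P A : mat) (k l m : C).

Definition hdot u v : C := (u *m v ^t*) 0 0.

Lemma hdotE u v : hdot u v = \sum_j u 0 j * (v 0 j)^*.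
Proof. by rewrite /hdot mxE; apply: eq_bigr => j _; rewrite !mxE. Qed.

Lemma hdotDl u u' v : hdot (u + u') v = hdot u v + hdot u' v.
Proof. by rewrite /hdot mulmxDl mxE. Qed.

Lemma hdotZl k u v : hdot (k *: u) v = k * hdot u v.
Proof. by rewrite /hdot -scalemxAl mxE. Qed.

Lemma hdotC u v : hdot v u = (hdot u v)^*.
Proof.
rewrite !hdotE rmorph_sum; apply: eq_bigr => j _.
by rewrite rmorphM /= conjCK mulrC.
Qed.

Lemma hdotDr u v v' : hdot u (v + v') = hdot u v + hdot u v'.
Proof. by rewrite ![hdot u _]hdotC hdotDl rmorphD. Qed.

Lemma hdotZr k u v : hdot u (k *: v) = k^* * hdot u v.
Proof. by rewrite ![hdot u _]hdotC hdotZl rmorphM. Qed.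

Lemma hdotNl u v : hdot (- u) v = - hdot u v.
Proof. by rewrite -scaleN1r hdotZl mulN1r. Qed.

Lemma hdot_sq u : hdot u u = (\sum_j cabs (u 0 j) ^+ 2)%:C.
Proof.
rewrite hdotE rmorph_sum; apply: eq_bigr => j _.
by rewrite -normCK normE rmorphXn.
Qed.

(** The real number of which hdot u u is the complex image. *)
Definition nsq u : R := \sum_j cabs (u 0 j) ^+ 2.

Lemma hdot_nsq u : hdot u u = (nsq u)%:C.
Proof. exact: hdot_sq. Qed.

Lemma nsq_ge0 u : 0 <= nsq u.
Proof. by apply: sumr_ge0 => j _; rewrite sqr_ge0. Qed.

Lemma nsq_eq0 u : (nsq u == 0) = (u == 0).
Proof.
apply/eqP/eqP => [u0|->]; last first.
  by rewrite /nsq big1 // => j _; rewrite mxE cabs0 expr0n.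
apply/rowP => j; rewrite mxE; apply/eqP; rewrite -cabs_eq0 -[_ == _]sqrf_eq0.
have := psumr_eq0P (fun (i : 'I_n.+1) _ => sqr_ge0 (cabs (u 0 i))) u0.
by move=> /(_ j isT) ->.
Qed.

Lemma nsq_gt0 u : (0 < nsq u) = (u != 0).
Proof. by rewrite lt_def nsq_ge0 andbT nsq_eq0. Qed.

Lemma hdot_eq0 u : (hdot u u == 0) = (u == 0).
Proof. by rewrite hdot_nsq -nsq_eq0 -(inj_eq (@complexI R)). Qed.

Lemma hdot_mul u v : hdot u v * hdot v u = (cabs (hdot u v) ^+ 2)%:C.
Proof. by rewrite [hdot v u]hdotC -normCK normE rmorphXn. Qed.

Lemma cabs_conj k : k * k^* = (cabs k ^+ 2)%:C.
Proof. by rewrite -normCK normE rmorphXn. Qed.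

Lemma outer_mul u v : (u ^t* *m u) *m (v ^t* *m v) = hdot u v *: (u ^t* *m v).
Proof.
rewrite mulmxA -[u ^t* *m u *m _]mulmxA [u *m v ^t*]mx11_scalar -/(hdot u v).
by rewrite mul_mx_scalar scalemxAl.
Qed.

Lemma trace_outer u v : \tr (u ^t* *m v) = hdot v u.
Proof. by rewrite mxtrace_mulC [v *m u ^t*]mx11_scalar mxtrace_scalar. Qed.

Lemma CPptE u : CPpt u = (hdot u u)^-1 *: (u ^t* *m u).
Proof. by []. Qed.

Lemma CPpt_scale k u : k != 0 -> CPpt (k *: u) = CPpt u.
Proof.
move=> k0; rewrite !CPptE hdotZl hdotZr.
have -> : (k *: u) ^t* = k^* *: u ^t* by apply/matrixP => i j; rewrite !mxE rmorphM.
rewrite -scalemxAl -scalemxAr !scalerA; congr (_ *: _).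
have [->|u0] := eqVneq (hdot u u) 0; first by rewrite !mulr0 invr0 !mul0r.
have kk : k^* != 0 by rewrite conjC_eq0.
by field; rewrite u0 k0 kk.
Qed.

Lemma mul_CPpt u v : u *m CPpt v = (hdot u v / hdot v v) *: v.
Proof.
rewrite CPptE -scalemxAr mulmxA [u *m v ^t*]mx11_scalar -/(hdot u v) mul_scalar_mx.
by rewrite scalerA mulrC.
Qed.

Lemma CPpt_inj u v : u != 0 -> v != 0 -> CPpt u = CPpt v ->
  exists2 k, k != 0 & v = k *: u.
Proof.
move=> u0 v0 e; have := mul_CPpt v v; rewrite -e mul_CPpt divff ?hdot_eq0 // scale1r.
move=> vE; exists (hdot v u / hdot u u); last by rewrite vE.
by apply: contraNneq v0 => k0; rewrite -vE k0 scale0r.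
Qed.

Lemma trace_CPpt2 u v :
  trp (CPpt u) (CPpt v) = (cabs (hdot u v) ^+ 2 / (nsq u * nsq v))%:C.
Proof.
rewrite -trpE !CPptE -scalemxAl -scalemxAr outer_mul !mxtraceZ trace_outer hdot_mul.
rewrite !hdot_nsq; move: (cabs _ ^+ 2) => c.
by rewrite rmorphM fmorphV rmorphM /= mulrA mulrC -invfM.
Qed.

Lemma trace_CPpt_id u : u != 0 -> trp (CPpt u) (CPpt u) = 1.
Proof.
move=> u0; rewrite trace_CPpt2 hdot_nsq cabs_real ger0_norm ?nsq_ge0 //.
have u0' : nsq u != 0 by rewrite nsq_eq0.
by rewrite expr2 divff ?rmorph1 // mulf_neq0.
Qed.

Lemma proj_map_CPpt P u : P \in unitmx -> u != 0 ->
  proj_map P (CPpt u) = CPpt (u *m P).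
Proof.
move=> uP u0; rewrite /proj_map; apply: xget_unique => /=; first by exists u; split.
move=> A' [v [v0 uv ->]]; have [k k0 ->] := CPpt_inj u0 v0 uv.
by rewrite -scalemxAl CPpt_scale.
Qed.

Lemma mulmx_unit_neq0 P u : P \in unitmx -> u != 0 -> u *m P != 0.
Proof.
move=> uP u0; apply: contraNneq u0 => uP0.
by rewrite -(mulmxK uP u) uP0 mul0mx.
Qed.

(** hdot z z times the component of h orthogonal to z, so that no division is
    involved. *)
Definition orth z h : vec := hdot z z *: h - hdot h z *: z.

(** The point of the line spanned by z and h antipodal to the point of z. *)
Definition gdir z h : mat := CPpt (orth z h).

Definition indep z h := forall k l, k *: z + l *: h = 0 -> k = 0 /\ l = 0.

Lemma indep_neq0 z h : indep z h -> z != 0.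
Proof.
move=> ind; apply/eqP => z0; have [] := ind 1 0; first by rewrite z0 scaler0 scale0r addr0.
by move/eqP; rewrite oner_eq0.
Qed.

Lemma indep_orth_neq0 z h : indep z h -> orth z h != 0.
Proof.
move=> ind; apply/eqP => o0; have := indep_neq0 ind; rewrite -hdot_eq0.
have [|_ ->] := ind (- hdot h z) (hdot z z); last by rewrite eqxx.
by rewrite scaleNr addrC.
Qed.

Lemma indep_mul P z h : P \in unitmx -> indep z h -> indep (z *m P) (h *m P).
Proof.
move=> uP ind k l; rewrite !scalemxAl -mulmxDl => e; apply: ind.
by rewrite -[LHS](mulmxK uP) e mul0mx.
Qed.

Lemma orth_tri z h k l m :
  orth (k *: z) (l *: h + m *: z) = (k * k^* * l) *: orth z h.
Proof.
rewrite /orth !hdotDl !hdotZl !hdotZr scalerBr !scalerDr !scalerA.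
rewrite -[in LHS]addrA -scalerBl; congr (_ *: _ + _); first by ring.
by rewrite -scaleNr; congr (_ *: _); ring.
Qed.

Lemma gdir_tri z h k l m : k != 0 -> l != 0 ->
  gdir (k *: z) (l *: h + m *: z) = gdir z h.
Proof.
by move=> k0 l0; rewrite /gdir orth_tri CPpt_scale // !mulf_neq0 // conjC_eq0.
Qed.

(** A line of the complex projective space and its image under the Gauss map
    determine the frame up to a triangular change of basis. *)
Lemma gdir_inj z h z' h' : indep z h -> indep z' h' ->
  CPpt z = CPpt z' -> gdir z h = gdir z' h' ->
  exists k l m, [/\ k != 0, l != 0, z' = k *: z & h' = l *: h + m *: z].
Proof.
move=> ind ind' ez eo.
have [k k0 zE] := CPpt_inj (indep_neq0 ind) (indep_neq0 ind') ez.
have [l l0 oE] := CPpt_inj (indep_orth_neq0 ind) (indep_orth_neq0 ind') eo.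
have z0 : hdot z z != 0 by rewrite hdot_eq0 (indep_neq0 ind).
have z0' : hdot z' z' != 0 by rewrite hdot_eq0 (indep_neq0 ind').
exists k, (l * hdot z z / hdot z' z'), ((hdot h' z' * k - l * hdot h z) / hdot z' z').
split; [exact: k0| |exact: zE|].
  by apply: mulf_neq0; [apply: mulf_neq0; [exact: l0|exact: z0]|rewrite invr_eq0].
apply: (scalerI z0'); rewrite scalerDr !scalerA.
have -> : hdot z' z' *: h' = orth z' h' + hdot h' z' *: z' by rewrite /orth subrK.
have -> : hdot h' z' *: z' = (hdot h' z' * k) *: z by rewrite {2}zE scalerA.
rewrite oE /orth scalerBr !scalerA -addrA -scaleNr -scalerDl.
move: z0'; move: (hdot z' z') (hdot h' z') (hdot z z) (hdot h z) => p q r s p0.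
by congr (_ *: _ + _ *: _); field.
Qed.

Lemma hdot_orth z h : hdot (orth z h) z = 0.
Proof. by rewrite /orth hdotDl hdotNl !hdotZl; ring. Qed.

Lemma proj_lineP z h y : (y <= col_mx z h)%MS -> exists k l, y = k *: z + l *: h.
Proof.
move=> /submxP[D ->]; exists (lsubmx D 0 0), (rsubmx D 0 0).
rewrite -{1}[D]hsubmxK mul_row_col {1}[lsubmx D]mx11_scalar {1}[rsubmx D]mx11_scalar.
by rewrite !mul_scalar_mx.
Qed.

Lemma sub_proj_line z h k l : ((k *: z + l *: h)%R <= col_mx z h)%MS.
Proof.
apply/submxP; exists (row_mx (k%:M : 'M[C]_1) (l%:M : 'M[C]_1)).
by rewrite mul_row_col !mul_scalar_mx.
Qed.

(** Two orthogonal points of a projective line are antipodal: for a third point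
    of the line, the squared cosines of the angles with them add up to one. *)
Lemma orthogonal_midpoint z o k l : z != 0 -> o != 0 -> hdot o z = 0 ->
  k *: z + l *: o != 0 ->
  let D := CPpt (k *: z + l *: o) - 2^-1 *: (CPpt z + CPpt o) in HM_inner D D = 1.
Proof.
move=> z0 o0 zo; set v := k *: z + l *: o => v0.
have oz : hdot z o = 0 by rewrite hdotC zo rmorph0.
have vz : hdot v z = k * hdot z z by rewrite /v hdotDl !hdotZl zo mulr0 addr0.
have vo : hdot v o = l * hdot o o by rewrite /v hdotDl !hdotZl oz mulr0 add0r.
have zP : 0 < nsq z by rewrite nsq_gt0.
have oP : 0 < nsq o by rewrite nsq_gt0.
have vP : 0 < nsq v by rewrite nsq_gt0.
have vv : nsq v = cabs k ^+ 2 * nsq z + cabs l ^+ 2 * nsq o.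
  apply: (@complexI R); rewrite -hdot_nsq {2}/v hdotDr !hdotZr vz vo !hdot_nsq.
  move: (cabs_conj k) (cabs_conj l); move: (cabs k ^+ 2) (cabs l ^+ 2) => p q ep eq.
  by rewrite rmorphD !rmorphM /= -ep -eq; ring.
have e1 : cabs (hdot v z) ^+ 2 / (nsq v * nsq z) + cabs (hdot v o) ^+ 2 / (nsq v * nsq o) = 1.
  rewrite vz vo !cabsM !hdot_nsq !cabs_real !(ger0_norm (nsq_ge0 _)).
  rewrite [RHS](_ : 1 = nsq v / nsq v); last by rewrite divff // gt_eqF.
  by rewrite {3}vv; field; rewrite !gt_eqF.
clearbody v; move=> D; rewrite /HM_inner trpE.
have t1 : trp (CPpt v) (CPpt z + CPpt o) = 1.
  by rewrite trpDr !trace_CPpt2 -rmorphD e1 rmorph1.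
have t2 : trp (CPpt z + CPpt o) (CPpt z + CPpt o) = 2.
  rewrite trp_sq_add (trace_CPpt_id z0) (trace_CPpt_id o0) trace_CPpt2 oz.
  by rewrite cabs0 expr0n /= mul0r rmorph0; ring.
have trD : trp D D = 2^-1.
  by rewrite trp_sq_sub t1 t2 (trace_CPpt_id v0); field.
by rewrite trD divff ?pnatr_eq0.
Qed.

Lemma antipodal_gdir z h : indep z h -> antipodal (proj_line z h) (CPpt z) (gdir z h).
Proof.
move=> ind; have z0 := indep_neq0 ind; have o0 := indep_orth_neq0 ind.
split.
- exists z => //; split=> //=.
  by have := sub_proj_line z h 1 0; rewrite scale1r scale0r addr0.
- exists (orth z h) => //; split=> //=.
  have := sub_proj_line z h (- hdot h z) (hdot z z).
  by rewrite scaleNr addrC.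
move=> X [v [v0 /proj_lineP[k [l vE]]] <-].
have zz0 : hdot z z != 0 by rewrite hdot_eq0.
have vE' : v = (k + l * hdot h z / hdot z z) *: z + (l / hdot z z) *: orth z h.
  rewrite vE /orth scalerBr !scalerA addrCA -scalerBl addrC.
  by move: zz0; move: (hdot z z) (hdot h z) => p q p0; congr (_ *: _ + _ *: _); field.
rewrite vE' in v0 *; exact: orthogonal_midpoint z0 o0 (hdot_orth z h) v0.
Qed.

(** The distance condition, applied to the point [z] itself, says that the
    end points are orthogonal, which on a line determines the second one. *)
Lemma antipodal_unique z h A' : indep z h ->
  antipodal (proj_line z h) (CPpt z) A' -> A' = gdir z h.
Proof.
move=> ind; have z0 := indep_neq0 ind.
move=> [Lz [y [y0 /proj_lineP[k [l yE]]] <-] /(_ _ Lz)].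
rewrite /HM_inner /= trpE; set D := (X in trp X X).
have zP : 0 < nsq z by rewrite nsq_gt0.
have yP : 0 < nsq y by rewrite nsq_gt0.
have DE : D = CPpt z - 2^-1 *: (CPpt z + CPpt y) by [].
rewrite DE trp_sq_sub trp_sq_add trpDr (trace_CPpt_id z0) (trace_CPpt_id y0) trace_CPpt2.
set q := cabs (hdot z y) ^+ 2 / _.
have -> : 2 * (1 - 2 * 2^-1 * (1 + q%:C) + 2^-1 ^+ 2 * (1 + 2 * q%:C + 1))
    = (1 - q)%:C :> C by rewrite rmorphB rmorph1 /=; field.
move=> /= q1; have {q1}: q = 0 by lra.
move=> q0; have zy : hdot z y = 0.
  apply/eqP; rewrite -cabs_eq0 -[_ == _]sqrf_eq0; move/eqP: q0.
  rewrite /q mulf_eq0 => /orP[//|]; rewrite invr_eq0 mulf_eq0 => /orP[];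
    by rewrite gt_eqF.
have yz : k * hdot z z + l * hdot h z = 0.
  by rewrite -!hdotZl -hdotDl -yE hdotC zy rmorph0.
have zz0 : hdot z z != 0 by rewrite hdot_eq0.
have l0 : l != 0.
  apply: contraNneq y0 => l0; move/eqP: yz; rewrite yE l0 mul0r addr0 mulf_eq0.
  by rewrite (negPf zz0) orbF => /eqP ->; rewrite !scale0r addr0.
rewrite /gdir -[RHS](@CPpt_scale (l / hdot z z)); last by rewrite mulf_neq0 // invr_eq0.
congr CPpt; rewrite yE /orth scalerBr !scalerA addrC -scaleNr.
congr (_ *: _ + _ *: _); first by field.
have -> : k = - (l * hdot h z) / hdot z z; last by field.
by apply: (mulIf zz0); rewrite divfK //; apply/eqP; rewrite -addr_eq0 yz.
Qed.

End Projectors.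

(** * Coordinatewise derivatives and isolated zeros *)
Section VectorCalculus.
Variable R : realType.
Local Notation C := (Cx R).
Implicit Types (w : C).

(** Coordinatewise, so that the scalar rules of derivation apply directly. *)
Definition vder n (z : C -> 'rV[C]_n) w (dz : 'rV[C]_n) :=
  forall j, is_derive w 1 (fun v => z v 0 j) (dz 0 j).

Lemma vderP n (z : C -> 'rV[C]_n.+1) w dz :
  vder z w dz <-> derivable z w 1 /\ derive1 z w = dz.
Proof.
have coordP : derivable z w 1 -> forall j, is_derive w 1 (fun v => z v 0 j) (derive1 z w 0 j).
  move=> /derivable1_diffP dz' j.
  pose c (M : 'rV[C]_n.+1) : C := M 0 j.
  have dc : differentiable c (z w) by exact: differentiable_coord.
  have dcz : differentiable (c \o z) w by exact: differentiable_comp.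
  have lc : 'd c (z w) = c :> (_ -> _).
    have cc : continuous (c : 'rV[C]_n.+1 -> C) by exact: coord_continuous.
    pose cl : {linear 'rV[C]_n.+1 -> C} := HB.pack c (GRing.isLinear.Build C _ _ _ c
       (fun a u v => etrans (mxE _ _ _ _) (congr1 (fun t => t + v 0 j) (mxE _ _ _ _)))).
    exact: (@diff_lin _ _ _ cl (z w) cc).
  apply/is_derive1P; split; first exact/derivable1_diffP.
  rewrite !derive1E (deriveE _ dcz) diff_comp // lc /=.
  by rewrite (deriveE _ dz').
split=> [H|[dz' <-] j]; last exact: coordP.
suff dz' : derivable z w 1.
  split=> //; apply/rowP => j; have /is_derive1P[_ <-] := H j.
  by have /is_derive1P[_ <-] := coordP dz' j.
apply/derivable1_diffP.
have -> : z = \sum_(j < n.+1) (fun v => z v 0 j *: delta_mx 0 j).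
  by apply/funext => v; rewrite fct_sumE; apply: row_sum_delta.
apply: differentiable_sum => j; apply: differentiableZl.
by apply/derivable1_diffP; have /is_derive1P[] := H j.
Qed.

Lemma der_sum (I : Type) (r : seq I) (f : I -> C -> C) w df :
  (forall i, is_derive w 1 (f i) (df i)) ->
  is_derive w 1 (fun v => \sum_(i <- r) f i v) (\sum_(i <- r) df i).
Proof.
move=> H; elim: r => [|i r IH].
  have := @der_cst R w 0; congr is_derive; last by rewrite big_nil.
  by apply/funext => v; rewrite big_nil.
have := derD (H i) IH; congr is_derive; last by rewrite big_cons.
by apply/funext => v; rewrite big_cons.
Qed.

Lemma vder_mulmx n p (z : C -> 'rV[C]_n) w dz (P : 'M[C]_(n, p)) :
  vder z w dz -> vder (fun v => z v *m P) w (dz *m P).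
Proof.
move=> H j.
have := @der_sum _ (index_enum 'I_n) (fun i v => z v 0 i * P i j) w
  (fun i => dz 0 i * P i j + z w 0 i * 0) (fun i => derM (H i) (der_cst w (P i j))).
congr is_derive; first by apply/funext => v; rewrite mxE.
by rewrite mxE; apply: eq_bigr => i _; rewrite mulr0 addr0.
Qed.

Lemma vder_scale n (g : C -> C) (z : C -> 'rV[C]_n) w dg dz :
  is_derive w 1 g dg -> vder z w dz ->
  vder (fun v => g v *: z v) w (dg *: z w + g w *: dz).
Proof.
move=> Hg Hz j; have := derM Hg (Hz j); congr is_derive; last by rewrite !mxE.
by apply/funext => v; rewrite mxE.
Qed.

Lemma vder_comp n (g : C -> C) (z : C -> 'rV[C]_n) w dg dz :
  is_derive w 1 g dg -> vder z (g w) dz -> vder (fun v => z (g v)) w (dg *: dz).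
Proof.
move=> Hg Hz j; have := der_comp Hg (Hz j); congr is_derive.
by rewrite !mxE mulrC.
Qed.

Lemma near_vder n (z y : C -> 'rV[C]_n) w dz : (\forall v \near w, z v = y v) ->
  vder z w dz -> vder y w dz.
Proof. by move=> zy H j; apply: near_der (H j); apply: filterS zy => v ->. Qed.

Lemma vder_unique n (z : C -> 'rV[C]_n) w d1 d2 : vder z w d1 -> vder z w d2 -> d1 = d2.
Proof.
move=> H1 H2; apply/rowP => j.
by have /is_derive1P[_ <-] := H1 j; have /is_derive1P[_ <-] := H2 j.
Qed.

(** Used to extend to branch points identities that hold around them. *)
Lemma punctured_eq (f g : C -> C) w : {for w, continuous f} -> {for w, continuous g} ->
  (\forall v \near w, v != w -> f v = g v) -> f w = g w.
Proof.
move=> cf cg fg; apply/eqP; rewrite -subr_eq0 -cabs_eq0 eq_le cabs_ge0 andbT.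
apply/ler_addgt0Pr => e e0; rewrite add0r.
have e20 : 0 < e / 2 by rewrite divr_gt0.
have /cvg_cabsP/(_ _ e20) nf := cf; have /cvg_cabsP/(_ _ e20) ng := cg.
have /nbhs_cabsP[r r0 rP] : nbhs w [set v | [/\ cabs (f v - f w) < e / 2,
    cabs (g v - g w) < e / 2 & (v != w -> f v = g v)]].
  by apply: filterS3 nf ng fg => v h1 h2 h3; split.
pose v : C := w + (r / 2)%:C.
have vw : v - w = (r / 2)%:C by rewrite /v addrC addKr.
have r2 : 0 < r / 2 by rewrite divr_gt0.
have [|h1 h2 h3] := rP v; first by rewrite vw cabs_real gtr0_norm //; lra.
have {}h3 : f v = g v.
  apply: h3; rewrite -subr_eq0 vw -cabs_gt0 cabs_real gtr0_norm //.
have := cabsD (f w - f v) (g v - g w); rewrite h3 subrKA.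
move: h1 h2; rewrite h3 [cabs (g v - f w)]cabsB; lra.
Qed.

Lemma exists_near_neq w (P : C -> Prop) : (\forall v \near w, P v) ->
  exists2 v, v != w & P v.
Proof.
move=> /nbhs_cabsP[r r0 rP]; have r2 : 0 < r / 2 by rewrite divr_gt0.
exists (w + (r / 2)%:C); first by rewrite -subr_eq0 addrC addKr -cabs_gt0 cabs_real gtr0_norm.
by apply: rP; rewrite addrC addKr cabs_real gtr0_norm //; lra.
Qed.

Lemma holo_isolated (f : C -> C) w : holo f w -> ~ (\forall v \near w, f v = 0) ->
  \forall v \near w, v != w -> f v != 0.
Proof.
move=> hf nz; have [//|[m [h [hh h0 hE]]]] := holo_factor hf.
have ch : {for w, continuous h} by apply: derivable_continuous; exact: nbhs_singleton hh.
have hn : \forall v \near w, h v != 0.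
  have /cvg_cabsP/(_ (cabs (h w))) := ch; rewrite cabs_gt0 => /(_ h0).
  apply: filterS => v hv; apply/negP => /eqP hv0; move: hv.
  by rewrite hv0 sub0r cabsN ltxx.
apply: filterS2 hn hE => v hv -> vw.
by rewrite mulf_neq0 // expf_neq0 // subr_eq0.
Qed.

(** If the derivative of f vanishes near w, then comparing the leading terms of
    f - f w = (v - w)^m h and of its derivative forces f - f w to vanish. *)
Lemma derive0_constant (f : C -> C) w :
  (\forall v \near w, is_derive (v : C) 1 f (0 : C)) -> \forall v \near w, f v = f w.
Proof.
move=> df; pose g v := f v - f w.
have dg : \forall v \near w, is_derive (v : C) 1 g (0 : C).
  apply: filterS df => v dfv; have := derB dfv (der_cst v (f w)).
  by rewrite subr0.
have hg : holo g w by apply: filterS dg => v /is_derive1P[].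
have [g0|[m [h [hh h0 hE]]]] := holo_factor hg.
  by apply: filterS g0 => v /eqP; rewrite subr_eq0 => /eqP.
exfalso; case: m hE => [|m] hE.
  have := nbhs_singleton hE; rewrite /g subrr expr0 mul1r => h00.
  by rewrite -h00 eqxx in h0.
have hh' := holo_derive hh.
have lead : \forall v \near w, v != w -> m.+1%:R * h v + (v - w) * derive1 h v = 0.
  have hE' := near_join hE.
  near=> v => vw.
  have hv : derivable h v 1 by near: v; exact: hh.
  have dh : is_derive v 1 h (derive1 h v) by apply/is_derive1P; split.
  have dv := derX m.+1 (derB (der_id v) (der_cst v w)).
  have nE : \forall u \near v, (u - w) ^+ m.+1 * h u = g u.
    have : \forall u \near v, g u = (u - w) ^+ m.+1 * h u by near: v; exact: hE'.
    by apply: filterS => u ->.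
  have /is_derive1P[_ D1] := near_der nE (derM dv dh).
  have /is_derive1P[_ D2] : is_derive (v : C) 1 g (0 : C) by near: v; exact: dg.
  move: D1; rewrite D2 /= subr0 mulr1 exprSr => /esym e.
  have vw0 : (v - w) ^+ m != 0 by rewrite expf_neq0 // subr_eq0.
  apply: (mulfI vw0); rewrite mulr0 -[RHS]e; ring.
have ch : {for w, continuous h} by apply: derivable_continuous; exact: nbhs_singleton hh.
have ch' : {for w, continuous (derive1 h)}.
  by apply: derivable_continuous; exact: nbhs_singleton hh'.
have := @punctured_eq (fun v => m.+1%:R * h v + (v - w) * derive1 h v) (fun=> 0) w.
rewrite subrr mul0r addr0 => H; have {H} /eqP : m.+1%:R * h w = 0 :> C.
  apply: H.
  - apply: contD; first by apply: contM; [exact: cont_cst|exact: ch].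
    apply: contM; last exact: ch'.
    by apply: contB; [exact: cont_id|exact: cont_cst].
  - exact: cont_cst.
  - exact: lead.
by rewrite mulf_eq0 (negPf h0) orbF pnatr_eq0.
Unshelve. all: by end_near.
Qed.

End VectorCalculus.

(** * Continuity of projectors *)
Section ProjectorContinuity.
Variables (R : realType) (n : nat) (T : topologicalType) (t : T).
Local Notation C := (Cx R).
Local Notation vec := 'rV[C]_n.+1.
Implicit Types (z h : T -> vec).

Definition vcont z := forall j, {for t, continuous (fun s => z s 0 j : C)}.

Lemma contJ (f : T -> C) : {for t, continuous f} -> {for t, continuous (fun s => (f s)^*)}.
Proof.
move=> /cvg_cabsP cf; apply/cvg_cabsP => e /cf; apply: filterS => s.
by rewrite -rmorphB /cabs norm_conjC.
Qed.

Lemma cont_sum (I : Type) (r : seq I) (f : I -> T -> C) :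
  (forall i, {for t, continuous (f i)}) ->
  {for t, continuous (fun s => \sum_(i <- r) f i s)}.
Proof.
move=> cf; elim: r => [|i r IH].
  have := @cont_cst R T t 0; congr continuous_at.
  by apply/funext => s; rewrite big_nil.
have := contD (cf i) IH; congr continuous_at.
by apply/funext => s; rewrite big_cons.
Qed.

Lemma hdot_cont z h : vcont z -> vcont h -> {for t, continuous (fun s => hdot (z s) (h s))}.
Proof.
move=> cz ch; have := @cont_sum _ (index_enum _) (fun j s => z s 0 j * (h s 0 j)^*)
  (fun j => contM (cz j) (contJ (ch j))).
by congr continuous_at; apply/funext => s; rewrite hdotE.
Qed.

Lemma CPpt_entry (u : vec) i j : CPpt u i j = (hdot u u)^-1 * ((u 0 i)^* * u 0 j).
Proof. by rewrite CPptE !mxE big_ord1 !mxE. Qed.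

Lemma CPpt_cont z i j : vcont z -> z t != 0 ->
  {for t, continuous (fun s => CPpt (z s) i j : C)}.
Proof.
move=> cz z0; have z0' : hdot (z t) (z t) != 0 by rewrite hdot_eq0.
have := contM (contV (hdot_cont cz cz) z0') (contM (contJ (cz i)) (cz j)).
by congr continuous_at; apply/funext => s; rewrite CPpt_entry.
Qed.

Lemma orth_cont z h : vcont z -> vcont h -> vcont (fun s => orth (z s) (h s)).
Proof.
move=> cz ch j; have := contB (contM (hdot_cont cz cz) (ch j)) (contM (hdot_cont ch cz) (cz j)).
by congr continuous_at; apply/funext => s; rewrite /orth !mxE.
Qed.

Lemma gdir_cont z h i j : vcont z -> vcont h -> indep (z t) (h t) ->
  {for t, continuous (fun s => gdir (z s) (h s) i j : C)}.
Proof.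
move=> cz ch ind; apply: (@CPpt_cont (fun s => orth (z s) (h s))).
  exact: orth_cont.
exact: indep_orth_neq0.
Qed.

Lemma vcont_mulmx z (P : 'M[C]_n.+1) : vcont z -> vcont (fun s => z s *m P).
Proof.
move=> cz j; have := @cont_sum _ (index_enum _) (fun i s => z s 0 i * P i j)
  (fun i => contM (cz i) (@cont_cst _ _ _ (P i j))).
by congr continuous_at; apply/funext => s; rewrite mxE.
Qed.

End ProjectorContinuity.

(** * Holomorphic curves: charts, hyperplane sections, tangent frames *)
Section Charts.
Variables (R : realType) (T : ptopologicalType) (S : riemann_surface R T).
Local Notation C := (Cx R).
Implicit Types (x y : T) (i : chart_index S).

Lemma near_dom i x : chart_dom i x -> \forall y \near x, chart_dom i y.
Proof. by move=> ix; apply: open_nbhs_nbhs; split; [exact: chart_dom_open|]. Qed.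

Lemma near_chart i x (P : C -> Prop) : chart_dom i x ->
  (\forall w \near chart i x, P w) -> \forall y \near x, P (chart i y).
Proof. by move=> ix nP; have := chart_continuous ix; apply. Qed.

Lemma near_chart_inv i x (Q : T -> Prop) : chart_dom i x ->
  (\forall y \near x, Q y) ->
  \forall w \near chart i x, [/\ chart_dom i (chart_inv i w),
    chart i (chart_inv i w) = w & Q (chart_inv i w)].
Proof.
move=> ix nQ.
have n1 : \forall w \near chart i x, (chart i @` chart_dom i) w.
  by apply: open_nbhs_nbhs; split; [exact: chart_img_open|exists x].
have n2 : \forall w \near chart i x, Q (chart_inv i w).
  by have := chart_inv_continuous ix; apply; rewrite chartK.
by apply: filterS2 n1 n2 => w [y iy <-]; rewrite chartK // => Qy; split; rewrite ?chartK.
Qed.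

Lemma chart_inj i x y : chart_dom i x -> chart_dom i y -> chart i x = chart i y -> x = y.
Proof. by move=> ix iy e; rewrite -(chartK ix) e chartK. Qed.

End Charts.

Section Curves.
Variables (R : realType) (T : ptopologicalType) (S : riemann_surface R T) (n : nat).
Local Notation C := (Cx R).
Local Notation vec := 'rV[C]_n.+1.
Local Notation mat := 'M[C]_n.+1.
Implicit Types (F : T -> mat) (x y : T) (i : chart_index S).

Lemma row_neq0 (u : vec) k : u 0 k = 1 -> u != 0.
Proof. by move=> uk; apply/eqP => u0; move/eqP: uk; rewrite u0 mxE eq_sym oner_eq0. Qed.

Lemma CPpt_mul_col p (u : vec) (c : 'M[C]_(n.+1, p)) : u != 0 ->
  CPpt u *m c = 0 <-> u *m c = 0.
Proof.
move=> u0; split=> [e|e]; last by rewrite CPptE -scalemxAl -mulmxA e mulmx0 scaler0.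
have := congr1 (mulmx u) e; rewrite mulmxA mul_CPpt divff ?hdot_eq0 // scale1r mulmx0.
by [].
Qed.

Lemma lift_point F x i k z : affine_lift (S := S) F x i k z ->
  z (chart i x) 0 k = 1 /\ F x = CPpt (z (chart i x)).
Proof. by move=> [ix /nbhs_singleton[_ zk FE]]; rewrite -FE chartK. Qed.

Lemma lift_near F x i k z : affine_lift (S := S) F x i k z ->
  \forall y \near x, affine_lift (S := S) F y i k z.
Proof.
move=> [ix zP]; have := near_join zP => zP'.
apply: filterS2 (near_dom ix) (near_chart ix zP') => y iy h; by split.
Qed.

Definition vholo p (u : C -> 'rV[C]_p) w := forall j, holo (fun v => u v 0 j) w.

Lemma near_forall (I : finType) (P : I -> C -> Prop) (w : C) :
  (forall j, \forall v \near w, P j v) -> \forall v \near w, forall j, P j v.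
Proof. by move=> H; apply: (@filter_forall C I (fun j v => P j v) (nbhs w)). Qed.

Lemma vholo_near p (u : C -> 'rV[C]_p) w : vholo u w ->
  \forall v \near w, vder u v (\row_j derive1 (fun t => u t 0 j) v).
Proof.
move=> hu; have : \forall v \near w, forall j, derivable (fun t => u t 0 j) v 1.
  by apply: near_forall => j; exact: hu.
by apply: filterS => v dv j; rewrite mxE; apply/is_derive1P; split.
Qed.

Lemma near_vholo p (u : C -> 'rV[C]_p) w :
  (\forall v \near w, exists du, vder u v du) -> vholo u w.
Proof.
move=> du j; apply: filterS du => v [dv H].
by have /is_derive1P[] := H j.
Qed.

Lemma vholo_mulmx p q (u : C -> 'rV[C]_p) (P : 'M[C]_(p, q)) w : vholo u w ->
  vholo (fun v => u v *m P) w.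
Proof.
move=> /vholo_near hu; apply: near_vholo; apply: filterS hu => v /(vder_mulmx P) H.
by eexists; exact: H.
Qed.

Lemma lift_vholo F x i k z : affine_lift (S := S) F x i k z -> vholo z (chart i x).
Proof.
move=> [_ zP]; apply: near_vholo; apply: filterS zP => v [dz _ _].
by exists (derive1 z v); apply/vderP.
Qed.

Lemma mx11_eq0 (M : 'M[C]_1) : M 0 0 = 0 <-> M = 0.
Proof.
split=> [M0|->]; last by rewrite mxE.
by rewrite [M]mx11_scalar M0 scalemx0 || (rewrite [M]mx11_scalar M0; apply/matrixP => a b; rewrite !mxE mul0rn).
Qed.

(** In a local lift z, being in the hyperplane is the vanishing of the
    holomorphic function z c, whose zeros are isolated unless it is zero. *)
Lemma curve_hyperplane_local F x (c : 'cV[C]_n.+1) : holomorphic_curve S F ->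
  (\forall y \near x, F y *m c = 0) \/ (\forall y \near x, y != x -> F y *m c <> 0).
Proof.
move=> /(_ x)[i [k [z zl]]]; have [ix _] := zl.
pose f v := (z v *m c) 0 0.
have hf : holo f (chart i x) by exact: (vholo_mulmx c (lift_vholo zl) 0).
have fE y : affine_lift (S := S) F y i k z -> F y *m c = 0 <-> f (chart i y) = 0.
  move=> /lift_point[zk ->]; rewrite /f mx11_eq0.
  by apply: CPpt_mul_col; exact: row_neq0 zk.
case: (pselect (\forall v \near chart i x, f v = 0)) => [f0|f0].
  left; apply: filterS2 (lift_near zl) (near_chart ix f0) => y zy fy.
  by apply/fE.
right; have iso := near_chart ix (holo_isolated hf f0).
apply: filterS3 (lift_near zl) iso (near_dom ix) => y zy fy iy yx.
move=> /(fE y zy); apply/eqP; apply: fy.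
by apply: contra_neq yx; exact: chart_inj.
Qed.

(** Identity theorem: the points near which the curve stays in a hyperplane form
    an open and closed set. *)
Lemma curve_identity F x0 (c : 'cV[C]_n.+1) : holomorphic_curve S F ->
  (\forall y \near x0, F y *m c = 0) -> forall y, F y *m c = 0.
Proof.
move=> hF x0P; pose E : set T := [set x | \forall y \near x, F y *m c = 0].
have oE : open E by rewrite openE => x Ex; exact: near_join Ex.
have oCE : open (~` E).
  rewrite openE => x nEx; have [//|iso] := @curve_hyperplane_local F x c hF.
  apply: filterS iso => y yP Ey; have [yx|yx] := eqVneq y x.
    by apply: nEx; rewrite -yx.
  exact: yP yx (nbhs_singleton Ey).
have ET : E = [set: T].
  apply: (surface_connected S); first by exists x0.
  - by exists E => //; rewrite setTI.
  - by exists E; [rewrite -[E]setCK; exact: open_closedC|rewrite setTI].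
by move=> y; have : E y by [rewrite ET]; exact: nbhs_singleton.
Qed.

(** Fullness is thereby a local property: no piece of the curve, however small,
    lies in a hyperplane. *)
Lemma full_not_near F x (c : 'cV[C]_n.+1) : holomorphic_curve S F -> full F -> c != 0 ->
  ~ (\forall y \near x, F y *m c = 0).
Proof.
move=> hF fF c0 /(curve_identity hF) Fc; apply: (fF c c0) => _ [y _ <-].
have [i [k [z /lift_point[zk FE]]]] := hF y.
exists (z (chart i y)) => //=; have z0 := row_neq0 zk; split=> //.
by apply/(CPpt_mul_col _ z0); rewrite -FE Fc.
Qed.

Definition lift_frame F x i k z (m : nat) (h : C -> vec) :=
  [/\ affine_lift (S := S) F x i k z,
      \forall w \near chart i x,
        derivable h w 1 /\
        derive1 z w = (w - chart i x) ^+ m *: h w &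
      h (chart i x) != 0].

(** The two vectors u and v span the tangent line at x; the pair is determined
    up to a triangular change. *)
Definition is_frame F x (u v : vec) := exists i k z m h,
  [/\ lift_frame F x i k z m h, u = z (chart i x) & v = h (chart i x)].

(** Factoring out of a holomorphic vector the common order of vanishing of its
    coordinates: the orders that can be factored out are bounded by the order
    of any coordinate that does not vanish identically. *)
Lemma vholo_factor (u : C -> vec) w : vholo u w ->
  (\forall v \near w, u v = 0) \/
  exists m (h : C -> vec), [/\ vholo h w, h w != 0 &
    \forall v \near w, u v = (v - w) ^+ m *: h v].
Proof.
move=> hu; case: (pselect (forall j, \forall v \near w, u v 0 j = 0)) => [u0|].
  left; have : \forall v \near w, forall j, u v 0 j = 0 by exact: near_forall.
  by apply: filterS => v v0; apply/rowP => j; rewrite v0 mxE.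
move=> /existsNP[j0 nj0]; right.
have [//|[m0 [h0 [hh0 h00 h0E]]]] := holo_factor (hu j0).
pose P m := `[< exists h : C -> vec, vholo h w /\
  \forall v \near w, u v = (v - w) ^+ m *: h v >].
have P0 : exists m, P m.
  exists 0%N; apply/asboolP; exists u; split=> //.
  by apply: filterE => v; rewrite expr0 scale1r.
have Pm m : P m -> (m <= m0)%N.
  move=> /asboolP[h [hh hE]]; rewrite leqNgt; apply/negP => mm.
  have e : \forall v \near w, v != w -> h0 v = (v - w) ^+ (m - m0) * h v 0 j0.
    apply: filterS2 h0E hE => v e1 e2 vw; move: e1; rewrite e2 mxE.
    have vw0 : (v - w) ^+ m0 != 0 by rewrite expf_neq0 // subr_eq0.
    rewrite -{1}(subnK (ltnW mm)) exprD mulrAC mulrC => /(mulfI vw0) <-.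
    by rewrite mulrC.
  have ch0 : {for w, continuous h0} by apply: derivable_continuous; exact: nbhs_singleton hh0.
  have ch : {for w, continuous (fun v => h v 0 j0)}.
    by apply: derivable_continuous; exact: nbhs_singleton (hh j0).
  have cx : {for w, continuous (fun v : C => (v - w) ^+ (m - m0) : C)}.
    by apply: contX; apply: contB; [exact: cont_id|exact: cont_cst].
  have := punctured_eq ch0 (contM cx ch) e.
  by rewrite subrr expr0n subn_eq0 leqNgt mm /= mul0r => /eqP; rewrite (negPf h00).
have [m /asboolP[h [hh hE]] mmax] := ex_maxnP P0 Pm.
exists m, h; split=> //; apply/eqP => hw0.
have gex j : exists g : C -> C, holo g w /\ \forall v \near w, h v 0 j = (v - w) * g v.
  have [hj|[p [g [hg g0 gE]]]] := holo_factor (hh j).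
    exists (fun=> 0); split; last by apply: filterS hj => v ->; rewrite mulr0.
    by apply: filterE => v; exact: derivable_cst.
  case: p gE => [|p] gE.
    have := nbhs_singleton gE; rewrite hw0 mxE expr0 mul1r => /esym/eqP.
    by rewrite (negPf g0).
  exists (fun v => (v - w) ^+ p * g v); split; last first.
    by apply: filterS gE => v ->; rewrite exprS mulrA.
  apply: filterS hg => v dg.
  have dg' : is_derive v 1 g (derive1 g v) by apply/is_derive1P; split.
  by have /is_derive1P[] := derM (derX p (derB (der_id v) (der_cst v w))) dg'.
have [G GP] := choice gex.
have : P m.+1.
  apply/asboolP; exists (fun v => \row_j G j v); split.
    move=> j; have -> : (fun v => (\row_l G l v) 0 j) = G j.
      by apply/funext => t; rewrite mxE.
    exact: (GP j).1.
  have : \forall v \near w, forall j, h v 0 j = (v - w) * G j v.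
    by apply: near_forall => j; exact: (GP j).2.
  apply: filterS2 hE => v -> hv; apply/rowP => j.
  by rewrite !mxE hv exprSr mulrA.
by move=> /mmax; rewrite ltnn.
Qed.

(** Otherwise z' would vanish near the point, so the lift would be constant there,
    contrary to fullness. *)
Lemma exists_frame F x : holomorphic_curve S F -> full F -> (0 < n)%N ->
  exists i k z m h, lift_frame F x i k z m h.
Proof.
move=> hF fF n0; have [i [k [z zl]]] := hF x; have [ix zP] := zl.
have zder : \forall v \near chart i x, vder z v (derive1 z v).
  by apply: filterS zP => v [dz _ _]; apply/vderP.
have hd : vholo (derive1 z) (chart i x).
  move=> j; have hzj : holo (fun v => z v 0 j) (chart i x) := lift_vholo zl j.
  have hd := holo_derive hzj; have zder' := near_join zder.
  apply: filterS2 hd zder' => v dv zv; apply: near_eq_derivable dv.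
  by apply: filterS zv => t /(_ j)/is_derive1P[].
have [d0|[m [h [hh h0 hE]]]] := vholo_factor hd; last first.
  exists i, k, z, m, h; split=> //.
  have hn := vholo_near hh; apply: filterS2 hn hE => v dv ->; split=> //.
  by have /vderP[] := dv.
exfalso; have zc j : \forall v \near chart i x, z v 0 j = z (chart i x) 0 j.
  apply: derive0_constant; apply: filterS2 zder d0 => v /(_ j) + dv.
  by rewrite dv mxE.
have [j jk] : exists j, j != k.
  case: (eqVneq k ord0) => [->|k0]; last by exists ord0; rewrite eq_sym.
  by exists (Ordinal (n0 : (1 < n.+1)%N)).
have [zk _] := lift_point zl.
(* The hyperplane z_j = z_j(x) z_k would contain the curve near x. *)
pose c : 'cV[C]_n.+1 := delta_mx j 0 - z (chart i x) 0 j *: delta_mx k 0.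
have c0 : c != 0.
  apply/eqP => /colP/(_ j); rewrite !mxE !eqxx (negPf jk) mulr0 subr0 => /eqP.
  by rewrite oner_eq0.
apply: (@full_not_near F x c hF fF c0).
have zc' : \forall v \near chart i x, forall j, z v 0 j = z (chart i x) 0 j.
  exact: near_forall.
apply: filterS2 (lift_near zl) (near_chart ix zc') => y /lift_point[yk ->] yc.
apply/(CPpt_mul_col _ (row_neq0 yk)); apply/mx11_eq0.
rewrite mulmxBr -scalemxAr !mxE.
rewrite (bigD1 j) //= big1 ?addr0 => [|l lj]; last by rewrite !mxE (negPf lj) mulr0.
rewrite (bigD1 k) //= big1 ?addr0 => [|l lj]; last by rewrite !mxE (negPf lj) mulr0.
by rewrite !mxE !eqxx !mulr1 yc yk mulr1 subrr.
Qed.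

End Curves.

(** * The tangent line is well defined and projectively covariant *)
Section Frames.
Variables (R : realType) (T : ptopologicalType) (S : riemann_surface R T) (n : nat).
Local Notation C := (Cx R).
Local Notation vec := 'rV[C]_n.+1.
Local Notation mat := 'M[C]_n.+1.
Implicit Types (F : T -> mat) (x y : T) (i : chart_index S) (P : mat).

Lemma cont_neq0 (f : C -> C) w : {for w, continuous f} -> f w != 0 ->
  \forall v \near w, f v != 0.
Proof.
move=> /cvg_cabsP/(_ (cabs (f w))) + f0; rewrite cabs_gt0 => /(_ f0).
apply: filterS => v hv; apply/negP => /eqP hv0; move: hv.
by rewrite hv0 sub0r cabsN ltxx.
Qed.

Lemma lift_vder F x i k z : affine_lift (S := S) F x i k z ->
  \forall w \near chart i x, vder z w (derive1 z w).
Proof. by move=> [_ zP]; apply: filterS zP => v [dz _ _]; apply/vderP. Qed.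

Lemma frame_vholo F x i k z m h : lift_frame (S := S) F x i k z m h ->
  vholo h (chart i x).
Proof.
move=> [_ hP _]; apply: near_vholo; apply: filterS hP => v [dh _].
by exists (derive1 h v); apply/vderP.
Qed.

Lemma vholo_cont p (u : C -> 'rV[C]_p) w : vholo u w ->
  forall j, {for w, continuous (fun v => u v 0 j : C)}.
Proof. by move=> hu j; apply: derivable_continuous; exact: nbhs_singleton (hu j). Qed.
Arguments vholo_cont {p u w} hu j.

(** The coordinate of z normalized to 1 has derivative 0, so this coordinate of
    h vanishes, while h itself does not. *)
Lemma frame_indep F x i k z m h : lift_frame (S := S) F x i k z m h ->
  \forall w \near chart i x, indep (z w) (h w).
Proof.
move=> fr; have [zl hP h0] := fr; have [_ zP] := zl.
have hh := frame_vholo fr.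
have zk : \forall w \near chart i x, z w 0 k = 1 by apply: filterS zP => w [].
(* Away from the centre h is a nonzero multiple of z', whose k-th coordinate is 0. *)
have hk : \forall w \near chart i x, w != chart i x -> h w 0 k = 0.
  apply: filterS3 (near_join zk) (lift_vder zl) hP => w zk1 /(_ k) zd [_ e] wx.
  have nE : \forall v \near w, (1 : C) = z v 0 k by apply: filterS zk1 => v ->.
  have /is_derive1P[_ D1] := near_der nE (der_cst w 1).
  have /is_derive1P[_ D2] := zd; move: D2; rewrite D1 e mxE => /esym/eqP.
  by rewrite mulf_eq0 expf_eq0 subr_eq0 (negPf wx) andbF => /eqP.
have hk0 : h (chart i x) 0 k = 0.
  exact: (@punctured_eq _ (fun w => h w 0 k) (fun=> 0) _ (vholo_cont hh k) (@cont_cst R C _ 0) hk).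
have hkn : \forall w \near chart i x, h w 0 k = 0.
  by apply: filterS hk => w hw; have [->|/hw] := eqVneq w (chart i x).
have [j hj] : exists j, h (chart i x) 0 j != 0.
  apply: contrapT => nj; move/eqP: h0; apply; apply/rowP => j; rewrite mxE.
  by apply/eqP; apply: contrapT => /negP hj; apply: nj; exists j.
have hjn : \forall w \near chart i x, h w 0 j != 0.
  exact: (cont_neq0 (vholo_cont hh j) hj).
apply: filterS3 zk hkn hjn => w zk1 hk1 hj1 s t e.
have s0 : s = 0 by move/rowP/(_ k): e; rewrite !mxE zk1 hk1 mulr1 mulr0 addr0.
split=> //; move/rowP/(_ j): e; rewrite !mxE s0 mul0r add0r => /eqP.
by rewrite mulf_eq0 (negPf hj1) orbF => /eqP.
Qed.

Lemma is_frame_indep F x u v : is_frame S F x u v -> indep u v.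
Proof. by move=> [i [k [z [m [h [fr -> ->]]]]]]; exact: nbhs_singleton (frame_indep fr). Qed.

Lemma is_frame_point F x u v : is_frame S F x u v -> F x = CPpt u.
Proof. by move=> [i [k [z [m [h [[zl _ _] -> _]]]]]]; have [] := lift_point zl. Qed.

(** Near a point, branched or not, the frame found there also gives the tangent
    lines at the other points, up to rescaling the second vector. *)
Lemma frame_near F x i k z m h : lift_frame (S := S) F x i k z m h ->
  \forall y \near x, exists2 l, l != 0 & is_frame S F y (z (chart i y)) (l *: h (chart i y)).
Proof.
move=> fr; have [zl hP h0] := fr; have [ix _] := zl.
have hn := near_chart ix (near_join hP); have ind := near_chart ix (frame_indep fr).
have hlin := near_chart ix (near_join (vholo_near (frame_vholo fr))).
apply: filterS3 (lift_near zl) (near_dom ix) (filterI hn (filterI ind hlin)).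
move=> y zy iy [hy [indy hly]]; have [yx|yx] := eqVneq y x.
  exists 1; first exact: oner_neq0.
  by rewrite scale1r yx; exists i, k, z, m, h; split; [exact: fr|exact: erefl|exact: erefl].
have l0 : (chart i y - chart i x) ^+ m != 0.
  rewrite expf_neq0 // subr_eq0; apply: contra_neq yx; exact: chart_inj.
exists ((chart i y - chart i x) ^+ m); first exact: l0.
exists i, k, z, 0%N, (fun v => (v - chart i x) ^+ m *: h v).
split; [|exact: erefl|exact: erefl]; split; first exact: zy.
- apply: filterS2 hy hly => v [dh e] hv; split; last by rewrite expr0 scale1r.
  have := vder_scale (derX m (derB (der_id v) (der_cst v (chart i x)))) hv.
  by move=> /vderP[].
- apply/eqP => /eqP; rewrite scaler_eq0 (negPf l0) /= => /eqP hy0.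
  by have [|_ /eqP] := indy 0 1; rewrite ?oner_eq0 // hy0 scaler0 scale0r addr0.
Qed.

(** The tangent line does not depend on the chart, the affine coordinates and
    the factorisation chosen: at nearby unbranched points it is spanned by the
    lift and its derivative, which change by a triangular matrix, and the
    projectors on the tangent lines vary continuously. *)
Lemma frame_unique F x u v u' v' : is_frame S F x u v -> is_frame S F x u' v' ->
  gdir u v = gdir u' v'.
Proof.
move=> [i [k [z [m [h [fr -> ->]]]]]] [i' [k' [z' [m' [h' [fr' -> ->]]]]]].
have [zl hP h0] := fr; have [zl' hP' h0'] := fr'; have [ix zP] := zl; have [ix' zP'] := zl'.
(* The second lift is read in the first chart; there z' o tau = g z. *)
pose tau w := chart i' (chart_inv i w).
have tauE y : chart_dom i y -> tau (chart i y) = chart i' y by move=> iy; rewrite /tau chartK.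
have near_tau (Q : C -> Prop) : (\forall w \near chart i' x, Q w) ->
    \forall w \near chart i x, Q (tau w).
  move=> nQ; have := near_chart_inv ix (near_chart ix' nQ).
  by apply: filterS => w [].
have dtau : \forall w \near chart i x, is_derive (w : C) 1 tau (derive1 tau w).
  have := near_chart_inv ix (near_dom ix'); apply: filterS => w [iw cw i'w].
  apply/is_derive1P; split; last exact: erefl.
  by have := transition_holomorphic iw i'w; rewrite cw.
have basic : \forall w \near chart i x, [/\ z w 0 k = 1, z' (tau w) 0 k' = 1 &
    CPpt (z w) = CPpt (z' (tau w))].
  have := near_chart_inv ix (near_dom ix').
  apply: filterS3 zP (near_tau _ zP') => w [_ zk zF] [_ zk' zF'] [iw cw i'w].
  split; [exact: zk|exact: zk'|].
  by rewrite -zF -zF' /tau chartK.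
pose g w := z' (tau w) 0 k.
have zz' : \forall w \near chart i x, g w != 0 /\ g w *: z w = z' (tau w).
  apply: filterS basic => w [zk zk' e].
  have [c c0 e'] := CPpt_inj (row_neq0 zk) (row_neq0 zk') e.
  by have gc : g w = c; [rewrite /g e' mxE zk mulr1|rewrite gc].
have eqd : \forall w \near chart i x, w != chart i x ->
    gdir (z w) (h w) = gdir (z' (tau w)) (h' (tau w)).
  have dz' : \forall w \near chart i x, vder z' (tau w) (derive1 z' (tau w)).
    exact: (near_tau (fun w => vder z' w (derive1 z' w)) (lift_vder zl')).
  have jn := near_join zz'.
  have lv := lift_vder zl.
  have ind' := near_tau (fun w => indep (z' w) (h' w)) (frame_indep fr').
  have hPt := near_tau _ hP'.
  apply: filterS (filterI zz' (filterI (frame_indep fr) (filterI ind' (filterI hP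
    (filterI hPt (filterI dtau (filterI lv (filterI dz' jn)))))))) => w.
  move=> [[g0 zE] [indw [indw' [[_ hE] [[_ hE'] [dt [vz [vz' jw]]]]]]]] wx.
  have nE : \forall v \near w, g v *: z v = z' (tau v) by apply: filterS jw => t [].
  have c1 := vder_comp dt vz'.
  have [g' c1k] : exists g', is_derive w 1 g g' by eexists; exact: (c1 k).
  have := vder_unique (near_vder nE (vder_scale c1k vz)) c1; rewrite hE hE' !scalerA.
  set p := (w - chart i x) ^+ m; set q := derive1 tau w * _ => e.
  have p0 : p != 0 by rewrite expf_neq0 // subr_eq0.
  have hwE : h w = (q / (g w * p)) *: h' (tau w) + (- g' / (g w * p)) *: z w.
    have gp0 : g w * p != 0 by rewrite mulf_neq0.
    apply: (scalerI gp0); rewrite scalerDr !scalerA !(mulrC (g w * p)) !divfK // -e.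
    by rewrite scaleNr addrC addKr || (rewrite scaleNr addrAC subrr add0r).
  have zwE : z w = (g w)^-1 *: z' (tau w) by rewrite -zE scalerA mulVf // scale1r.
  have q0 : q / (g w * p) != 0.
    apply/eqP => q0; have [|_ /eqP] := indw (- (- g' / (g w * p))) 1.
      by rewrite scale1r hwE q0 scale0r add0r scaleNr addNr.
    by rewrite oner_eq0.
  rewrite hwE {2}zwE scalerA [in LHS]zwE; apply: gdir_tri => //.
  by rewrite invr_eq0.
have ct : {for chart i x, continuous tau}.
  by apply: derivable_continuous; have /is_derive1P[] := nbhs_singleton dtau.
have tx : tau (chart i x) = chart i' x by exact: tauE.
have comp_cont (f : C -> vec) : vholo f (chart i' x) ->
    vcont (chart i x) (fun w => f (tau w)).
  move=> /vholo_cont hf j; have := hf j; rewrite -tx => cf.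
  exact: (@continuous_comp _ _ _ tau (fun v => f v 0 j) _ ct cf).
have ind1 := nbhs_singleton (frame_indep fr).
have ind2 : indep (z' (tau (chart i x))) (h' (tau (chart i x))).
  by rewrite tx; exact: nbhs_singleton (frame_indep fr').
rewrite -tx; apply/matrixP => a b.
have c1 := gdir_cont (i := a) (j := b) (vholo_cont (lift_vholo zl)) (vholo_cont (frame_vholo fr)) ind1.
have c2 := gdir_cont (i := a) (j := b) (comp_cont _ (lift_vholo zl')) (comp_cont _ (frame_vholo fr')) ind2.
by apply: (punctured_eq c1 c2); apply: filterS eqd => w H /H ->.
Qed.

(** Uniqueness of the tangent line and of the antipodal point makes the set in
    the definition of the Gauss map a singleton. *)
Lemma gauss_map_frame F x u v : is_frame S F x u v -> gauss_map S F x = gdir u v - CPpt u.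
Proof.
move=> fr; have ind := is_frame_indep fr; have Fx := is_frame_point fr.
apply: xget_unique => /=.
  exists (proj_line u v), (gdir u v); split; last by rewrite Fx.
    by have [i [k [z [m [h [[p1 p2 p3] -> ->]]]]]] := fr; exists i, k, z, m, h; split; [exact: p1|exact: p2|exact: p3|exact: erefl].
  by rewrite Fx; exact: antipodal_gdir.
move=> B [L [A' [[i [k [z [m [h [zl hP h0 LE]]]]]] anti ->]]].
have fr' : is_frame S F x (z (chart i x)) (h (chart i x)).
  exists i, k, z, m, h; split; [|exact: erefl|exact: erefl].
  by split; [exact: zl|exact: hP|exact: h0].
have ind' := is_frame_indep fr'; have Fx' := is_frame_point fr'.
rewrite Fx' LE in anti; rewrite (antipodal_unique ind' anti) (frame_unique fr' fr).
by rewrite Fx.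
Qed.

(** Multiplying a lift by P gives a lift of the transported curve once its
    k-th coordinate is normalized again; this changes the frame by a
    triangular matrix. *)
Lemma frame_proj F P x u v : P \in unitmx -> is_frame S F x u v ->
  gauss_map S (fun y => proj_map P (F y)) x = gdir (u *m P) (v *m P) - CPpt (u *m P) /\
  proj_map P (F x) = CPpt (u *m P).
Proof.
move=> uP fr; have ind := is_frame_indep fr; have Fx := is_frame_point fr.
have u0 := indep_neq0 ind; split; last by rewrite Fx proj_map_CPpt.
have [k0 k0P] : exists k0, (u *m P) 0 k0 != 0.
  apply: contrapT => nj; have /eqP := mulmx_unit_neq0 uP u0; apply.
  apply/rowP => j; rewrite [RHS]mxE.
  by apply/eqP; apply: contrapT => /negP hj; apply: nj; exists j.
have [i [k [z [m [h [frz zE hE]]]]]] := fr; have [zl hP h0] := frz; have [ix zP] := zl.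
pose zp w := z w *m P; pose g w : C := (zp w 0 k0)^-1.
have zph : vholo zp (chart i x) by exact: vholo_mulmx (lift_vholo zl).
have zpn : \forall w \near chart i x, zp w 0 k0 != 0.
  by apply: (cont_neq0 (vholo_cont zph k0)); rewrite /zp -zE; exact: k0P.
have g0 : g (chart i x) != 0.
  by rewrite /g invr_eq0 /zp -zE; exact: k0P.
pose hp w := g w *: (h w *m P) - (g w ^+ 2 * (h w *m P) 0 k0) *: zp w.
have vzp : \forall w \near chart i x, vder zp w (derive1 z w *m P).
  by apply: filterS (lift_vder zl) => w; exact: vder_mulmx.
have vg : \forall w \near chart i x,
    is_derive (w : C) 1 g (- ((derive1 z w *m P) 0 k0 / zp w 0 k0 ^+ 2)).
  by apply: filterS2 vzp zpn => w /(_ k0) dz z0; exact: derV.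
have hhp : vholo hp (chart i x).
  have hmP := vholo_near (vholo_mulmx P (frame_vholo frz)).
  apply: near_vholo; apply: filterS3 vg hmP vzp => w dg dh dz.
  have := vder_scale dg dh; set d1 := (X in vder _ _ X) => v1.
  have := vder_scale (derM (derX 2 dg) (dh k0)) dz; set d2 := (X in vder _ _ X) => v2.
  exists (d1 - d2) => j; have := derB (v1 j) (v2 j); congr is_derive.
    by apply/funext => t; rewrite !mxE.
  by rewrite [RHS]mxE; congr (_ + _); rewrite [RHS]mxE.
have frp : lift_frame (S := S) (fun y => proj_map P (F y)) x i k0
    (fun w => g w *: zp w) m hp.
  split.
  - split; [exact: ix|]; apply: filterS3 zP zpn (filterI vg vzp) => w [_ zk FE] z0 [dg dz].
    split; [by have /vderP[] := vder_scale dg dz|by rewrite mxE mulVf|].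
    rewrite FE (proj_map_CPpt uP (row_neq0 zk)); apply/esym/CPpt_scale.
    by rewrite /g invr_eq0.
  - apply: filterS3 (vholo_near hhp) hP (filterI vg (filterI vzp zpn)) => w dh [_ e] [dg [dz z0]].
    split; first by have /vderP[] := dh.
    have /vderP[_ ->] := vder_scale dg dz; rewrite e /hp -!scalemxAl mxE.
    rewrite scalerBr !scalerA -addrC -scaleNr; congr (_ *: _ + _ *: _).
      by rewrite mulrC.
    by rewrite /g; field.
  have ind' := indep_mul uP ind; apply/eqP => hp0.
  move: hp0; rewrite /hp /zp -hE -zE => hp0.
  have [|_ /eqP] := ind' (- (g (chart i x) ^+ 2 * (v *m P) 0 k0)) (g (chart i x)).
    by rewrite scaleNr addrC.
  by rewrite (negPf g0).
have frp' : is_frame S (fun y => proj_map P (F y)) x (g (chart i x) *: zp (chart i x))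
    (hp (chart i x)).
  by exists i, k0, (fun w => g w *: zp w), m, hp; split; [exact: frp|exact: erefl|exact: erefl].
rewrite (gauss_map_frame frp') /hp /zp -hE -zE (CPpt_scale _ g0) -scaleNr.
by rewrite (gdir_tri _ _ _ g0 g0).
Qed.

(** If the minor vanished identically, then by the quotient rule the ratio of the two
    linear forms would be locally constant along the curve. *)
Lemma minor_isolated F x i k z m h (c d : 'cV[C]_n.+1) :
  holomorphic_curve S F -> full F ->
  (forall s t : C, s *: c + t *: d = 0 -> s = 0 /\ t = 0) ->
  lift_frame (S := S) F x i k z m h ->
  \forall w \near chart i x, w != chart i x ->
    (z w *m c) 0 0 * (h w *m d) 0 0 - (z w *m d) 0 0 * (h w *m c) 0 0 != 0.
Proof.
move=> hF fF cd fr; have [zl hP h0] := fr; have [ix zP] := zl.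
pose f w := (z w *m c) 0 0; pose g w := (z w *m d) 0 0.
pose fh w := (h w *m c) 0 0; pose gh w := (h w *m d) 0 0.
have hz := lift_vholo zl; have hh := frame_vholo fr.
have hf : holo f (chart i x) := vholo_mulmx c hz 0.
have hg : holo g (chart i x) := vholo_mulmx d hz 0.
have hfh := vholo_near (vholo_mulmx c hh); have hgh := vholo_near (vholo_mulmx d hh).
have hfz := vholo_near (vholo_mulmx c hz); have hgz := vholo_near (vholo_mulmx d hz).
have hW : holo (fun w => f w * gh w - g w * fh w) (chart i x).
  apply: filterS3 hfh hgh (filterI hfz hgz) => w /(_ 0) a1 /(_ 0) a2 [/(_ 0) a3 /(_ 0) a4].
  by have /is_derive1P[] := derB (derM a3 a2) (derM a4 a1).
apply: (holo_isolated hW) => W0.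
have d0 : d != 0.
  by apply/eqP => d0; have [|_ /eqP] := cd 0 1; rewrite ?oner_eq0 // d0 scaler0 scale0r addr0.
have gE y : affine_lift (S := S) F y i k z -> F y *m d = 0 <-> g (chart i y) = 0.
  move=> /lift_point[zk ->]; rewrite /g mx11_eq0.
  by apply: CPpt_mul_col; exact: row_neq0 zk.
have g0 : ~ (\forall w \near chart i x, g w = 0).
  move=> gn; apply: (@full_not_near _ _ S _ F x d hF fF d0).
  apply: filterS2 (lift_near zl) (near_chart ix gn) => y zy gy.
  by apply/gE.
have [w1 w1x [g1 [y [iy w1E zy]] W1 dfg]] : exists2 w1, w1 != chart i x &
    [/\ g w1 != 0, exists y, [/\ chart_dom i y, chart i y = w1 & affine_lift (S := S) F y i k z],
      \forall w \near w1, f w * gh w - g w * fh w = 0 &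
      \forall w \near w1, exists a : C, is_derive (w : C) 1 f (a * fh w) /\
         is_derive (w : C) 1 g (a * gh w)].
  have dn : \forall w \near chart i x, exists a : C, is_derive (w : C) 1 f (a * fh w) /\
         is_derive (w : C) 1 g (a * gh w).
    apply: filterS2 (lift_vder zl) hP => w dz [_ e].
    exists ((w - chart i x) ^+ m).
    have := vder_mulmx c dz 0; have := vder_mulmx d dz 0.
    have sc (k0 : C) (M : 'M[C]_1) : (k0 *: M) 0 0 = k0 * M 0 0 by rewrite mxE.
    by rewrite e -!scalemxAl !sc => dg' df'; split; [exact: df'|exact: dg'].
  have yn := near_chart_inv ix (lift_near zl).
  have H := filterI (holo_isolated hg g0) (filterI yn (filterI (near_join W0) (near_join dn))).
  have [w wx [gw [[iw cw zw] [W1 d1]]]] := exists_near_neq (H _ _ _); exists w; first exact: wx.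
  split; [exact: gw wx| |exact: W1|exact: d1].
  by exists (chart_inv i w).
have cg1 : {for w1, continuous g}.
  by have [a [_ /is_derive1P[dg _]]] := nbhs_singleton dfg; exact: derivable_continuous.
have gn1 := cont_neq0 cg1 g1.
have const : \forall w \near w1, f w * (g w)^-1 = f w1 * (g w1)^-1.
  apply: (@derive0_constant _ (fun w => f w * (g w)^-1)).
  apply: filterS3 gn1 W1 dfg => w gw Ww [a [df dg]].
  have := derM df (derV dg gw); congr is_derive.
  have -> : a * fh w * (g w)^-1 + f w * - (a * gh w / g w ^+ 2) =
    - a * (f w * gh w - g w * fh w) / g w ^+ 2 by field.
  by rewrite Ww mulr0 mul0r.
(* The linear form e vanishes on the curve near the point of coordinate w1. *)
pose l := f w1 * (g w1)^-1; pose e := c - l *: d.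
have e0 : e != 0.
  apply/eqP => e0; have [|/eqP] := cd 1 (- l); last by rewrite oner_eq0.
  by rewrite scale1r scaleNr.
have const' : \forall w \near chart i y, f w * (g w)^-1 = l by rewrite w1E.
have gn1' : \forall w \near chart i y, g w != 0 by rewrite w1E.
apply: (@full_not_near _ _ S _ F y e hF fF e0).
apply: filterS3 (lift_near zy) (near_chart iy const') (near_chart iy gn1') => t /lift_point[tk ->] te gt.
apply/(CPpt_mul_col _ (row_neq0 tk)); apply/mx11_eq0.
have -> : (z (chart i t) *m e) 0 0 = f (chart i t) - l * g (chart i t).
  rewrite /e mulmxBr -scalemxAr [LHS]mxE; congr (_ + _).
  by rewrite [LHS]mxE; congr (- _); rewrite [LHS]mxE.
have fE : f (chart i t) = l * g (chart i t) by exact: (canRL (mulfVK gt) te).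
by rewrite fE subrr.
Qed.

End Frames.

(** * Frames over the whole surface and the finite exceptional sets *)
Section GlobalFrames.
Variables (R : realType) (T : ptopologicalType) (S : riemann_surface R T) (n : nat).
Local Notation C := (Cx R).
Local Notation vec := 'rV[C]_n.+1.
Local Notation mat := 'M[C]_n.+1.
Implicit Types (F : T -> mat) (x y : T) (i : chart_index S) (P : mat).

Lemma isolated_finite (Q : T -> Prop) : compact [set: T] ->
  (forall x, \forall y \near x, y != x -> ~ Q y) -> finite_set [set x | Q x].
Proof.
move=> cT iso; pose U x : set T := [set y | y != x -> ~ Q y]°%classic.
move: cT; rewrite compact_cover => /(_ T [set: T] U).
case=> [x _|x _|D _ TD].
- exact: open_interior.
- by exists x => //; exact: iso.
apply: (sub_finite_set _ (finite_fset D)) => y Qy; have [x xD Uxy] := TD y I.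
by have [->|yx] := eqVneq y x; [|have := interior_subset Uxy yx].
Qed.

Lemma triangular_frames F x u v u' v' : is_frame S F x u v -> is_frame S F x u' v' ->
  exists k l m, [/\ k != 0, l != 0, u' = k *: u & v' = l *: v + m *: u].
Proof.
move=> fr fr'; apply: gdir_inj; [exact: is_frame_indep fr|exact: is_frame_indep fr'| |].
  by rewrite -(is_frame_point fr) (is_frame_point fr').
exact: frame_unique fr fr'.
Qed.

Definition vminor (u v : vec) (c d : 'cV[C]_n.+1) : C :=
  (u *m c) 0 0 * (v *m d) 0 0 - (u *m d) 0 0 * (v *m c) 0 0.

Lemma vminor_tri u v c d k l m :
  vminor (k *: u) (l *: v + m *: u) c d = k * l * vminor u v c d.
Proof.
have sc (a b : C) (M N : 'M[C]_1) : (a *: M + b *: N) 0 0 = a * M 0 0 + b * N 0 0.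
  by rewrite [LHS]mxE; congr (_ + _); rewrite [LHS]mxE.
have sc1 (a : C) (M : 'M[C]_1) : (a *: M) 0 0 = a * M 0 0 by rewrite [LHS]mxE.
rewrite /vminor !mulmxDl -!scalemxAl !sc !sc1.
by move: ((u *m c) 0 0) ((u *m d) 0 0) ((v *m c) 0 0) ((v *m d) 0 0) => p q r s; ring.
Qed.

Variable F : T -> mat.
Hypotheses (hF : holomorphic_curve S F) (fF : full F) (n0 : (0 < n)%N).
Hypothesis cT : compact [set: T].

Lemma frames_exist : exists Z H : T -> vec, forall x, is_frame S F x (Z x) (H x).
Proof.
have ex x : exists p : vec * vec, is_frame S F x p.1 p.2.
  have [i [k [z [m [h fr]]]]] := exists_frame x hF fF n0.
  exists (z (chart i x), h (chart i x)), i, k, z, m, h.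
  by split; [exact: fr|exact: erefl|exact: erefl].
have [p pP] := choice ex; exists (fun x => (p x).1), (fun x => (p x).2).
exact: pP.
Qed.

Variables Z H : T -> vec.
Hypothesis ZH : forall x, is_frame S F x (Z x) (H x).

(** The frames chosen at the points of the surface need not be continuous, but up to
    triangular changes they agree near each point with a continuous frame. *)
Lemma frames_local x0 : exists z h : T -> vec,
  [/\ vcont x0 z, vcont x0 h, indep (z x0) (h x0) &
   \forall y \near x0, exists k l m,
     [/\ k != 0, l != 0, Z y = k *: z y & H y = l *: h y + m *: z y]].
Proof.
have [i [k [z [m [h fr]]]]] := exists_frame x0 hF fF n0; have [zl _ _] := fr.
have [ix _] := zl.
have cc (f : C -> vec) : vholo f (chart i x0) -> vcont x0 (fun y => f (chart i y)).
  move=> /vholo_cont hf j.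
  exact: (@continuous_comp _ _ _ (chart i) (fun v => f v 0 j) _ (chart_continuous ix) (hf j)).
exists (fun y => z (chart i y)), (fun y => h (chart i y)); split.
- exact: cc (lift_vholo zl).
- exact: cc (frame_vholo fr).
- exact: nbhs_singleton (frame_indep fr).
apply: filterS (frame_near fr) => y [l0 l00 fy].
have [a [b [c [a0 b0 -> ->]]]] := triangular_frames fy (ZH y).
exists a, (b * l0), c; split; [exact: a0| |exact: erefl|by rewrite scalerA].
exact: mulf_neq0.
Qed.

Lemma finite_hyperplane (c : 'cV[C]_n.+1) : c != 0 -> finite_set [set x | Z x *m c = 0].
Proof.
move=> c0; apply: (isolated_finite cT) => x.
have [/(full_not_near hF fF c0)[]|iso] := curve_hyperplane_local x c hF.
apply: filterS iso => y yP yx Zc; apply: (yP yx).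
rewrite (is_frame_point (ZH y)); apply/CPpt_mul_col => //.
exact: indep_neq0 (is_frame_indep (ZH y)).
Qed.

Lemma finite_minor (c d : 'cV[C]_n.+1) :
  (forall s t : C, s *: c + t *: d = 0 -> s = 0 /\ t = 0) ->
  finite_set [set x | vminor (Z x) (H x) c d = 0].
Proof.
move=> cd; apply: (isolated_finite cT) => x.
have [i [k [z [m [h fr]]]]] := exists_frame x hF fF n0; have [zl _ _] := fr.
have [ix _] := zl; have iso := near_chart ix (minor_isolated hF fF cd fr).
apply: filterS3 iso (near_dom ix) (frame_near fr) => y yP iy [l l0 fy] yx.
have [a [b [e [a0 b0 -> ->]]]] := triangular_frames fy (ZH y).
rewrite scalerA vminor_tri => /eqP; apply/negP; apply: mulf_neq0.
  by rewrite !mulf_neq0.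
by apply: yP; apply: contra_neq yx; exact: chart_inj.
Qed.

End GlobalFrames.

(** * The Riemannian measure is finite, nonzero and without atoms *)
Section MonotoneIntegral.
Local Open Scope ereal_scope.
Variables (d : measure_display) (T : measurableType d) (R : realType).
Variable mu : {measure set T -> \bar R}.

(** The integral of a nonnegative function is a supremum over simple functions
    below it, so it is monotone even without measurability. *)
Lemma ge0_le_integral_any (D E : set T) (f g : T -> \bar R) :
  (forall x, D x -> 0 <= f x) -> (forall x, E x -> 0 <= g x) -> D `<=` E ->
  (forall x, D x -> f x <= g x) ->
  \int[mu]_(x in D) f x <= \int[mu]_(x in E) g x.
Proof.
move=> f0 g0 DE fg; rewrite (ge0_integralE _ f0) (ge0_integralE _ g0).
apply: ereal_sup_le => _ [h hf <-]; exists h => // x; apply: le_trans (hf x) _; rewrite !patchE.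
case: ifPn => [xD|_]; last by case: ifPn => // xE; apply: g0; rewrite inE in xE.
rewrite inE in xD; rewrite ifT; first exact: fg.
by rewrite inE; exact: DE.
Qed.

End MonotoneIntegral.

Section Area.
Variables (R : realType) (T : ptopologicalType) (S : riemann_surface R T).
Local Notation C := (Cx R).
Local Notation borelT := (g_sigma_algebraType (@open T)).
Local Notation leb2 := ((@lebesgue_measure R \x @lebesgue_measure R)%E).

Lemma open_borel (U : set T) : open U -> measurable (U : set borelT).
Proof. by move=> oU; exact: sub_sigma_algebra. Qed.

Lemma point_borel (x : T) : measurable ([set x] : set borelT).
Proof.
rewrite -[X in measurable X]setCK; apply: measurableC; apply: open_borel.
apply: closed_openC; apply: accessible_closed_set1.
exact: hausdorff_accessible (surface_hausdorff S).
Qed.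

Lemma borel_continuous (f : T -> R) : continuous f ->
  measurable_fun [set: borelT] (f : borelT -> R).
Proof.
move=> /continuousP cf; apply: (measurability _ (measurable_realfun.RGenOpens.measurableE R)).
move=> _ [_ [a [b ->] <-]]; rewrite setTI; apply: open_borel.
by apply: cf; exact: interval_open.
Qed.

Variable g : conformal_metric S.

Definition energy i (w : C) : R := metric g i (chart_inv i w) 1 1.

Lemma energy_gt0 i x : chart_dom i x -> 0 < energy i (chart i x).
Proof. by move=> ix; rewrite /energy chartK //; apply: metric_pos => //; exact: oner_neq0. Qed.

Lemma energy_cont i x : chart_dom i x -> {for chart i x, continuous (energy i)}.
Proof.
move=> ix; have [+ _] := metric_smooth g i 1 1 0.
by apply; exists x.
Qed.

(** Multiplication by i is an isometry, so with the usual notation for the first fundamental form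
    E = G and F = 0, and sqrt (E G - F^2) is E itself. *)
Lemma area_densityE i x : chart_dom i x ->
  area_density g i (complex.Re (chart i x), complex.Im (chart i x)) = energy i (chart i x).
Proof.
move=> ix; rewrite /area_density /energy /=.
have -> : complex.Re (chart i x) +i* complex.Im (chart i x) = chart i x by case: (chart i x).
rewrite chartK //; set G := metric g i x.
have i2 : ('i%C : C) * 'i%C = -1 by rewrite -expr2 sqr_i.
have eG : G 'i%C 'i%C = G 1 1.
  by rewrite -[RHS](metric_conformal g 1 1 ix) !mulr1.
have lin0 v : G 0 v = 0.
  by have := metric_linear g (-1) 0 0 v ix; rewrite mulr0 addr0 mulN1r addNr.
have neg v w : G (- v) w = - G v w.
  have := metric_linear g (-1) v 0 w ix.
  by rewrite rmorphN rmorph1 mulN1r addr0 -/G lin0 addr0 mulN1r.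
have F0 : G 1 'i%C = 0.
  have := metric_conformal g 1 'i%C ix; rewrite mulr1 i2 -/G => e.
  have e2 : G 'i%C (-1) = - G 1 'i%C.
    by rewrite /G (Defs.metric_sym g) //; exact: neg.
  by move: e; rewrite e2 => e; lra.
rewrite eG F0 expr0n /= subr0 -expr2 sqrtr_sqr gtr0_norm //.
by apply: metric_pos => //; exact: oner_neq0.
Qed.

Variable mu : {measure set borelT -> \bar R}.
Hypothesis hmu : is_riemannian_measure g mu.

Lemma muE i (E : set borelT) : measurable E -> E `<=` chart_dom i ->
  mu E = (\int[leb2]_(p in
    [set (complex.Re (chart i x), complex.Im (chart i x)) | x in E])
    (area_density g i p)%:E)%E.
Proof. exact: hmu. Qed.

Definition box (w : C) (t : R) : set (R * R) :=
  `[complex.Re w - t, complex.Re w + t] `*` `[complex.Im w - t, complex.Im w + t].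

Lemma box_measure w t : 0 <= t -> leb2 (box w t) = ((2 * t) * (2 * t))%:E.
Proof.
move=> t0; rewrite /box product_measure1E //.
have e (x : R) : @lebesgue_measure R `[x - t, x + t] = (2 * t)%:E.
  rewrite lebesgue_measure_itv /= lte_fin; case: ifPn => [_|].
    by rewrite -EFinB; congr EFin; ring.
  by rewrite -leNgt => h; congr EFin; lra.
by transitivity ((2 * t)%:E * (2 * t)%:E)%E; [congr (_ * _)%E; exact: e|].
Qed.

Lemma measurable_box w t : measurable (box w t).
Proof. exact: measurableX. Qed.

Lemma box_integral w t k : 0 <= t ->
  (\int[leb2]_(x in box w t) (cst k%:E) x = k%:E * ((2 * t) * (2 * t))%:E)%E.
Proof.
move=> t0; rewrite integral_cst; last exact: measurable_box.
by congr (_ * _)%E; exact: box_measure.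
Qed.

Definition cdisc (i : chart_index S) (w : C) (t : R) : set T :=
  [set y | chart_dom i y /\ cabs (chart i y - w) < t].

Lemma open_cdisc i w t : open (cdisc i w t).
Proof.
rewrite openE => y [iy yt].
have n1 : \forall v \near chart i y, cabs (v - w) < t.
  apply/nbhs_cabsP; exists (t - cabs (chart i y - w)); first by rewrite subr_gt0.
  move=> v; rewrite ltrBrDr; apply: le_lt_trans.
  by have := cabsD (v - chart i y) (chart i y - w); rewrite addrA subrK.
by apply: filterS2 (near_dom iy) (near_chart iy n1) => u iu ut; split.
Qed.

(** In a chart the point is covered by degenerate squares of area zero; bounds
    by nonnegative constants need no measurability of the area density. *)
Lemma mu_point x : mu [set x] = 0%E.
Proof.
have [i ix] := chart_cover S x; pose w := chart i x.
have pE : [set (complex.Re (chart i y), complex.Im (chart i y)) | y in [set x]] =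
    [set (complex.Re w, complex.Im w)].
  by rewrite image_set1.
rewrite (@muE i _ (point_borel x)) ?pE; last by move=> y ->.
pose p : R * R := (complex.Re w, complex.Im w); apply/eqP; rewrite eq_le; apply/andP; split; last first.
  by apply: integral_ge0 => q _; rewrite lee_fin sqrtr_ge0.
have bE : box w 0 = [set p].
  rewrite /box !subr0 !addr0 !set_itv1; apply/seteqP; split=> [[a b] [/= -> ->]//|].
  by move=> _ ->.
apply: (@le_trans _ _ (\int[leb2]_(x in box w 0) (cst (area_density g i p)%:E) x)%E).
  rewrite bE; apply: ge0_le_integral_any => // [q _|q _|q ->] //.
  - by rewrite lee_fin sqrtr_ge0.
  - by rewrite lee_fin sqrtr_ge0.
by rewrite box_integral // mulr0 mul0r mule0.
Qed.

Lemma set_of_cons (x : T) s : [set` (x :: s)] = [set x] `|` [set` s].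
Proof.
apply/seteqP; split=> y; rewrite /= inE; first by move=> /predU1P[->|ys]; [left|right].
by case=> [->|ys]; rewrite ?eqxx // ys orbT.
Qed.

Lemma set_of_nil : [set` ([::] : seq T)] = set0.
Proof. by apply/seteqP; split. Qed.

Lemma mu_finite_set (A : set T) : finite_set A ->
  measurable (A : set borelT) /\ mu A = 0%E.
Proof.
move=> fA; have mA : measurable (A : set borelT).
  have -> : A = \bigcup_(x in A) [set x].
    by apply/seteqP; split=> [x Ax|x [y Ay ->]] //; exists x.
  by apply: fin_bigcup_measurable => // x _; exact: point_borel.
split=> //; apply/eqP; rewrite eq_le measure_ge0 andbT.
have [s ->] := (finite_seqP A).1 fA.
elim: s => [|x s IH].
  by rewrite set_of_nil measure0.
rewrite set_of_cons.
have ms : measurable ([set` s] : set borelT).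
  have -> : [set` s] = \bigcup_(y in [set` s]) [set y].
    by apply/seteqP; split=> [y Ay|y [z Az ->]] //; exists y.
  by apply: fin_bigcup_measurable => // y _; exact: point_borel.
apply: le_trans (measureU2 _ (point_borel x) ms) _.
rewrite -[leRHS](adde0 0%E); apply: leeD; last exact: IH.
by rewrite le_eqVlt; apply/orP; left; apply/eqP; exact: mu_point.
Qed.

Lemma mu_cdisc i x t M : chart_dom i x -> 0 < t ->
  (forall y, cdisc i (chart i x) t y -> energy i (chart i y) <= M) ->
  (mu (cdisc i (chart i x) t) < +oo)%E.
Proof.
move=> ix t0 EM; set w := chart i x in EM *.
have M0 : 0 <= M.
  have := EM x; rewrite /cdisc /= -/w subrr cabs0 => /(_ (conj ix t0)).
  by apply: le_trans; apply: ltW; exact: energy_gt0.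
rewrite (@muE i _ (open_borel (open_cdisc i w t))); last by move=> y [].
apply: (@le_lt_trans _ _ (\int[leb2]_(x in box w t) (cst M%:E) x)%E).
  apply: ge0_le_integral_any.
  - by move=> q _; rewrite lee_fin sqrtr_ge0.
  - by move=> q _; rewrite lee_fin.
  - move=> _ [y [iy yt] <-]; split; rewrite /= in_itv /=.
      have := le_lt_trans (Re_le_cabs _) yt; rewrite cxReD cxReN ltr_norml.
      by move=> /andP[h1 h2]; apply/andP; split; lra.
    have := le_lt_trans (Im_le_cabs _) yt; rewrite cxImD cxImN ltr_norml.
    by move=> /andP[h1 h2]; apply/andP; split; lra.
  - by move=> _ [y yV <-]; rewrite area_densityE ?lee_fin; [exact: EM|case: yV].
by rewrite box_integral ?(ltW t0) // -EFinM ltry.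
Qed.

(** The energy is bounded on a small coordinate disc, which lies in a square;
    finitely many such discs cover the surface. *)
Lemma mu_finite : compact [set: T] -> (mu [set: T] < +oo)%E.
Proof.
rewrite compact_cover => cT.
have loc x : exists U : set T, [/\ open U, U x & (mu U < +oo)%E].
  have [i ix] := chart_cover S x.
  have /cvg_realP/(_ 1 ltr01) := energy_cont ix; rewrite near_simpl => /nbhs_cabsP[t t0 tP].
  exists (cdisc i (chart i x) t); split.
  - exact: open_cdisc.
  - by split; rewrite // subrr cabs0.
  apply: (@mu_cdisc i x t (energy i (chart i x) + 1)) => // y [iy yt].
  have /= := tP _ yt; rewrite ltr_norml => /andP[_ h].
  by rewrite -lerBlDl ltW.
have [U UP] := choice loc.
have [x _|x _|D _ TD] := cT T [set: T] U; first by have [] := UP x.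
  by exists x => //; have [] := UP x.
have fin (s : seq T) : measurable (\bigcup_(x in [set` s]) U x : set borelT) /\
    (mu (\bigcup_(x in [set` s]) U x) < +oo)%E.
  elim: s => [|x s [ms IH]]; first by rewrite set_of_nil bigcup_set0 measure0.
  rewrite set_of_cons bigcup_setU1; have [oU _ mU] := UP x.
  split; first by apply: measurableU => //; exact: open_borel.
  apply: le_lt_trans (measureU2 _ (open_borel oU) ms) _.
  exact: lte_add_pinfty.
have [mD finD] := fin (finmap.enum_fset D).
by apply: le_lt_trans finD; apply: le_measure; rewrite ?inE.
Qed.

(** A small coordinate disc contains a square on which the energy is at least
    half its value at the centre. *)
Lemma mu_gt0 : (0 < mu [set: T])%E.
Proof.
have [i ix] := chart_cover S point; set w := chart i point.
have E0 := energy_gt0 ix; rewrite -/w in E0; set m := energy i w / 2.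
have m0 : 0 < m by rewrite divr_gt0.
have n1 : \forall v \near w, m <= energy i v.
  have /cvg_realP/(_ m m0) := energy_cont ix; rewrite near_simpl.
  have e : energy i w = m + m by rewrite /m -splitr.
  apply: filterS => v /=; rewrite -/w ltr_norml e => /andP[h _].
  by move: h; rewrite -/(energy i v); move: (energy i v) => u; lra.
have n2 : \forall v \near w, (chart i @` chart_dom i) v.
  by apply: open_nbhs_nbhs; split; [exact: chart_img_open|exists point].
have /nbhs_cabsP[t t0 tP] : nbhs w [set v | m <= energy i v /\ (chart i @` chart_dom i) v].
  by apply: filterS2 n1 n2 => v h1 h2; split.
have mT : measurable ([set: T] : set borelT) by apply: open_borel; exact: openT.
apply: (@lt_le_trans _ _ (mu (cdisc i w t))); last first.
  by apply: le_measure; rewrite ?inE //; apply: open_borel; exact: open_cdisc.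
rewrite (@muE i _ (open_borel (open_cdisc i w t))); last by move=> y [].
have t4 : 0 < t / 4 by rewrite divr_gt0.
apply: (@lt_le_trans _ _ (\int[leb2]_(x in box w (t / 4)) (cst m%:E) x)%E).
  by rewrite box_integral ?(ltW t4) // -EFinM lte_fin !mulr_gt0.
apply: ge0_le_integral_any.
- by move=> q _; rewrite lee_fin ltW.
- by move=> q _; rewrite lee_fin sqrtr_ge0.
- move=> [a b] [/=]; rewrite !in_itv /= => /andP[a1 a2] /andP[b1 b2].
  have near_ab : cabs ((a +i* b : C) - w) < t.
    apply: le_lt_trans (cabs_le_ReIm _) _; rewrite cxReD cxReN cxImD cxImN /=.
    have k1 : `|a - complex.Re w| <= t / 4 by rewrite ler_norml; apply/andP; split; lra.
    have k2 : `|b - complex.Im w| <= t / 4 by rewrite ler_norml; apply/andP; split; lra.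
    by lra.
  have [_ [y iy yE]] := tP _ near_ab.
  by exists y; rewrite /cdisc /= ?yE.
- move=> [a b] [/=]; rewrite !in_itv /= => /andP[a1 a2] /andP[b1 b2].
  have near_ab : cabs ((a +i* b : C) - w) < t.
    apply: le_lt_trans (cabs_le_ReIm _) _; rewrite cxReD cxReN cxImD cxImN /=.
    have k1 : `|a - complex.Re w| <= t / 4 by rewrite ler_norml; apply/andP; split; lra.
    have k2 : `|b - complex.Im w| <= t / 4 by rewrite ler_norml; apply/andP; split; lra.
    by lra.
  have [me [y iy yE]] := tP _ near_ab; rewrite lee_fin.
  have := area_densityE iy; rewrite yE /= => ->; exact: me.
Qed.

End Area.

(** * Plucker coordinates of a frame *)
Section Plucker.
Variables (R : realType) (n : nat).
Local Notation C := (Cx R).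
Local Notation vec := 'rV[C]_n.+1.
Local Notation mat := 'M[C]_n.+1.
Implicit Types (u v z h : vec) (k l m : C) (G T U : mat).

Definition plk z h i j : C := z 0 i * h 0 j - z 0 j * h 0 i.

(** Each pair of indices is counted twice, so this is twice the squared norm of
    the bivector z ^ h; only ratios of it are used. *)
Definition plsq z h : R := \sum_i \sum_j cabs (plk z h i j) ^+ 2.

(** Lagrange's identity. *)
Lemma plsq_lagrange z h : plsq z h = 2 * (nsq z * nsq h - cabs (hdot z h) ^+ 2).
Proof.
apply: (@complexI R); transitivity (2 * (hdot z z * hdot h h - hdot z h * hdot h z)); last first.
  rewrite hdot_mul !hdot_nsq; move: (cabs _ ^+ 2) (nsq z) (nsq h) => c p q.
  by rewrite -rmorphM -rmorphB -[2 in LHS](rmorph_nat (real_complex R)) -rmorphM.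
rewrite !hdotE rmorph_sum /=.
rewrite (eq_bigr (fun i => \sum_j ((z 0 i * (z 0 i)^*) * (h 0 j * (h 0 j)^*) +
   (h 0 i * (h 0 i)^*) * (z 0 j * (z 0 j)^*) -
   ((z 0 i * (h 0 i)^*) * (h 0 j * (z 0 j)^*) +
    (h 0 i * (z 0 i)^*) * (z 0 j * (h 0 j)^*))))); last first.
  move=> i _; rewrite rmorph_sum; apply: eq_bigr => j _ /=.
  rewrite -[LHS]cabs_conj /plk rmorphB !rmorphM /=; ring.
have split4 (a b c d : 'I_n.+1 -> C) : \sum_i \sum_j (a i * b j + b i * a j - (c i * d j + d i * c j)) =
    2 * ((\sum_i a i) * (\sum_i b i) - (\sum_i c i) * (\sum_i d i)).
  rewrite (eq_bigr (fun i => a i * (\sum_j b j) + b i * (\sum_j a j) -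
      (c i * (\sum_j d j) + d i * (\sum_j c j)))); last first.
    by move=> i _; rewrite sumrB !big_split /= -!mulr_sumr.
  by rewrite sumrB !big_split /= -!mulr_suml; ring.
exact: (split4 (fun i => z 0 i * (z 0 i)^*) (fun i => h 0 i * (h 0 i)^*)
  (fun i => z 0 i * (h 0 i)^*) (fun i => h 0 i * (z 0 i)^*)).
Qed.

Lemma plsq_tri z h k l m :
  plsq (k *: z) (l *: h + m *: z) = cabs k ^+ 2 * cabs l ^+ 2 * plsq z h.
Proof.
rewrite /plsq mulr_sumr; apply: eq_bigr => i _; rewrite mulr_sumr; apply: eq_bigr => j _.
rewrite -!exprMn -!cabsM; congr (cabs _ ^+ 2); rewrite /plk !mxE; ring.
Qed.

Lemma plsq_orthE z h : plsq z (orth z h) = nsq z ^+ 2 * plsq z h.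
Proof.
have e : orth z h = hdot z z *: h + (- hdot h z) *: z by rewrite /orth scaleNr.
have := plsq_tri z h 1 (hdot z z) (- hdot h z).
rewrite -e scale1r cabs1 expr1n mul1r hdot_nsq cabs_real (ger0_norm (nsq_ge0 z)).
exact.
Qed.

Lemma plsq_orth z h : nsq z ^+ 2 * plsq z h = 2 * (nsq z * nsq (orth z h)).
Proof.
rewrite -plsq_orthE plsq_lagrange hdotC hdot_orth rmorph0 cabs0 expr0n /=.
by rewrite subr0.
Qed.

Lemma plsq_gt0 z h : indep z h -> 0 < plsq z h.
Proof.
move=> ind; have z0 : 0 < nsq z by rewrite nsq_gt0 (indep_neq0 ind).
have o0 : 0 < nsq (orth z h) by rewrite nsq_gt0 indep_orth_neq0.
rewrite -(pmulr_rgt0 _ (exprn_gt0 2 z0)) plsq_orth.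
by rewrite mulr_gt0 // mulr_gt0.
Qed.

(** Replacing h by its component o orthogonal to z, |z ^ o| = |z| |o|, and after applying T
    Lagrange's identity gives |zT ^ oT| <= |zT| |oT|. *)
Lemma plsq_mulr_le z h T (s : R) : indep z h -> 0 <= s ->
  (forall u, nsq (u *m T) <= s * nsq u) ->
  plsq (z *m T) (h *m T) <= s ^+ 2 * plsq z h.
Proof.
move=> ind s0 sT; have z0 : 0 < nsq z by rewrite nsq_gt0 (indep_neq0 ind).
rewrite -(ler_pM2l (exprn_gt0 2 z0)) mulrCA plsq_orth.
have -> : nsq z ^+ 2 * plsq (z *m T) (h *m T) = plsq (z *m T) (orth z h *m T).
  have := plsq_tri (z *m T) (h *m T) 1 (hdot z z) (- hdot h z).
  have -> : hdot z z *: (h *m T) + - hdot h z *: (z *m T) = orth z h *m T.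
    by rewrite /orth mulmxBl -!scalemxAl scaleNr.
  rewrite scale1r cabs1 expr1n mul1r hdot_nsq cabs_real (ger0_norm (nsq_ge0 z)) => ->.
  by [].
rewrite plsq_lagrange.
apply: le_trans (_ : 2 * (nsq (z *m T) * nsq (orth z h *m T)) <= _).
  by rewrite ler_pM2l // lerBlDr lerDl sqr_ge0.
rewrite [leRHS]mulrCA ler_pM2l // expr2 mulrACA.
by apply: ler_pM; rewrite ?nsq_ge0.
Qed.

(** The free coefficient e is later chosen so that the bound becomes a square. *)
Lemma nsqD_le u v (e : R) : 0 < e ->
  nsq (u + v) <= (1 + e) * nsq u + (1 + e^-1) * nsq v.
Proof.
move=> e0; rewrite /nsq !mulr_sumr -big_split; apply: ler_sum => j _ /=.
rewrite mxE; have := cabsD (u 0 j) (v 0 j); have := cabs_ge0 (u 0 j + v 0 j).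
move: (cabs (u 0 j + v 0 j)) (cabs (u 0 j)) (cabs (v 0 j)) => c a b c0 cab.
have h1 : c ^+ 2 <= (a + b) ^+ 2 by rewrite lerXn2r // nnegrE // (le_trans c0).
apply: le_trans h1 _.
have -> : (1 + e) * a ^+ 2 + (1 + e^-1) * b ^+ 2 = (a + b) ^+ 2 + e^-1 * (e * a - b) ^+ 2.
  by field; rewrite gt_eqF.
by rewrite lerDl mulr_ge0 ?sqr_ge0 // invr_ge0 ltW.
Qed.

Lemma sum_sq_le (a : 'I_n.+1 -> R) : (\sum_i a i) ^+ 2 <= n.+1%:R * \sum_i a i ^+ 2.
Proof.
set A := \sum_i a i; pose m := A / n.+1%:R; have N0 : n.+1%:R != 0 :> R by rewrite pnatr_eq0.
have h : 0 <= \sum_i (a i - m) ^+ 2 by apply: sumr_ge0 => i _; exact: sqr_ge0.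
have e : \sum_i (a i - m) ^+ 2 = \sum_i a i ^+ 2 - 2 * m * A + n.+1%:R * m ^+ 2.
  rewrite (eq_bigr (fun i => (a i ^+ 2 + (- (2 * m)) * a i) + m ^+ 2)); last by move=> i _; ring.
  rewrite big_split /= sumr_const card_ord -(mulr_natl (m ^+ 2)) big_split /= -mulr_sumr.
  by rewrite -/A; ring.
have {}e : n.+1%:R * \sum_i (a i - m) ^+ 2 = n.+1%:R * \sum_i a i ^+ 2 - A ^+ 2.
  by rewrite e /m; field.
by rewrite -subr_ge0 -e mulr_ge0.
Qed.

Lemma nsq_mulmx_le u T (e : R) : 0 <= e -> (forall i j, cabs (T i j) <= e) ->
  nsq (u *m T) <= (n.+1%:R * e) ^+ 2 * nsq u.
Proof.
move=> e0 Te; pose A := \sum_i cabs (u 0 i).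
have A0 : 0 <= A by apply: sumr_ge0 => i _; exact: cabs_ge0.
have AN : A ^+ 2 <= n.+1%:R * nsq u.
  by rewrite /A /nsq; exact: sum_sq_le.
have hj j : cabs ((u *m T) 0 j) <= A * e.
  rewrite mxE /A mulr_suml; elim/big_ind2 : _ => [|p q r t pq rt|i _].
  - by rewrite cabs0.
  - by apply: le_trans (cabsD _ _) _; exact: lerD.
  - by rewrite cabsM ler_wpM2l ?cabs_ge0.
apply: le_trans (_ : \sum_(j < n.+1) (A * e) ^+ 2 <= _).
  by apply: ler_sum => j _; rewrite lerXn2r ?nnegrE ?cabs_ge0 ?mulr_ge0.
rewrite sumr_const card_ord -(mulr_natl ((A * e) ^+ 2)) .
have -> : n.+1%:R * (A * e) ^+ 2 = (n.+1%:R * e ^+ 2) * A ^+ 2 by ring.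
have -> : (n.+1%:R * e) ^+ 2 * nsq u = (n.+1%:R * e ^+ 2) * (n.+1%:R * nsq u) by ring.
by rewrite ler_wpM2l // mulr_ge0 ?sqr_ge0.
Qed.

Lemma nsq_near1_le u T (e : R) : 0 < e -> (forall i j, cabs (T i j - (1%:M : mat) i j) <= e) ->
  nsq (u *m T) <= (1 + n.+1%:R * e) ^+ 2 * nsq u.
Proof.
move=> e0 Te; pose t := n.+1%:R * e; have t0 : 0 < t by rewrite mulr_gt0.
have -> : u *m T = u + u *m (T - 1%:M) by rewrite mulmxBr mulmx1 addrC subrK.
apply: le_trans (nsqD_le _ _ t0) _; rewrite -/t.
have h : nsq (u *m (T - 1%:M)) <= t ^+ 2 * nsq u.
  apply: nsq_mulmx_le; first exact: ltW.
  by move=> i j; have := Te i j; rewrite !mxE.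
have -> : (1 + t) ^+ 2 * nsq u = (1 + t) * nsq u + (1 + t^-1) * (t ^+ 2 * nsq u).
  by field; rewrite gt_eqF.
by rewrite lerD2l ler_wpM2l // addr_ge0 // invr_ge0 ltW.
Qed.

Lemma hdot_mulmx u v T : hdot (u *m T) (v *m T) = (u *m (T *m T ^t*) *m v ^t*) 0 0.
Proof. by rewrite /hdot trmx_mul map_mxM /= !mulmxA. Qed.

Lemma hdot_unitary u v U : U *m U ^t* = 1%:M -> hdot (u *m U) (v *m U) = hdot u v.
Proof. by move=> UU; rewrite hdot_mulmx UU mulmx1. Qed.

Lemma nsq_hdot u v : hdot u u = hdot v v -> nsq u = nsq v.
Proof. by rewrite !hdot_nsq => /complexI. Qed.

Lemma plsq_hdot z h z' h' : hdot z z = hdot z' z' -> hdot h h = hdot h' h' ->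
  hdot z h = hdot z' h' -> plsq z h = plsq z' h'.
Proof. by move=> /nsq_hdot e1 /nsq_hdot e2 e3; rewrite !plsq_lagrange e1 e2 e3. Qed.

Lemma nsq_unitary u U : U *m U ^t* = 1%:M -> nsq (u *m U) = nsq u.
Proof. by move=> UU; apply: nsq_hdot; exact: hdot_unitary. Qed.

Lemma plsq_unitary z h U : U *m U ^t* = 1%:M -> plsq (z *m U) (h *m U) = plsq z h.
Proof. by move=> UU; apply: plsq_hdot; exact: hdot_unitary. Qed.

End Plucker.

(** * Logarithms of sums of exponentials *)
Section LogSumExp.
Variables (R : realType) (J : finType) (c : J -> R).
Hypothesis c0 : forall j, 0 <= c j.
Hypothesis W0 : 0 < \sum_j c j.
Implicit Types l : J -> R.

(** Normalized so that lse 0 = 0. *)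
Definition lse l : R := ln ((\sum_j c j * expR (l j)) / \sum_j c j).

(** Convexity of exp between 0 and u, from the tangent line inequality applied
    on both sides of t u. *)
Lemma expR_chord (t u : R) : 0 <= t <= 1 -> expR (t * u) <= t * expR u + (1 - t).
Proof.
move=> /andP[t0 t1]; have h1 := expR_ge1Dx ((1 - t) * u); have h2 := expR_ge1Dx (- (t * u)).
have e0 := expR_gt0 (t * u).
have e1 : expR u = expR (t * u) * expR ((1 - t) * u) by rewrite -expRD; congr expR; ring.
have e2 : 1 = expR (t * u) * expR (- (t * u)) by rewrite -expRD subrr expR0.
rewrite e1 -[X in _ + X]mulr1 [X in _ + _ * X]e2.
move: (expR (t * u)) (expR ((1 - t) * u)) (expR (- (t * u))) e0 h1 h2 => p q r p0 h1 h2.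
have -> : t * (p * q) + (1 - t) * (p * r) = p * (t * q + (1 - t) * r) by ring.
rewrite -[leLHS]mulr1 ler_pM2l //.
have k1 : t * (1 + (1 - t) * u) <= t * q by rewrite ler_wpM2l.
have k2 : (1 - t) * (1 - t * u) <= (1 - t) * r by rewrite ler_wpM2l // subr_ge0.
apply: le_trans (lerD k1 k2); rewrite le_eqVlt; apply/orP; left; apply/eqP; ring.
Qed.

Lemma exp_sum_gt0 l : 0 < \sum_j c j * expR (l j).
Proof.
rewrite lt_neqAle; apply/andP; split; last first.
  by apply: sumr_ge0 => j _; rewrite mulr_ge0 ?expR_ge0.
rewrite eq_sym; apply/negP => /eqP/psumr_eq0P h; move: W0; rewrite big1 ?ltxx // => j _.
have := h _ j isT; have ej := expR_gt0 (l j).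
move=> /(_ (fun i _ => mulr_ge0 (c0 i) (expR_ge0 _)))/eqP.
by rewrite mulf_eq0 (gt_eqF ej) orbF => /eqP.
Qed.

Lemma lseK l : \sum_j c j * expR (l j) = expR (lse l) * \sum_j c j.
Proof.
rewrite /lse lnK ?divfK ?gt_eqF // posrE divr_gt0 //; exact: exp_sum_gt0.
Qed.

Lemma lse_le l (b : R) : \sum_j c j * expR (l j) <= expR b * \sum_j c j -> lse l <= b.
Proof. by rewrite lseK ler_pM2r // ler_expR. Qed.

Lemma lse_ge l (b : R) : expR b * \sum_j c j <= \sum_j c j * expR (l j) -> b <= lse l.
Proof. by rewrite lseK ler_pM2r // ler_expR. Qed.

(** Convexity along rays.  With L = lse l, the chord inequality
    exp (t (l_j - L)) <= t exp (l_j - L) + (1 - t) averages to 1. *)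
Lemma lse_ray l (t : R) : 0 <= t <= 1 -> lse (fun j => t * l j) <= t * lse l.
Proof.
move=> t01; apply: lse_le; set L := lse l.
apply: (@le_trans _ _ (\sum_j expR (t * L) * (t * (expR (- L) * (c j * expR (l j))) + (1 - t) * c j))).
  apply: ler_sum => j _; have := expR_chord (l j - L) t01.
  have -> : expR (t * l j) = expR (t * L) * expR (t * (l j - L)) by rewrite -expRD; congr expR; ring.
  have -> : expR (l j - L) = expR (- L) * expR (l j) by rewrite -expRD; congr expR; ring.
  move: (expR (t * (l j - L))) => p hp.
  rewrite mulrCA ler_pM2l ?expR_gt0 //.
  have -> : t * (expR (- L) * (c j * expR (l j))) + (1 - t) * c j =
    c j * (t * (expR (- L) * expR (l j)) + (1 - t)) by ring.
  exact: ler_wpM2l.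
rewrite -mulr_sumr ler_pM2l ?expR_gt0 // big_split /= -!mulr_sumr lseK -/L.
have eL : expR (- L) * expR L = 1 by rewrite -expRD addNr expR0.
by rewrite [X in t * X]mulrA eL mul1r le_eqVlt; apply/orP; left; apply/eqP; ring.
Qed.

Lemma lse_bound l (b : R) : (forall j, `|l j| <= b) -> `|lse l| <= b.
Proof.
move=> lb; rewrite ler_norml; apply/andP; split.
  apply: lse_ge; rewrite mulr_sumr; apply: ler_sum => j _; rewrite mulrC ler_wpM2l // ler_expR.
  by have := lb j; rewrite ler_norml => /andP[].
apply: lse_le; rewrite mulr_sumr; apply: ler_sum => j _; rewrite mulrC ler_wpM2r // ler_expR.
by have := lb j; rewrite ler_norml => /andP[].
Qed.

Lemma lse_ge_term l j : 0 < c j -> l j + ln (c j / \sum_i c i) <= lse l.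
Proof.
move=> cj; apply: lse_ge; rewrite expRD lnK ?posrE ?divr_gt0 // -mulrA divfK ?gt_eqF //.
rewrite (bigD1 j) //= mulrC lerDl; apply: sumr_ge0 => i _; by rewrite mulr_ge0 ?expR_ge0.
Qed.

End LogSumExp.

(** * The potential at a point of the curve *)
Section Potential.
Variables (R : realType) (n : nat).
Local Notation C := (Cx R).
Local Notation vec := 'rV[C]_n.+1.
Local Notation mat := 'M[C]_n.+1.
Implicit Types (u v z h : vec) (k l m : C) (G T U : mat) (x : 'I_n.+1 -> R).
Variable a : R.

(** The growth of the length of z and of the area of the parallelogram on z and
    h under G. *)
Definition loggrow G z h : R :=
  (1 - 2 * a) * ln (nsq (z *m G) / nsq z) + a * ln (plsq (z *m G) (h *m G) / plsq z h).

(** With the halves in the exponents, squared lengths are weighted by exp (x j). *)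
Definition expd x : mat := diag_mx (\row_j (expR (x j / 2))%:C).

Lemma mul_expd u x j : (u *m expd x) 0 j = u 0 j * (expR (x j / 2))%:C.
Proof. by rewrite mul_mx_diag !mxE. Qed.

Lemma expd_mul x y : expd x *m expd y = expd (fun j => x j + y j).
Proof.
apply/matrixP => i j; rewrite mul_mx_diag !mxE; case: eqP => [->|_].
  by rewrite !mulr1n -rmorphM -expRD -mulrDl.
by rewrite !mulr0n mul0r.
Qed.

Lemma expd0 : expd (fun _ => 0) = 1%:M.
Proof.
apply/matrixP => i j; rewrite !mxE mul0r expR0; by case: (i == j).
Qed.

Lemma expdK x : expd x *m expd (fun j => - x j) = 1%:M.
Proof. by rewrite expd_mul -expd0; congr expd; apply/funext => j; rewrite subrr. Qed.

Lemma expd_unit x : expd x \in unitmx.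
Proof. exact: (mulmx1_unit (expdK x)).1. Qed.

Lemma cabs_expR (r : R) : cabs (expR r)%:C = expR r.
Proof. by rewrite cabs_real ger0_norm ?expR_ge0. Qed.

Lemma expR_half2 (r : R) : expR (r / 2) ^+ 2 = expR r.
Proof. by rewrite expr2 -expRD -splitr. Qed.

Lemma nsq_expd u x : nsq (u *m expd x) = \sum_j cabs (u 0 j) ^+ 2 * expR (x j).
Proof.
by apply: eq_bigr => j _; rewrite mul_expd cabsM exprMn cabs_expR expR_half2.
Qed.

Lemma plsq_expd u v x : plsq (u *m expd x) (v *m expd x) =
  \sum_p cabs (plk u v p.1 p.2) ^+ 2 * expR (x p.1 + x p.2).
Proof.
rewrite /plsq pair_bigA; apply: eq_bigr => -[i j] _ /=.
rewrite /plk !mul_expd.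
have -> : u 0 i * (expR (x i / 2))%:C * (v 0 j * (expR (x j / 2))%:C) -
    u 0 j * (expR (x j / 2))%:C * (v 0 i * (expR (x i / 2))%:C) =
  plk u v i j * (expR ((x i + x j) / 2))%:C.
  by rewrite (mulrDl (x i)) expRD rmorphM /plk; ring.
by rewrite cabsM exprMn cabs_expR expR_half2.
Qed.

Definition weight1 z U : 'I_n.+1 -> R := fun j => cabs ((z *m U) 0 j) ^+ 2.
Definition weight2 z h U : 'I_n.+1 * 'I_n.+1 -> R :=
  fun p => cabs (plk (z *m U) (h *m U) p.1 p.2) ^+ 2.

Lemma weight1_ge0 z U j : 0 <= weight1 z U j. Proof. exact: sqr_ge0. Qed.
Lemma weight2_ge0 z h U p : 0 <= weight2 z h U p. Proof. exact: sqr_ge0. Qed.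

Lemma weight1_sum z U : U *m U ^t* = 1%:M -> \sum_j weight1 z U j = nsq z.
Proof. exact: nsq_unitary. Qed.

Lemma weight2_sum z h U : U *m U ^t* = 1%:M -> \sum_p weight2 z h U p = plsq z h.
Proof. by move=> /(plsq_unitary z h) <-; rewrite /plsq pair_bigA. Qed.

Lemma loggrow_lse U x z h : U *m U ^t* = 1%:M -> loggrow (U *m expd x) z h =
  (1 - 2 * a) * lse (weight1 z U) x + a * lse (weight2 z h U) (fun p => x p.1 + x p.2).
Proof.
move=> UU; rewrite /loggrow !mulmxA nsq_expd plsq_expd /lse (weight1_sum _ UU).
by rewrite (weight2_sum _ _ UU).
Qed.

Hypothesis a01 : 0 <= a < 2^-1.

Let a0 : 0 <= a. Proof. by have /andP[] := a01. Qed.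
Let a1 : 0 < 1 - 2 * a.
Proof. by have /andP[_ h] := a01; move: h; lra. Qed.

(** Squared lengths are multiplied by at most s and squared areas by at most s^2, and the
    weights are such that (1 - 2a) + 2a = 1. *)
Lemma loggrow_mulr_le z h G T (s : R) : indep z h -> G \in unitmx -> T \in unitmx -> 0 < s ->
  (forall u, nsq (u *m T) <= s * nsq u) -> loggrow (G *m T) z h <= loggrow G z h + ln s.
Proof.
move=> ind uG uT s0 sT.
have i1 := indep_mul uG ind; have i2 := indep_mul uT i1.
have q1 : 0 < nsq z by rewrite nsq_gt0 (indep_neq0 ind).
have q2 : 0 < nsq (z *m G) by rewrite nsq_gt0 (indep_neq0 i1).
have q3 : 0 < nsq (z *m G *m T) by rewrite nsq_gt0 (indep_neq0 i2).
have p1 := plsq_gt0 ind; have p2 := plsq_gt0 i1; have p3 := plsq_gt0 i2.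
have le1 : ln (nsq (z *m G *m T) / nsq z) <= ln (nsq (z *m G) / nsq z) + ln s.
  rewrite -lnM ?posrE ?divr_gt0 // ler_ln ?posrE ?mulr_gt0 ?invr_gt0 //.
  by rewrite mulrAC ler_pM2r ?invr_gt0 // mulrC.
have le2 : ln (plsq (z *m G *m T) (h *m G *m T) / plsq z h) <=
    ln (plsq (z *m G) (h *m G) / plsq z h) + 2 * ln s.
  have -> : 2 * ln s = ln (s ^+ 2) by rewrite lnXn // mulr_natl.
  have s2 : 0 < s ^+ 2 by rewrite exprn_gt0.
  rewrite -lnM ?posrE ?divr_gt0 // ler_ln ?posrE ?mulr_gt0 ?invr_gt0 //.
  rewrite mulrAC ler_pM2r ?invr_gt0 // mulrC.
  by apply: plsq_mulr_le => //; exact: ltW.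
rewrite /loggrow !mulmxA.
have m1 := ler_wpM2l (ltW a1) le1; have m2 := ler_wpM2l a0 le2.
apply: le_trans (lerD m1 m2) _; rewrite le_eqVlt; apply/orP; left; apply/eqP; ring.
Qed.

Lemma loggrow1 z h : indep z h -> loggrow 1%:M z h = 0.
Proof.
move=> ind; have q1 : 0 < nsq z by rewrite nsq_gt0 (indep_neq0 ind).
have p1 := plsq_gt0 ind.
by rewrite /loggrow !mulmx1 !divff ?gt_eqF // ln1 !mulr0 addr0.
Qed.

Lemma nsq_mulmx_bound G : exists2 s : R, 0 < s & forall u, nsq (u *m G) <= s * nsq u.
Proof.
pose e := 1 + \sum_i \sum_j cabs (G i j); have e1 : 1 <= e.
  by rewrite lerDl; apply: sumr_ge0 => i _; apply: sumr_ge0 => j _; exact: cabs_ge0.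
have e0 : 0 < e by exact: lt_le_trans e1.
exists ((n.+1%:R * e) ^+ 2); first by rewrite exprn_gt0 // mulr_gt0.
move=> u; apply: nsq_mulmx_le; first exact: ltW.
move=> i j; rewrite /e (bigD1 i) //= (bigD1 j) //= addrCA -addrA lerDl.
rewrite addr_ge0 //; first by apply: sumr_ge0 => k _; exact: cabs_ge0.
by rewrite addr_ge0 //; apply: sumr_ge0 => k _; apply: sumr_ge0 => l _; exact: cabs_ge0.
Qed.

Lemma loggrow_bound G : G \in unitmx -> exists b : R, forall z h, indep z h -> `|loggrow G z h| <= b.
Proof.
move=> uG; have [s s0 sP] := nsq_mulmx_bound G; have [t t0 tP] := nsq_mulmx_bound (invmx G).
exists (`|ln s| + `|ln t|) => z h ind; rewrite ler_norml; apply/andP; split.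
  have uV : invmx G \in unitmx by rewrite unitmx_inv.
  have := loggrow_mulr_le ind uG uV t0 tP; rewrite mulmxV // loggrow1 // -lerBlDr sub0r.
  apply: le_trans; rewrite lerN2; apply: le_trans (ler_norm _) _.
  by rewrite lerDr.
have := loggrow_mulr_le ind (unitmx1 _ _) uG s0 sP; rewrite mul1mx loggrow1 // add0r => h1.
by apply: le_trans h1 _; apply: le_trans (ler_norm _) _; rewrite lerDl.
Qed.

Lemma loggrow_tri G z h k l m : k != 0 -> l != 0 -> loggrow G (k *: z) (l *: h + m *: z) = loggrow G z h.
Proof.
move=> k0 l0; have ck : cabs k ^+ 2 != 0 by rewrite expf_neq0 // cabs_eq0.
have cl : cabs l ^+ 2 != 0 by rewrite expf_neq0 // cabs_eq0.
rewrite /loggrow mulmxDl -!scalemxAl !plsq_tri.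
have nsqZ u : nsq (k *: u) = cabs k ^+ 2 * nsq u.
  by rewrite /nsq mulr_sumr; apply: eq_bigr => j _; rewrite mxE cabsM exprMn.
have cancel (c p q : R) : c != 0 -> c * p / (c * q) = p / q.
  by move=> c0; rewrite -mulf_div divff // mul1r.
by rewrite !nsqZ (cancel _ _ _ ck) (cancel _ _ _ (mulf_neq0 ck cl)).
Qed.

Lemma loggrow_ray U x z h (t : R) : U *m U ^t* = 1%:M -> indep z h -> 0 <= t <= 1 ->
  loggrow (U *m expd (fun j => t * x j)) z h <= t * loggrow (U *m expd x) z h.
Proof.
move=> UU ind t01; rewrite !loggrow_lse // mulrDr.
have q1 : 0 < nsq z by rewrite nsq_gt0 (indep_neq0 ind).
have p1 := plsq_gt0 ind.
rewrite -(weight1_sum z UU) in q1; rewrite -(weight2_sum z h UU) in p1.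
have l1 := lse_ray (weight1_ge0 z U) q1 x t01.
have l2 := lse_ray (weight2_ge0 z h U) p1 (fun p => x p.1 + x p.2) t01.
rewrite [X in _ <= X + _]mulrCA [X in _ <= _ + X]mulrCA; apply: lerD; apply: ler_wpM2l => //.
  exact: ltW.
apply: le_trans l2; rewrite le_eqVlt; apply/orP; left; apply/eqP; congr lse.
by apply/funext => p; rewrite mulrDr.
Qed.

Lemma loggrow_norm_le U x z h (b : R) : U *m U ^t* = 1%:M -> indep z h -> (forall j, `|x j| <= b) ->
  `|loggrow (U *m expd x) z h| <= b.
Proof.
move=> UU ind xb; rewrite loggrow_lse //.
have q1 : 0 < nsq z by rewrite nsq_gt0 (indep_neq0 ind).
have p1 := plsq_gt0 ind.
rewrite -(weight1_sum z UU) in q1; rewrite -(weight2_sum z h UU) in p1.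
have l1 := lse_bound (weight1_ge0 z U) q1 xb.
have l2 : `|lse (weight2 z h U) (fun p => x p.1 + x p.2)| <= 2 * b.
  apply: lse_bound => // [p|p]; first exact: weight2_ge0.
  by apply: le_trans (ler_normD _ _) _; rewrite mulr_natl mulr2n lerD.
apply: le_trans (ler_normD _ _) _; rewrite !normrM (gtr0_norm a1) (ger0_norm a0).
have m1 := ler_wpM2l (ltW a1) l1; have m2 := ler_wpM2l a0 l2.
apply: le_trans (lerD m1 m2) _; rewrite le_eqVlt; apply/orP; left; apply/eqP; ring.
Qed.

(** A single term bounds each sum from below; the rest does not depend on x, so x_i and
    x_i + x_j give the asymptotic slope along the ray of x. *)
Lemma loggrow_lower U x z h i j : U *m U ^t* = 1%:M -> indep z h ->
  0 < weight1 z U i -> 0 < weight2 z h U (i, j) ->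
  (1 - 2 * a) * (x i + ln (weight1 z U i / nsq z)) +
    a * (x i + x j + ln (weight2 z h U (i, j) / plsq z h)) <= loggrow (U *m expd x) z h.
Proof.
move=> UU ind w1 w2; rewrite loggrow_lse //.
have q1 : 0 < nsq z by rewrite nsq_gt0 (indep_neq0 ind).
have p1 := plsq_gt0 ind.
rewrite -(weight1_sum z UU) in q1 *; rewrite -(weight2_sum z h UU) in p1 *.
apply: lerD; apply: ler_wpM2l => //; first exact: ltW.
  exact: (lse_ge_term (weight1_ge0 z U) q1).
exact: (lse_ge_term (weight2_ge0 z h U) p1 (fun p => x p.1 + x p.2) w2).
Qed.

End Potential.

(** * Integrals of bounded measurable functions *)
Section BoundedIntegral.
Variables (d : measure_display) (T : measurableType d) (R : realType).
Variable mu : {measure set T -> \bar R}.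
Hypothesis mufin : (mu [set: T] < +oo)%E.
Implicit Types f g : T -> R.

Definition bmeas f := measurable_fun [set: T] f /\ exists b : R, forall y, `|f y| <= b.

Definition integ f : R := (\int[mu]_(y in [set: T]) f y)%R.

Lemma bmeas_integrable f : bmeas f -> mu.-integrable [set: T] (EFin \o f).
Proof.
move=> [mf [b fb]]; apply: measurable_bounded_integrable => //.
exists b; split; first exact: num_real.
by move=> c bc y _; exact: le_trans (fb y) (ltW bc).
Qed.

Lemma bmeas_cst (c : R) : bmeas (fun=> c).
Proof. by split; [exact: measurable_cst|exists `|c|]. Qed.

Lemma bmeasD f g : bmeas f -> bmeas g -> bmeas (fun y => f y + g y).
Proof.
move=> [mf [b fb]] [mg [c gc]]; split; first by have := measurable_realfun.measurable_funD mf mg.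
by exists (b + c) => y; apply: le_trans (ler_normD _ _) _; exact: lerD.
Qed.

Lemma bmeasZ (c : R) f : bmeas f -> bmeas (fun y => c * f y).
Proof.
move=> [mf [b fb]]; split; first exact: (measurable_realfun.measurable_funM (measurable_cst c) mf).
by exists (`|c| * b) => y; rewrite normrM ler_wpM2l.
Qed.

Lemma integ_le f g : bmeas f -> bmeas g -> (forall y, f y <= g y) -> integ f <= integ g.
Proof.
by move=> bf bg fg; apply: le_Rintegral => //; exact: bmeas_integrable.
Qed.

Lemma integD f g : bmeas f -> bmeas g -> integ (fun y => f y + g y) = integ f + integ g.
Proof. by move=> bf bg; apply: RintegralD => //; exact: bmeas_integrable. Qed.

Lemma integZ (c : R) f : bmeas f -> integ (fun y => c * f y) = c * integ f.
Proof. by move=> bf; apply: RintegralZl => //; exact: bmeas_integrable. Qed.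

Lemma integ_cst (c : R) : integ (fun=> c) = c * fine (mu [set: T]).
Proof. exact: Rintegral_cst. Qed.

(** A lower bound on an almost sure limit gives, by dominated convergence applied
    to the truncations at that bound, a positive integral along the sequence. *)
Lemma integ_eventually_gt0 (f : nat -> T -> R) (k b : R) (N : set T) :
  (0 < mu [set: T])%E -> 0 < k -> (forall i, measurable_fun [set: T] (f i)) ->
  (forall i y, `|f i y| <= b) -> measurable N -> mu N = 0%E ->
  (forall y, ~ N y -> exists c, forall i, k + c / i.+1%:R <= f i y) ->
  exists i, 0 < integ (f i).
Proof.
move=> mu0 k0 mf fb mN N0 fk.
pose g i y := Num.min (f i y) k.
have gb i y : `|g i y| <= b + k.
  have := fb i y; rewrite /g /Num.min !ler_norml => /andP[h1 h2].
  by case: ifPn => _; apply/andP; split; lra.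
have bg i : bmeas (g i).
  split; last by exists (b + k).
  by apply: measurable_realfun.measurable_minr => //; exact: measurable_cst.
have gk y : ~ N y -> g i y @[i --> \oo] --> k.
  move=> /fk[c cP].
  have h1 : k + Num.min c 0 / i.+1%:R @[i --> \oo] --> k.
    rewrite -[X in _ --> X]addr0; apply: cvgD; first exact: cvg_cst.
    rewrite -[X in _ --> X](mulr0 (Num.min c 0)).
    by apply: cvgM; [exact: cvg_cst|exact: cvg_harmonic].
  apply: (squeeze_cvgr _ h1); last exact: (@cvg_cst _ k).
  apply: nearW => i; rewrite /g ge_min lexx orbT andbT le_min; apply/andP; split.
    by apply: le_trans (cP i); rewrite lerD2l ler_wpM2r // ge_min lexx.
  by rewrite gerDl mulr_le0_ge0 // ge_min lexx orbT.
have [] := @dominated_convergence _ _ _ mu [set: T] measurableT (fun i y => (g i y)%:E)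
  (fun=> k%:E) (fun=> (b + k)%:E).
- by move=> i; apply/measurable_realfun.measurable_EFinP; have [] := bg i.
- exact: measurable_cst.
- exists N; split=> // y /= h; apply: contrapT => Ny; apply: h => _.
  by apply: cvg_EFin; [exact: nearW|exact: gk].
- by apply: bmeas_integrable; exact: bmeas_cst.
- by apply: aeW => y i _; rewrite lee_fin.
move=> _ _; rewrite integral_cst // => hl.
have muk : 0 < k * fine (mu [set: T]) by rewrite mulr_gt0 // fine_gt0 // mu0.
rewrite -[mu [set: T]]fineK ?ge0_fin_numE // -EFinM in hl.
have fl := fine_cvg hl.
have /cvg_realP/(_ _ muk)[i _ /(_ i (leqnn i)) /= hi] := fl eventually_filter.
exists i; apply: (@lt_le_trans _ _ (integ (g i))).
  by move: hi; rewrite ltr_norml => /andP[+ _]; rewrite ltrBrDr addNr.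
apply: integ_le => [||y]; [exact: bg|by split; [exact: mf|exists b]|].
by rewrite /g ge_min lexx.
Qed.

End BoundedIntegral.

(** * The potential of the curve *)
Section PotentialContinuity.
Variables (R : realType) (n : nat) (T : topologicalType) (t : T) (a : R).
Local Notation C := (Cx R).
Local Notation vec := 'rV[C]_n.+1.
Local Notation mat := 'M[C]_n.+1.
Implicit Types (z h : T -> vec) (G : mat).

Lemma nsq_cont z : vcont t z -> {for t, continuous (fun s => nsq (z s))}.
Proof.
move=> cz; have := @continuous_comp _ _ _ (fun s => hdot (z s) (z s) : C) (@complex.Re R : C -> R) t
  (hdot_cont cz cz) (@continuous_Re R _).
by congr continuous_at; apply/funext => s /=; rewrite hdot_nsq.
Qed.

Lemma plsq_cont z h : vcont t z -> vcont t h -> {for t, continuous (fun s => plsq (z s) (h s))}.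
Proof.
move=> cz ch.
have c1 := @continuous_comp _ _ _ (fun s => hdot (z s) (h s) : C) (@cabs R : C -> R) t
  (hdot_cont cz ch) (@continuous_cabs R _).
have c2 := continuousM (nsq_cont cz) (nsq_cont ch).
have c3 := continuousB c2 (continuousM c1 c1).
have := continuousM (@cst_continuous _ _ (2 : R) t) c3.
by congr continuous_at; apply/funext => s /=; rewrite plsq_lagrange expr2.
Qed.

Lemma ln_ratio_cont (f g : T -> R) : {for t, continuous f} -> {for t, continuous g} ->
  0 < f t -> 0 < g t -> {for t, continuous (fun s => ln (f s / g s))}.
Proof.
move=> cf cg f0 g0; have cV := continuousV (lt0r_neq0 g0) cg.
have cq := continuousM cf cV.
apply: (@continuous_comp _ _ _ (fun s => f s / g s) (@ln R) t cq).
by apply: continuous_ln; rewrite divr_gt0.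
Qed.

Lemma loggrow_cont z h G : vcont t z -> vcont t h -> indep (z t) (h t) -> G \in unitmx ->
  {for t, continuous (fun s => loggrow a G (z s) (h s))}.
Proof.
move=> cz ch ind uG; have ind' := indep_mul uG ind.
have zG := vcont_mulmx (P := G) cz; have hG := vcont_mulmx (P := G) ch.
have pos u v : indep u v -> 0 < @nsq R n u by move=> iuv; rewrite nsq_gt0 (indep_neq0 iuv).
have c1 := ln_ratio_cont (nsq_cont zG) (nsq_cont cz) (pos _ _ ind') (pos _ _ ind).
have c2 := ln_ratio_cont (plsq_cont zG hG) (plsq_cont cz ch) (plsq_gt0 ind') (plsq_gt0 ind).
exact: (continuousD (continuousM (@cst_continuous _ _ (1 - 2 * a) t) c1)
                    (continuousM (@cst_continuous _ _ a t) c2)).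
Qed.

End PotentialContinuity.

Section Functional.
Variables (R : realType) (T : ptopologicalType) (S : riemann_surface R T) (n : nat).
Local Notation C := (Cx R).
Local Notation vec := 'rV[C]_n.+1.
Local Notation mat := 'M[C]_n.+1.
Local Notation borelT := (g_sigma_algebraType (@open T)).
Implicit Types (G U : mat) (x : 'I_n.+1 -> R).
Variable F : T -> mat.
Hypotheses (hF : holomorphic_curve S F) (fF : full F) (n0 : (0 < n)%N).
Hypothesis cT : compact [set: T].
Variables Z H : T -> vec.
Hypothesis ZH : forall y, is_frame S F y (Z y) (H y).
Variable a : R.
Hypothesis a01 : 0 <= a < 2^-1.
Variables (g : conformal_metric S) (mu : {measure set borelT -> \bar R}).
Hypothesis hmu : is_riemannian_measure g mu.

Let ind y : indep (Z y) (H y). Proof. exact: is_frame_indep (ZH y). Qed.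

(** A quantity invariant under triangular changes of frame can be computed near each point
    with a continuous frame, so the discontinuity of Z and H is
    invisible to it. *)
Lemma frame_invariant_cont (f : vec -> vec -> R) :
  (forall z h k l m, k != 0 -> l != 0 -> f (k *: z) (l *: h + m *: z) = f z h) ->
  (forall t z h, vcont t z -> vcont t h -> indep (z t) (h t) ->
    {for t, continuous (fun s : T => f (z s) (h s))}) ->
  continuous (fun y => f (Z y) (H y)).
Proof.
move=> ftri fc t.
have [z [h [cz ch izh loc]]] := frames_local hF fF n0 ZH t.
have e y : (exists k l m, [/\ k != 0, l != 0, Z y = k *: z y & H y = l *: h y + m *: z y]) ->
    f (Z y) (H y) = f (z y) (h y).
  by move=> [k [l [m [k0 l0 -> ->]]]]; exact: ftri.
apply/(cvg_realP (nbhs_filter t)) => d d0.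
have /(cvg_realP (nbhs_filter t))/(_ d d0) c := fc t z h cz ch izh.
have e0 := e _ (nbhs_singleton loc).
by apply: filterS2 loc c => y /e ey; rewrite /= ey e0.
Qed.

Definition growth G : R := integ mu (fun y : borelT => loggrow a G (Z y) (H y)).

Let mufin : (mu [set: T] < +oo)%E. Proof. exact: (mu_finite hmu cT). Qed.
Definition area : R := fine (mu [set: T]).

Lemma area_gt0 : 0 < area.
Proof. by rewrite /area fine_gt0 // mufin andbT; exact: (mu_gt0 hmu). Qed.

Lemma loggrow_bmeas G : G \in unitmx -> bmeas (fun y : borelT => loggrow a G (Z y) (H y)).
Proof.
move=> uG; split; last by have [b bP] := loggrow_bound a01 uG; exists b => y; exact: bP.
apply: borel_continuous; apply: (@frame_invariant_cont (loggrow a G)) => [z h k l m k0 l0|t z h cz ch izh].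
  exact: loggrow_tri.
exact: loggrow_cont.
Qed.

Lemma growth_mulr_le G (D : mat) (s : R) : G \in unitmx -> D \in unitmx -> 0 < s ->
  (forall u, nsq (u *m D) <= s * nsq u) -> growth (G *m D) <= growth G + ln s * area.
Proof.
move=> uG uD s0 sD; rewrite -integ_cst -integD //.
- apply: integ_le => // [||y].
  + by apply: loggrow_bmeas; rewrite unitmx_mul uG.
  + by apply: bmeasD; [exact: loggrow_bmeas|exact: bmeas_cst].
  + by apply: loggrow_mulr_le => //; exact: ind.
- exact: loggrow_bmeas.
- exact: bmeas_cst.
Qed.

Lemma unitary_unit U : U *m U ^t* = 1%:M -> U \in unitmx.
Proof. by move=> UU; exact: (mulmx1_unit UU).1. Qed.

Lemma growth_ray U x (t : R) : U *m U ^t* = 1%:M -> 0 <= t <= 1 ->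
  growth (U *m expd (fun j => t * x j)) <= t * growth (U *m expd x).
Proof.
move=> UU t01; have uU := unitary_unit UU.
rewrite -integZ //; last by apply: loggrow_bmeas; rewrite unitmx_mul uU expd_unit.
apply: integ_le => // [||y].
- by apply: loggrow_bmeas; rewrite unitmx_mul uU expd_unit.
- by apply: bmeasZ; apply: loggrow_bmeas; rewrite unitmx_mul uU expd_unit.
- by apply: loggrow_ray => //; exact: ind.
Qed.

Lemma growth1 : growth 1%:M = 0.
Proof.
rewrite /growth (_ : (fun y => _) = (fun=> 0)) ?integ_cst ?mul0r //.
by apply/funext => y; exact: loggrow1.
Qed.

End Functional.

(** * Growth of the potential along rays *)
Section Coercivity.
Variables (R : realType) (T : ptopologicalType) (S : riemann_surface R T) (n : nat).
Local Notation C := (Cx R).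
Local Notation vec := 'rV[C]_n.+1.
Local Notation mat := 'M[C]_n.+1.
Local Notation borelT := (g_sigma_algebraType (@open T)).
Implicit Types (G U : mat) (x : 'I_n.+1 -> R).
Variable F : T -> mat.
Hypotheses (hF : holomorphic_curve S F) (fF : full F) (n2 : (2 <= n)%N).
Hypothesis cT : compact [set: T].
Variables Z H : T -> vec.
Hypothesis ZH : forall y, is_frame S F y (Z y) (H y).
Variable a : R.
Hypothesis a01 : 0 <= a < 2^-1.
Variables (g : conformal_metric S) (mu : {measure set borelT -> \bar R}).
Hypothesis hmu : is_riemannian_measure g mu.

Let n0 : (0 < n)%N. Proof. exact: ltn_trans n2. Qed.
Let ind y : indep (Z y) (H y). Proof. exact: is_frame_indep (ZH y). Qed.
Let mufin : (mu [set: T] < +oo)%E. Proof. exact: (mu_finite hmu cT). Qed.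

Lemma unit_col_neq0 U i : U \in unitmx -> col i U != 0.
Proof.
move=> uU; apply/eqP => h; have : invmx U *m col i U = col i (1%:M : mat).
  by rewrite colE mulmxA mulVmx // -colE.
rewrite h mulmx0 => /matrixP/(_ i 0); rewrite !mxE eqxx => /eqP.
by rewrite eq_sym oner_eq0.
Qed.

Lemma unit_col_indep U i j (s t : C) : U \in unitmx -> i != j ->
  s *: col i U + t *: col j U = 0 -> s = 0 /\ t = 0.
Proof.
move=> uU ij h; have : invmx U *m (s *: col i U + t *: col j U) =
    s *: col i (1%:M : mat) + t *: col j (1%:M : mat).
  by rewrite mulmxDr -!scalemxAr !colE !mulmxA mulVmx.
rewrite h mulmx0 => /matrixP e; split.
  by have := e i 0; rewrite !mxE eqxx (negbTE ij) mulr1 mulr0 addr0.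
by have := e j 0; rewrite !mxE eqxx eq_sym (negbTE ij) mulr1 mulr0 add0r.
Qed.

Lemma mulmx_col_entry (u : vec) U i : (u *m col i U) 0 0 = (u *m U) 0 i.
Proof. by rewrite colE mulmxA -colE mxE. Qed.

Lemma weight1_neq0 y U i : Z y *m col i U != 0 -> 0 < weight1 (Z y) U i.
Proof.
move=> h; rewrite /weight1 exprn_gt0 // cabs_gt0 -mulmx_col_entry.
by apply: contraNneq h => h; apply/eqP/mx11_eq0.
Qed.

Lemma weight2_neq0 y U i j : vminor (Z y) (H y) (col i U) (col j U) != 0 ->
  0 < weight2 (Z y) (H y) U (i, j).
Proof.
move=> h; rewrite /weight2 exprn_gt0 // cabs_gt0 /plk /=.
by move: h; rewrite /vminor !mulmx_col_entry.
Qed.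

(** Let x_i be the largest exponent, which is positive.  If x_i + x_j < 0 held for
    all j other than i, the sum of the x_j would be less than
    x_i - n x_i, which is negative as n >= 2. *)
Lemma growth_rate x : \sum_j x j = 0 -> (exists j, x j != 0) ->
  exists i j, i != j /\ 0 < (1 - 2 * a) * x i + a * (x i + x j).
Proof.
move=> sx [j0 xj0].
have [i _ im] := @Order.TotalTheory.arg_maxP _ _ _ j0 xpredT x isT.
have {}im j : x j <= x i by exact: im.
have xi : 0 < x i.
  rewrite ltNge; apply/negP => xi; move: xj0; apply/negP; rewrite negbK.
  have h j : 0 <= - x j by rewrite oppr_ge0 (le_trans (im j)).
  have s0 : \sum_j - x j = 0 by rewrite sumrN sx oppr0.
  by rewrite -oppr_eq0 (psumr_eq0P (fun j _ => h j) s0).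
have [j ij xij] : exists2 j, i != j & 0 <= x i + x j.
  apply: contrapT => no.
  have lt j : i != j -> x j <= - x i.
    move=> ij; rewrite leNgt; apply/negP => h; apply: no; exists j => //.
    by rewrite -(opprK (x i)) addrC subr_ge0 ltW.
  have : \sum_j x j <= x i - x i *+ n.
    rewrite (bigD1 i) //= lerD2l -mulNrn.
    apply: (@le_trans _ _ (\sum_(j | j != i) - x i)).
      by apply: ler_sum => j ji; apply: lt; rewrite eq_sym.
    by rewrite sumr_const cardC1 card_ord.
  rewrite sx leNgt => /negP; apply.
  rewrite subr_lt0 -[X in X < _]mulr1n -subr_gt0 -mulrnBr; last exact: ltnW.
  by rewrite pmulrn_lgt0 // subn_gt0.
exists i, j; split=> //; have /andP[a0 a1] := a01.
apply: ltr_pwDl; last exact: mulr_ge0.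
by apply: mulr_gt0 => //; move: a1; lra.
Qed.

(** Outside a finite set of points the i-th coordinate and the (i, j) minor do
    not vanish, so there the potential divided by k is at least the rate up to
    O(1/k); it is uniformly bounded, so the limit passes to the integral. *)
Lemma coercive U x : U *m U ^t* = 1%:M -> \sum_j x j = 0 -> (exists j, x j != 0) ->
  exists k : nat, 0 < growth Z H a mu (U *m expd (fun j => k.+1%:R * x j)).
Proof.
move=> UU sx x0; have uU := unitary_unit UU.
have [i [j [ij k0]]] := growth_rate sx x0; set kp := (X in 0 < X) in k0.
pose B : R := \sum_j `|x j|.
have xB l : `|x l| <= B.
  by rewrite /B (bigD1 l) //= lerDl; apply: sumr_ge0 => m _.
(* The potential along the ray, divided by its parameter, is bounded by B. *)
pose f k (y : borelT) := k.+1%:R^-1 * loggrow a (U *m expd (fun j => k.+1%:R * x j)) (Z y) (H y).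
pose N := [set y | Z y *m col i U = 0] `|` [set y | vminor (Z y) (H y) (col i U) (col j U) = 0].
have fN : finite_set N.
  rewrite finite_setU; split.
    exact: (finite_hyperplane hF fF cT ZH (unit_col_neq0 i uU)).
  by apply: (finite_minor hF fF n0 cT ZH) => s t; exact: unit_col_indep.
have [mN N0] := mu_finite_set hmu fN.
have bm k : bmeas (fun y : borelT => loggrow a (U *m expd (fun j => k.+1%:R * x j)) (Z y) (H y)).
  by apply: (loggrow_bmeas hF fF n0 ZH a01); rewrite unitmx_mul uU expd_unit.
have mf k : measurable_fun [set: borelT] (f k) by have [] := bmeasZ (k.+1%:R^-1) (bm k).
have fB k y : `|f k y| <= B.
  rewrite /f normrM ger0_norm ?invr_ge0 // ler_pdivrMl //.
  apply: (loggrow_norm_le a01 UU (@ind y)) => l; rewrite normrM ger0_norm //.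
  by rewrite ler_wpM2l.
have fk y : ~ N y -> exists c, forall k, kp + c / k.+1%:R <= f k y.
  move=> Ny.
  have w1 : 0 < weight1 (Z y) U i by apply: weight1_neq0; apply/eqP => h; apply: Ny; left.
  have w2 : 0 < weight2 (Z y) (H y) U (i, j) by apply: weight2_neq0; apply/eqP => h; apply: Ny; right.
  exists ((1 - 2 * a) * ln (weight1 (Z y) U i / nsq (Z y)) +
    a * ln (weight2 (Z y) (H y) U (i, j) / plsq (Z y) (H y))) => k.
  have := loggrow_lower a01 (fun j => k.+1%:R * x j) UU (@ind y) w1 w2.
  rewrite /f ler_pdivlMl // => h; apply: le_trans h.
  rewrite mulrDr mulrCA divff ?pnatr_eq0 // mulr1 /kp le_eqVlt; apply/orP; left; apply/eqP; ring.
have [k] := @integ_eventually_gt0 _ _ _ mu mufin f kp B N (mu_gt0 hmu) k0 mf fB mN N0 fk.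
rewrite integZ // => h; exists k; move: h; rewrite pmulr_rgt0 ?invr_gt0 //; exact.
Qed.

End Coercivity.

(** * A compact space of deformations *)
Section MatrixContinuity.
Variables (R : realType) (n : nat) (T : topologicalType) (t : T).
Local Notation C := (Cx R).
Local Notation mat := 'M[C]_n.+1.
Implicit Types (M N : T -> mat).

Definition mcont M := forall i j, {for t, continuous (fun s => M s i j : C)}.

Lemma mcont_cst (A : mat) : mcont (fun=> A).
Proof. by move=> i j; exact: cont_cst. Qed.

Lemma mcont_mul M N : mcont M -> mcont N -> mcont (fun s => M s *m N s).
Proof.
move=> cM cN i j; have := @cont_sum _ _ t _ (index_enum _) (fun k s => M s i k * N s k j)
  (fun k => contM (cM i k) (cN k j)).
by congr continuous_at; apply/funext => s; rewrite mxE.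
Qed.

Lemma mcont_adj M : mcont M -> mcont (fun s => (M s) ^t*).
Proof.
move=> cM i j; have := contJ (cM j i).
by congr continuous_at; apply/funext => s; rewrite !mxE.
Qed.

Lemma mcont_expd (x : T -> 'I_n.+1 -> R) (k : R) :
  (forall j, {for t, continuous (fun s => x s j)}) ->
  mcont (fun s => expd (fun j => k * x s j)).
Proof.
move=> cx i j.
have cr : {for t, continuous (fun s => (expR (k * x s j / 2))%:C : C)}.
  have cl : {for t, continuous (fun s => k * x s j / 2 : R)}.
    exact: (continuousM (continuousM (@cst_continuous _ _ k t) (cx j)) (@cst_continuous _ _ (2^-1 : R) t)).
  apply: continuous_complex => /=; last exact: cst_continuous.
  exact: (@continuous_comp _ _ _ (fun s => k * x s j / 2) (@expR R) t cl (@continuous_expR R _)).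
have := contM cr (@cont_cst _ _ t (1%:M i j)); congr continuous_at; apply/funext => s.
by rewrite !mxE; case: eqP => [->|_] /=; rewrite ?mulr1n ?mulr0n ?mulr1 ?mulr0.
Qed.

Lemma mcont_near1 M (e : R) : mcont M -> M t = 1%:M -> 0 < e ->
  \forall s \near t, forall i j, cabs (M s i j - (1%:M : mat) i j) <= e.
Proof.
move=> cM M1 e0; have h i j : \forall s \near t, cabs (M s i j - (1%:M : mat) i j) <= e.
  have /(cvg_cabsP (nbhs_filter t))/(_ e e0) := cM i j; rewrite M1.
  by apply: filterS => s; exact: ltW.
by apply: filter_forall => i; apply: filter_forall => j; exact: h.
Qed.

Lemma rcont_sum (I : Type) (r : seq I) (f : I -> T -> R) :
  (forall i, {for t, continuous (f i)}) ->
  {for t, continuous (fun s => \sum_(i <- r) f i s)}.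
Proof.
move=> cf; elim: r => [|i r IH].
  have := @cst_continuous _ _ (0 : R) t; congr continuous_at.
  by apply/funext => s; rewrite big_nil.
have := continuousD (cf i) IH; congr continuous_at.
by apply/funext => s; rewrite big_cons.
Qed.

End MatrixContinuity.

Lemma closed_real_le (T : topologicalType) (R : realType) (f : T -> R) (b : R) :
  continuous f -> closed [set p | f p <= b].
Proof. by move=> /continuous_closedP cf; exact: (cf _ (@closed_le R b)). Qed.

Lemma closed_real_ge (T : topologicalType) (R : realType) (f : T -> R) (b : R) :
  continuous f -> closed [set p | b <= f p].
Proof. by move=> /continuous_closedP cf; exact: (cf _ (@closed_ge R b)). Qed.

Section DeformationSpace.
Variables (R : realType) (n : nat).
Local Notation C := (Cx R).
Local Notation mat := 'M[C]_n.+1.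

Definition coord : eqType := ('I_n.+1 * 'I_n.+1 * bool + 'I_n.+1)%type.
(** Pairs of a complex matrix and a real vector, flattened into real
    coordinates so that compactness is that of a product of segments. *)
Definition param := prod_topology (fun _ : coord => R).
Implicit Types p : param.

Definition pmx p : mat := \matrix_(i, j) (p (inl (i, j, true)) +i* p (inl (i, j, false))).
Definition pvec p : 'I_n.+1 -> R := fun j => p (inr j).

Definition mkparam (U : mat) (x : 'I_n.+1 -> R) : param := fun c =>
  match c with
  | inl (i, j, b) => if b then complex.Re (U i j) else complex.Im (U i j)
  | inr j => x j
  end.

Lemma pmx_mk U x : pmx (mkparam U x) = U.
Proof. by apply/matrixP => i j; rewrite mxE /=; case: (U i j). Qed.

Lemma coord_cont (c : coord) : continuous (fun p : param => p c : R).
Proof. exact: (@proj_continuous coord (fun=> R) c). Qed.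

Lemma pvec_cont p0 j : {for p0, continuous (fun p => pvec p j)}.
Proof. exact: coord_cont. Qed.

Lemma pmx_cont p0 : mcont p0 pmx.
Proof.
move=> i j; apply: continuous_complex.
  have := @coord_cont (inl (i, j, true)) p0; congr continuous_at.
  by apply/funext => p; rewrite mxE.
have := @coord_cont (inl (i, j, false)) p0; congr continuous_at.
by apply/funext => p; rewrite mxE.
Qed.

Definition unitary p := pmx p *m (pmx p) ^t* = 1%:M.

(** The directions are shell 1 1, and the deformations of size at most r are
    shell 0 (r^2). *)
Definition shell (b c : R) : set param := [set p |
  [/\ unitary p, \sum_j pvec p j = 0 & b <= \sum_j pvec p j ^+ 2 <= c]].

Let defect p : R := \sum_i \sum_j cabs ((pmx p *m (pmx p) ^t*) i j - (1%:M : mat) i j).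

Lemma unitary_closed : closed (unitary : set param).
Proof.
have -> : (unitary : set param) = [set p | defect p <= 0].
  apply/seteqP; split=> p; rewrite /unitary /defect /=.
    by move=> ->; rewrite big1 // => i _; rewrite big1 // => j _; rewrite subrr cabs0.
  move=> d0; apply/matrixP => i j; apply/eqP; rewrite -subr_eq0 -cabs_eq0.
  rewrite eq_le cabs_ge0 andbT; apply: le_trans d0.
  rewrite (bigD1 i) //= (bigD1 j) //= -addrA lerDl addr_ge0 //.
    by apply: sumr_ge0 => l _; exact: cabs_ge0.
  by apply: sumr_ge0 => k _; apply: sumr_ge0 => l _; exact: cabs_ge0.
apply: closed_real_le => p0; apply: rcont_sum => i; apply: rcont_sum => j.
have cm := mcont_mul (@pmx_cont p0) (mcont_adj (@pmx_cont p0)).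
have cB := contB (cm i j) (@cont_cst _ _ p0 ((1%:M : mat) i j)).
exact: (@continuous_comp _ _ _ (fun p => _ : C) (@cabs R : C -> R) p0 cB (@continuous_cabs R _)).
Qed.

Lemma shell_closed b c : closed (shell b c).
Proof.
have -> : shell b c = (unitary : set param) `&` ([set p | \sum_j pvec p j <= 0] `&`
    [set p | 0 <= \sum_j pvec p j]) `&` ([set p | b <= \sum_j pvec p j ^+ 2] `&`
    [set p | \sum_j pvec p j ^+ 2 <= c]).
  apply/seteqP; split=> p /=.
    by move=> [up -> /andP[bp pc]]; rewrite lexx.
  move=> [[up [s0 s1]] [h1 h2]]; split; first exact: up.
    by apply/eqP; rewrite eq_le s0.
  by apply/andP; split.
have c1 : continuous (fun p : param => \sum_j pvec p j).
  by move=> p0; apply: rcont_sum => j; exact: pvec_cont.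
have c2 : continuous (fun p : param => \sum_j pvec p j ^+ 2).
  move=> p0; apply: rcont_sum => j.
  have := continuousM (@pvec_cont p0 j) (@pvec_cont p0 j); congr continuous_at.
apply: closedI; first apply: closedI; first exact: unitary_closed.
  by apply: closedI; [exact: closed_real_le|exact: closed_real_ge].
by apply: closedI; [exact: closed_real_ge|exact: closed_real_le].
Qed.

Lemma unitary_entry (U : mat) i j : U *m U ^t* = 1%:M -> cabs (U i j) <= 1.
Proof.
move=> UU; have /(congr1 (@complex.Re R)) : (U *m U ^t*) i i = (nsq (row i U))%:C.
  by rewrite -hdot_nsq hdotE mxE; apply: eq_bigr => k _; rewrite !mxE.
rewrite UU mxE eqxx /= /nsq (bigD1 j) //= mxE => e.
rewrite -ler_sqr ?nnegrE ?cabs_ge0 // expr1n e lerDl.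
by apply: sumr_ge0 => k _; exact: sqr_ge0.
Qed.

Lemma shell_compact b c : compact (shell b c).
Proof.
have box := @tychonoff coord (fun=> R) (fun=> `[- (1 + `|c|), 1 + `|c|]%classic)
  (fun=> @segment_compact R _ _).
apply: (@subclosed_compact param (shell b c) _ (@shell_closed b c) box).
move=> p [up _ /andP[_ pc]] [[[i j] s]|j]; rewrite /= in_itv /= -ler_norml.
  have := unitary_entry i j up; rewrite mxE => h.
  apply: (@le_trans _ _ 1); last by rewrite lerDl.
  apply: le_trans h; case: s; [exact: (Re_le_cabs (_ +i* _))|exact: (Im_le_cabs (_ +i* _))].
have h : pvec p j ^+ 2 <= `|c|.
  apply: le_trans (le_trans pc (ler_norm c)); rewrite (bigD1 j) //= lerDl.
  by apply: sumr_ge0 => k _; exact: sqr_ge0.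
rewrite -[p _]/(pvec p j) -ler_sqr ?nnegrE ?addr_ge0 // real_normK ?num_real //.
apply: le_trans h _; rewrite sqrrD expr1n mul1r.
move: (normr_ge0 c) (sqr_ge0 `|c|); move: `|c| (_ ^+ 2) => q q2 h1 h2.
by rewrite mulr2n; lra.
Qed.

End DeformationSpace.

(** * Existence of a minimum *)
Section Minimiser.
Variables (R : realType) (T : ptopologicalType) (S : riemann_surface R T) (n : nat).
Local Notation C := (Cx R).
Local Notation vec := 'rV[C]_n.+1.
Local Notation mat := 'M[C]_n.+1.
Local Notation borelT := (g_sigma_algebraType (@open T)).
Local Notation param := (param R n).
Implicit Types (G U : mat) (x : 'I_n.+1 -> R) (p : param).
Variable F : T -> mat.
Hypotheses (hF : holomorphic_curve S F) (fF : full F) (n2 : (2 <= n)%N).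
Hypothesis cT : compact [set: T].
Variables Z H : T -> vec.
Hypothesis ZH : forall y, is_frame S F y (Z y) (H y).
Variable a : R.
Hypothesis a01 : 0 <= a < 2^-1.
Variables (g : conformal_metric S) (mu : {measure set borelT -> \bar R}).
Hypothesis hmu : is_riemannian_measure g mu.

Let n0 : (0 < n)%N. Proof. exact: ltn_trans n2. Qed.

Definition deform k p : mat := pmx p *m expd (fun j => k * pvec p j).

Lemma expdNK x (k : R) : expd (fun j => k * x j) *m expd (fun j => - k * x j) = 1%:M :> mat.
Proof.
by rewrite -(expdK (fun j => k * x j)); congr (_ *m expd _); apply/funext => j; rewrite mulNr.
Qed.

(** For unitary p this is the inverse of deform k p followed by deform k q, written so
    that it is continuous in both arguments without restriction. *)
Definition change k p q : mat :=
  expd (fun j => - k * pvec p j) *m ((pmx p) ^t* *m (pmx q *m expd (fun j => k * pvec q j))).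

Lemma deform_change k p q : unitary p -> deform k p *m change k p q = deform k q.
Proof.
move=> up; rewrite /deform /change.
rewrite mulmxA -(mulmxA (pmx p)) expdNK mulmx1 mulmxA.
by rewrite [pmx p *m _]up mul1mx.
Qed.

Lemma adj_unit U : U *m U ^t* = 1%:M -> U ^t* \in unitmx.
Proof. by move=> UU; exact: (mulmx1_unit UU).2. Qed.

Lemma deform_unit k p : unitary p -> deform k p \in unitmx.
Proof. by move=> up; rewrite unitmx_mul expd_unit andbT; exact: unitary_unit. Qed.

Lemma change_unit k p q : unitary p -> unitary q -> change k p q \in unitmx.
Proof.
move=> up uq; rewrite unitmx_mul expd_unit /= unitmx_mul; apply/andP; split.
  exact: adj_unit.
exact: deform_unit.
Qed.

Lemma change_refl k p : unitary p -> change k p p = 1%:M.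
Proof.
move=> up; rewrite /change mulmxA; have up' : (pmx p) ^t* *m pmx p = 1%:M by exact: mulmx1C.
rewrite -mulmxA (mulmxA _ (pmx p)) up' mul1mx; have := @expdNK (pvec p) (- k).
by rewrite opprK.
Qed.

(** A matrix with entries e-close to those of the identity stretches lengths by
    at most 1 + (n+1) e. *)
Lemma growth_change k p q (e : R) : unitary p -> unitary q -> 0 < e ->
  (forall i j, cabs (change k p q i j - (1%:M : mat) i j) <= e) ->
  growth Z H a mu (deform k q) <= growth Z H a mu (deform k p) + 2 * (n.+1%:R * e) * area mu.
Proof.
move=> up uq e0 he; rewrite -(deform_change k q up).
have ne0 : 0 < n.+1%:R * e by rewrite mulr_gt0.
have s0 : 0 < (1 + n.+1%:R * e) ^+ 2 by rewrite exprn_gt0 // addr_gt0.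
apply: le_trans (growth_mulr_le hF fF n0 cT ZH a01 hmu (deform_unit k up) (change_unit k up uq) s0 _) _.
  by move=> u; exact: nsq_near1_le.
rewrite lerD2l ler_pM2r; last exact: (area_gt0 cT hmu).
have -> : ln ((1 + n.+1%:R * e) ^+ 2) = 2 * ln (1 + n.+1%:R * e).
  by rewrite lnXn ?addr_gt0 // (mulr_natl (ln _)).
by rewrite ler_pM2l // le_ln1Dx // (lt_trans _ ne0) // ltrN10.
Qed.

Lemma growth_near k p (e : R) : unitary p -> 0 < e ->
  \forall q \near p, unitary q ->
    `|growth Z H a mu (deform k q) - growth Z H a mu (deform k p)| < e.
Proof.
move=> up e0; pose A := 2 * n.+1%:R * area mu + 1.
have A0 : 0 < A by rewrite addr_gt0 // mulr_gt0 //; exact: (area_gt0 cT hmu).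
pose d := e / A; have d0 : 0 < d by rewrite divr_gt0.
have c1 : mcont p (fun q => change k p q).
  apply: mcont_mul; first exact: mcont_cst.
  apply: mcont_mul; first exact: mcont_cst.
  by apply: mcont_mul; [exact: pmx_cont|apply: mcont_expd => j; exact: pvec_cont].
have c2 : mcont p (fun q => change k q p).
  apply: mcont_mul; first by apply: mcont_expd => j; exact: pvec_cont.
  by apply: mcont_mul; [apply: mcont_adj; exact: pmx_cont|exact: mcont_cst].
have n1 := mcont_near1 c1 (change_refl k up) d0.
have n2' := mcont_near1 c2 (change_refl k up) d0.
apply: filterS2 n1 n2' => q h1 h2 uq.
have k1 := growth_change up uq d0 h1; have k2 := growth_change uq up d0 h2.
have small : 2 * (n.+1%:R * d) * area mu < e.
  have -> : e = A * d by rewrite /d mulrC divfK ?gt_eqF.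
  by rewrite -subr_gt0 (_ : A * d - _ = d) //; move: (d) => dd; rewrite /A; ring.
move: k1 k2 small; move: (growth _ _ _ _ _) (growth _ _ _ _ _) (2 * _ * _) => r s t h3 h4 h5.
by rewrite ltr_norml; apply/andP; split; lra.
Qed.

(** In particular positivity at k propagates to every l >= k. *)
Lemma deform_ray k l p : unitary p -> 0 < k -> k <= l ->
  growth Z H a mu (deform k p) <= k / l * growth Z H a mu (deform l p).
Proof.
move=> up k0 kl; have l0 : 0 < l by exact: lt_le_trans kl.
have t01 : 0 <= k / l <= 1.
  by rewrite divr_ge0 ?(ltW k0) ?(ltW l0) //= ler_pdivrMr // mul1r.
have := growth_ray hF fF n0 cT ZH a01 hmu (fun j => l * pvec p j) up t01.
rewrite /deform (_ : (fun j => k / l * _) = (fun j => k * pvec p j)) //.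
by apply/funext => j; rewrite mulrA divfK ?gt_eqF.
Qed.

(** On each ray the potential becomes positive and stays so.  By continuity it
    does so at the same time on nearby rays, so by compactness there is a common time. *)
Lemma escape : exists m : nat, forall p, shell 1 1 p ->
  0 < growth Z H a mu (deform m.+1%:R p).
Proof.
have /compact_near_coveringP cov := @shell_compact R n 1 1.
pose P (k : nat) (p : param) := shell 1 1 p -> 0 < growth Z H a mu (deform k.+1%:R p).
have [p [up sp /andP[np _]]|m _ mP] := cov nat \oo P _.
  have [m m0] : exists m : nat, 0 < growth Z H a mu (deform m.+1%:R p).
    apply: (coercive hF fF n2 cT ZH a01 hmu up sp); apply: contrapT => no.
    have h j : pvec p j = 0 by apply: contrapT => /eqP pj; apply: no; exists j.
    move: np; rewrite big1 ?leNgt ?ltr01 // => j _; by rewrite h expr0n.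
  have near_p := growth_near m.+1%:R up m0.
  exists ([set q | unitary q -> `|growth Z H a mu (deform m.+1%:R q) -
    growth Z H a mu (deform m.+1%:R p)| < growth Z H a mu (deform m.+1%:R p)],
    [set k | (m <= k)%N]).
    by split; [exact: near_p|exists m].
  move=> [q k] [/= hq mk] [uq _ _]; have := hq uq; rewrite ltr_norml => /andP[h _].
  have q0 : 0 < growth Z H a mu (deform m.+1%:R q) by rewrite ltrBrDr addNr in h.
  have := @deform_ray m.+1%:R k.+1%:R q uq (ltr0Sn _ _).
  rewrite ler_nat ltnS => /(_ mk)/(lt_le_trans q0).
  by rewrite pmulr_rgt0 // divr_gt0.
by exists m => p Kp; exact: (mP m (leqnn m) p Kp Kp).
Qed.

(** The potential is 0 at the identity and positive outside the ball where the
    minimum is taken. *)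
Lemma minimiser : exists p, [/\ unitary p, \sum_j pvec p j = 0 &
  forall q, unitary q -> \sum_j pvec q j = 0 ->
    growth Z H a mu (deform 1 p) <= growth Z H a mu (deform 1 q)].
Proof.
have [m mP] := escape; pose r : R := m.+1%:R.
have r0 : 0 < r by rewrite ltr0n.
pose p1 : param := mkparam 1%:M (fun=> 0).
have ball1 : shell 0 (r ^+ 2) p1.
  split; first by rewrite /unitary pmx_mk trmx1 map_mx1 mulmx1.
    by rewrite big1.
  rewrite big1; first by rewrite lexx sqr_ge0.
  by move=> j _; rewrite expr0n.
have val1 : growth Z H a mu (deform 1 p1) = 0.
  rewrite /deform pmx_mk mul1mx (_ : (fun j => _) = (fun=> 0)).
    by rewrite expd0; exact: (growth1 ZH).
  by apply/funext => j; rewrite mulr0.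
have cont : {within shell 0 (r ^+ 2), continuous (fun p : param => growth Z H a mu (deform 1 p))}.
  apply/subspace_continuousP => p [up _ _].
  apply/(cvg_realP (within_filter _ (nbhs_filter p))) => e e0.
  by apply: filterS (growth_near 1 up e0) => q h [uq _ _]; exact: h.
have [|p] := @compact_EVT_min param R _ (shell 0 (r ^+ 2)) _ (@shell_compact R n _ _) cont.
  by exists p1.
move=> /set_mem[up sp _] minp; exists p; split; [exact: up|exact: sp|move=> q uq sq].
have [small|big] := leP (\sum_j pvec q j ^+ 2) (r ^+ 2).
  apply: minp; apply: mem_set; split; [exact: uq|exact: sq|rewrite small andbT].
  by apply: sumr_ge0 => j _; exact: sqr_ge0.
apply: (@le_trans _ _ 0); first by rewrite -val1; apply: minp; exact: mem_set.
set N := \sum_j _ in big; pose rho := Num.sqrt N.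
have N0 : 0 < N by apply: lt_trans big; rewrite exprn_gt0.
have rho0 : 0 < rho by rewrite sqrtr_gt0.
have rho2 : rho ^+ 2 = N by rewrite sqr_sqrtr // ltW.
have rrho : r <= rho by rewrite -ler_sqr ?nnegrE ?ltW // rho2.
pose q' : param := mkparam (pmx q) (fun j => rho^-1 * pvec q j).
have uq' : unitary q' by rewrite /unitary pmx_mk.
have Kq' : shell 1 1 q'.
  split; [exact: uq'|by rewrite -mulr_sumr sq mulr0|].
  rewrite (_ : \sum_j _ = 1) ?lexx //.
  rewrite (eq_bigr (fun j => rho^-1 ^+ 2 * pvec q j ^+ 2)); last by move=> j _; rewrite -exprMn.
  by rewrite -mulr_sumr -/N -rho2 -exprMn mulVf ?expr1n ?gt_eqF.
have e : deform rho q' = deform 1 q.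
  rewrite /deform pmx_mk; congr (_ *m expd _); apply/funext => j.
  by rewrite /pvec /= mulrA mulfV ?gt_eqF.
have := lt_le_trans (mP q' Kq') (deform_ray uq' r0 rrho); rewrite e.
by rewrite (pmulr_rgt0 _ (divr_gt0 r0 rho0)) => /ltW.
Qed.

End Minimiser.

(** * Reduction of arbitrary matrices to deformations *)
Section Gram.
Variables (R : realType) (n : nat).
Local Notation C := (Cx R).
Local Notation vec := 'rV[C]_n.+1.
Local Notation mat := 'M[C]_n.+1.
Implicit Types (u v z h : vec) (G U : mat) (x y : 'I_n.+1 -> R) (a : R).

Lemma adjM (A B : mat) : (A *m B) ^t* = B ^t* *m A ^t*.
Proof. by rewrite trmx_mul map_mxM. Qed.

Lemma adjK (A : mat) : (A ^t*) ^t* = A.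
Proof. by apply/matrixP => i j; rewrite !mxE conjCK. Qed.

Lemma adj_expd x : (expd x : mat) ^t* = expd x.
Proof.
apply/matrixP => i j; rewrite !mxE eq_sym; case: eqP => [->|_].
  by rewrite !mulr1n; exact: conjc_real.
by rewrite !mulr0n conjC0.
Qed.

(** Lengths and areas after applying G only involve the Gram matrix G G^*. *)
Lemma loggrow_gram a G G' z h : G *m G ^t* = G' *m G' ^t* -> loggrow a G z h = loggrow a G' z h.
Proof.
move=> e; have d u v : hdot (u *m G) (v *m G) = hdot (u *m G') (v *m G').
  by rewrite !hdot_mulmx e.
by rewrite /loggrow (nsq_hdot (d z z)) (plsq_hdot (d z z) (d h h) (d z h)).
Qed.

Lemma nsqZ k u : nsq (k *: u) = cabs k ^+ 2 * nsq u.
Proof. by rewrite /nsq mulr_sumr; apply: eq_bigr => j _; rewrite mxE cabsM exprMn. Qed.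

Lemma plsqZ k z h : plsq (k *: z) (k *: h) = cabs k ^+ 2 * cabs k ^+ 2 * plsq z h.
Proof. by rewrite -(plsq_tri z h k k 0) scale0r addr0. Qed.

Lemma loggrow_scale a G z h k : k != 0 -> G \in unitmx -> indep z h ->
  loggrow a (k *: G) z h = loggrow a G z h + ln (cabs k ^+ 2).
Proof.
move=> k0 uG ind; have ind' := indep_mul uG ind.
have c0 : 0 < cabs k ^+ 2 by rewrite exprn_gt0 // cabs_gt0.
have q1 : 0 < nsq z by rewrite nsq_gt0 (indep_neq0 ind).
have q2 : 0 < nsq (z *m G) by rewrite nsq_gt0 (indep_neq0 ind').
have p1 := plsq_gt0 ind; have p2 := plsq_gt0 ind'.
have l1 : ln (nsq (z *m (k *: G)) / nsq z) = ln (cabs k ^+ 2) + ln (nsq (z *m G) / nsq z).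
  by rewrite -scalemxAr nsqZ; move: (cabs k ^+ 2) c0 => c c0; rewrite -mulrA lnM ?posrE ?divr_gt0.
have l2 : ln (plsq (z *m (k *: G)) (h *m (k *: G)) / plsq z h) =
    ln (cabs k ^+ 2) + (ln (cabs k ^+ 2) + ln (plsq (z *m G) (h *m G) / plsq z h)).
  have pp := divr_gt0 p2 p1.
  rewrite -!scalemxAr plsqZ; move: (cabs k ^+ 2) c0 => c c0; rewrite -!mulrA.
  by rewrite lnM ?posrE ?mulr_gt0 ?invr_gt0 // lnM ?posrE ?mulr_gt0 ?invr_gt0.
by rewrite /loggrow l1 l2; ring.
Qed.

Lemma det_expd x : \det (expd x : mat) = (expR ((\sum_j x j) / 2))%:C.
Proof.
rewrite det_diag mulr_suml expR_sum rmorph_prod; apply: eq_bigr => j _.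
by rewrite mxE.
Qed.

Lemma det_gram G : \det (G *m G ^t*) = (cabs (\det G) ^+ 2)%:C.
Proof. by rewrite det_mulmx det_map_mx det_tr cabs_conj. Qed.

Lemma cabs_det_unitary U : U *m U ^t* = 1%:M -> cabs (\det U) ^+ 2 = 1.
Proof. by move=> UU; apply: (@complexI R); rewrite -det_gram UU det1. Qed.

Lemma ln_det_deform U x : U *m U ^t* = 1%:M ->
  ln (cabs (\det (U *m expd x)) ^+ 2) = \sum_j x j.
Proof.
move=> UU; rewrite det_mulmx cabsM exprMn cabs_det_unitary // mul1r det_expd.
by rewrite cabs_expR expR_half2 expRK.
Qed.

(** U^* diagonalizes the positive matrix G G^*, and x is the logarithm of its spectrum. *)
Lemma polar G : G \in unitmx -> exists U x, U *m U ^t* = 1%:M /\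
  G *m G ^t* = (U *m expd x) *m (U *m expd x) ^t*.
Proof.
move=> uG; set A := G *m G ^t*.
have hA : A \is hermsymmx by apply/is_hermitianmxP; rewrite expr0 scale1r adjM adjK.
have /orthomx_spectralP := hermitian_normalmx hA.
set V := spectralmx A; set d := spectral_diag A.
have uV : V \is unitarymx by exact: spectral_unitarymx.
have VV : V *m V ^t* = 1%:M by exact/unitarymxP.
rewrite invmx_unitary // => eA; pose r j := nsq (row j V *m G).
have r0 j : 0 < r j.
  rewrite nsq_gt0 mulmx_unit_neq0 //; apply/eqP => h.
  have : (row j V) *m V ^t* = 0 by rewrite h mul0mx.
  rewrite -row_mul VV => /matrixP/(_ 0 j); rewrite !mxE eqxx => /eqP.
  by rewrite oner_eq0.
have dr j : d 0 j = (r j)%:C.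
  have : (V *m A *m V ^t*) j j = d 0 j.
    rewrite {1}eA !mulmxA VV mul1mx -mulmxA VV mulmx1 mxE eqxx mulr1n //.
  move=> <-; rewrite /r -hdot_nsq hdot_mulmx -/A.
  by rewrite -row_mul [RHS]mxE [LHS]mxE; apply: eq_bigr => k _; rewrite !mxE.
exists (V ^t*), (fun j => ln (r j)); split; first by rewrite adjK; exact: mulmx1C.
rewrite adjM adj_expd adjK !mulmxA -(mulmxA (V ^t*)) expd_mul [LHS]eA.
congr (_ *m _ *m _); apply/matrixP => i j; rewrite !mxE.
have half (p : R) : (p + p) / 2 = p by field.
by rewrite half lnK ?posrE // dr.
Qed.

End Gram.

(** * The balanced point *)
Section BalancedPoint.
Variables (R : realType) (T : ptopologicalType) (S : riemann_surface R T) (n : nat).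
Local Notation C := (Cx R).
Local Notation vec := 'rV[C]_n.+1.
Local Notation mat := 'M[C]_n.+1.
Local Notation borelT := (g_sigma_algebraType (@open T)).
Local Notation param := (param R n).
Implicit Types (G U : mat) (x : 'I_n.+1 -> R) (p : param).
Variable F : T -> mat.
Hypotheses (hF : holomorphic_curve S F) (fF : full F) (n2 : (2 <= n)%N).
Hypothesis cT : compact [set: T].
Variables Z H : T -> vec.
Hypothesis ZH : forall y, is_frame S F y (Z y) (H y).
Variable a : R.
Hypothesis a01 : 0 <= a < 2^-1.
Variables (g : conformal_metric S) (mu : {measure set borelT -> \bar R}).
Hypothesis hmu : is_riemannian_measure g mu.

Let n0 : (0 < n)%N. Proof. exact: ltn_trans n2. Qed.
Let ind y : indep (Z y) (H y). Proof. exact: is_frame_indep (ZH y). Qed.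
Let mufin : (mu [set: T] < +oo)%E. Proof. exact: (mu_finite hmu cT). Qed.

(** The subtracted term has the same homogeneity in G as the growth. *)
Definition scaled_growth G : R :=
  growth Z H a mu G - area mu / n.+1%:R * ln (cabs (\det G) ^+ 2).

Lemma scaled_growth_gram G G' : G *m G ^t* = G' *m G' ^t* -> scaled_growth G = scaled_growth G'.
Proof.
move=> e; rewrite /scaled_growth.
have -> : growth Z H a mu G = growth Z H a mu G'.
  by rewrite /growth; congr integ; apply/funext => y; exact: (loggrow_gram _ _ _ e).
suff -> : cabs (\det G) ^+ 2 = cabs (\det G') ^+ 2.
  exact: erefl.
by apply: (@complexI R); rewrite -!det_gram e.
Qed.

Lemma growth_scale (k : C) G : k != 0 -> G \in unitmx ->
  growth Z H a mu (k *: G) = growth Z H a mu G + ln (cabs k ^+ 2) * area mu.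
Proof.
move=> k0 uG; rewrite -integ_cst -integD //.
- by congr integ; apply/funext => y; exact: (loggrow_scale a k0 uG (@ind y)).
- exact: (loggrow_bmeas hF fF n0 ZH a01).
- exact: bmeas_cst.
Qed.

Lemma scaled_growth_scale (k : C) G : k != 0 -> G \in unitmx -> scaled_growth (k *: G) = scaled_growth G.
Proof.
move=> k0 uG; rewrite /scaled_growth growth_scale // detZ cabsM exprMn cabsX -exprM mulnC exprM.
have c0 : 0 < cabs k ^+ 2 by rewrite exprn_gt0 // cabs_gt0.
have d0 : 0 < cabs (\det G) ^+ 2 by rewrite exprn_gt0 // cabs_gt0 -unitfE.
move: (cabs k ^+ 2) (cabs (\det G) ^+ 2) c0 d0 => c d c0 d0.
rewrite lnM ?posrE ?exprn_gt0 // lnXn // -(mulr_natl (ln c)).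
have N0 : n.+1%:R != 0 :> R by rewrite pnatr_eq0.
by move: (n.+1%:R) N0 => N N0; field.
Qed.

Lemma scaled_growth_deform p : unitary p -> \sum_j pvec p j = 0 -> scaled_growth (deform 1 p) = growth Z H a mu (deform 1 p).
Proof.
move=> up sp; rewrite /scaled_growth ln_det_deform // (eq_bigr (pvec p)) ?sp ?mulr0 ?subr0 //.
by move=> j _; rewrite mul1r.
Qed.

Lemma scaled_growth_normal_form G : G \in unitmx -> exists p : param,
  [/\ unitary p, \sum_j pvec p j = 0 & scaled_growth G = scaled_growth (deform 1 p)].
Proof.
move=> uG; have [U [y [UU e]]] := polar uG.
pose m := (\sum_j y j) / n.+1%:R.
have mN : m *+ n.+1 = \sum_j y j by rewrite -(mulr_natr m) divfK // pnatr_eq0.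
pose p : param := mkparam U (fun j => y j - m).
have up : unitary p by rewrite /unitary pmx_mk.
exists p; split; first exact: up.
  by rewrite sumrB sumr_const card_ord mN subrr.
rewrite (scaled_growth_gram e).
have -> : U *m expd y = (expR (m / 2))%:C *: deform 1 p.
  rewrite /deform pmx_mk scalemxAr; congr (_ *m _); apply/matrixP => i j; rewrite !mxE.
  case: eqP => [->|_]; last by rewrite !mulr0n mulr0.
  by rewrite !mulr1n -rmorphM -expRD -mulrDl mul1r addrC /pvec /= subrK.
apply: scaled_growth_scale; last exact: deform_unit.
by rewrite -cabs_gt0 cabs_expR expR_gt0.
Qed.

Lemma expd_posdef x (v : vec) : v != 0 -> 0 < (v *m expd x *m v ^t*) 0 0.
Proof.
move=> v0; have -> : expd x = expd (fun j => x j / 2) *m (expd (fun j => x j / 2)) ^t* :> mat.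
  rewrite adj_expd expd_mul; congr expd; apply/funext => j; exact: splitr.
rewrite -hdot_mulmx hdot_nsq ltcR nsq_gt0 mulmx_unit_neq0 //; exact: expd_unit.
Qed.

(** Multiplying the minimising U diag(exp(x/2)) by U^* on the right does not
    change its Gram matrix and makes it Hermitian and positive definite. *)
Lemma balanced : exists P : mat, [/\ intH P, P \in unitmx &
  forall G, G \in unitmx -> scaled_growth P <= scaled_growth G].
Proof.
have [p [up sp pmin]] := minimiser hF fF n2 cT ZH a01 hmu.
pose P0 := deform 1 p *m (pmx p) ^t*.
have up' : (pmx p) ^t* *m pmx p = 1%:M by exact: mulmx1C.
have uP0 : P0 \in unitmx by rewrite unitmx_mul deform_unit // adj_unit.
pose x j : R := 1 * pvec p j; pose t : R := \sum_j expR (x j / 2).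
have t0 : 0 < t.
  rewrite /t (bigD1 ord0) //= ltr_pwDl ?expR_gt0 //; apply: sumr_ge0 => j _; exact: expR_ge0.
have tP0 : \tr P0 = t%:C.
  rewrite /P0 mxtrace_mulC /deform mulmxA up' mul1mx /mxtrace rmorph_sum; apply: eq_bigr => j _.
  by rewrite !mxE eqxx mulr1n.
have hP0 : P0 ^t* = P0 by rewrite /P0 /deform !adjM adjK adj_expd mulmxA.
pose c : C := (t^-1)%:C; have c0 : c != 0.
  by rewrite -cabs_gt0 cabs_real normr_gt0 invr_neq0 // gt_eqF.
exists (c *: P0); split.
- split; first split.
  + apply/is_hermitianmxP; rewrite expr0 scale1r; apply/matrixP => i j.
    rewrite -[in LHS]hP0 !mxE rmorphM; congr (_ * _); symmetry; exact: conjc_real.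
  + by rewrite mxtraceZ tP0 -rmorphM mulVf ?gt_eqF // rmorph1.
  + move=> v v0; rewrite -scalemxAr -scalemxAl mxE mulr_gt0 //.
      by rewrite ltcR invr_gt0.
    have -> : v *m P0 *m v ^t* = (v *m pmx p) *m expd x *m (v *m pmx p) ^t*.
      by rewrite /P0 /deform (trmx_mul v) map_mxM /= !mulmxA.
    apply: expd_posdef; exact: (mulmx_unit_neq0 (unitary_unit up) v0).
- by rewrite unitmxZ // unitfE.
move=> G uG; rewrite scaled_growth_scale //.
have [q [uq sq ->]] := scaled_growth_normal_form uG.
have -> : scaled_growth P0 = scaled_growth (deform 1 p).
  apply: scaled_growth_gram; rewrite /P0 adjM adjK !mulmxA -(mulmxA (deform 1 p)) up' mulmx1.
  exact: erefl.
rewrite (scaled_growth_deform up sp) (scaled_growth_deform uq sq); exact: pmin uq sq.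
Qed.

End BalancedPoint.

(** * Stretching along one direction *)
Section RankOne.
Variables (R : realType) (n : nat).
Local Notation C := (Cx R).
Local Notation vec := 'rV[C]_n.+1.
Local Notation mat := 'M[C]_n.+1.
Implicit Types (u v w k : vec) (s d a : R).

(** The two triangular factorizations of the block matrix (1, -r; c, 1). *)
Lemma det_rank1 (K : comNzRingType) m (c : 'cV[K]_m) (r : 'rV[K]_m) :
  \det (1%:M + c *m r) = 1 + (r *m c) 0 0.
Proof.
have e1 : block_mx 1%:M (- r) c 1%:M = block_mx (1%:M : 'M[K]_1) 0 c 1%:M *m
    block_mx 1%:M (- r) 0 (1%:M + c *m r).
  by rewrite mulmx_block !mul1mx !mul0mx !mulmx1 !addr0 mulmxN; congr block_mx; rewrite addrC addrK.
have e2 : block_mx 1%:M (- r) c 1%:M = block_mx (1%:M : 'M[K]_1) (- r) 0 1%:M *m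
    block_mx (1%:M + r *m c) 0 c 1%:M.
  by rewrite mulmx_block !mul1mx !mul0mx !mulmx1 !add0r mulNmx addrK.
have : \det (block_mx 1%:M (- r) c 1%:M) = \det (block_mx (1%:M : 'M[K]_1) (- r) c 1%:M) by [].
rewrite {1}e1 e2 !det_mulmx !det_lblock !det_ublock !det1 !mul1r mulr1 => ->.
by rewrite det_mx11 mxE [X in X + _]mxE eqxx.
Qed.

(** Stretches the unit vector v by 1 + d and fixes its orthogonal complement. *)
Definition stretch v d : mat := 1%:M + (d%:C *: v ^t*) *m v.

Lemma det_stretch v d : hdot v v = 1 -> \det (stretch v d) = (1 + d)%:C.
Proof.
move=> vv; rewrite /stretch det_rank1 -scalemxAr mxE -/(hdot v v) vv mulr1.
by rewrite rmorphD rmorph1.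
Qed.

Lemma mul_stretch w v d : w *m stretch v d = w + (d%:C * hdot w v) *: v.
Proof.
rewrite /stretch mulmxDr mulmx1 mulmxA -scalemxAr -scalemxAl -scalerA; congr (_ + _ *: _).
by rewrite /hdot {1}[w *m v ^t*]mx11_scalar mul_scalar_mx.
Qed.

Lemma hdot_stretch u w v d : hdot v v = 1 ->
  hdot (u *m stretch v d) (w *m stretch v d) =
  hdot u w + (2 * d + d ^+ 2)%:C * (hdot u v * hdot v w).
Proof.
move=> vv.
have cj : (d%:C * hdot w v)^* = d%:C * hdot v w.
  rewrite (hdotC w v) rmorphM; congr (_ * _); exact: conjc_real.
rewrite !mul_stretch hdotDl !hdotDr !hdotZl !hdotZr vv cj.
have -> : (2 * d + d ^+ 2)%:C = 2 * d%:C + d%:C ^+ 2 :> C.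
  by rewrite rmorphD rmorphM rmorphXn rmorph_nat.
ring.
Qed.

Lemma nsq_stretch w v d : hdot v v = 1 ->
  nsq (w *m stretch v d) = nsq w + (2 * d + d ^+ 2) * cabs (hdot w v) ^+ 2.
Proof.
move=> vv; apply: (@complexI R); rewrite -hdot_nsq hdot_stretch // hdot_nsq hdot_mul.
by rewrite -rmorphM -rmorphD.
Qed.

(** For orthogonal w and o the squared areas before and after are
    computed by Lagrange's identity, in which the terms of second order in
    2 d + d^2 cancel. *)
Lemma plsq_stretch w k v d : hdot v v = 1 -> indep w k ->
  plsq (w *m stretch v d) (k *m stretch v d) / plsq w k =
  1 + (2 * d + d ^+ 2) * (cabs (hdot w v) ^+ 2 / nsq w +
     cabs (hdot (orth w k) v) ^+ 2 / nsq (orth w k)).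
Proof.
move=> vv ind; set o := orth w k.
have w0 : 0 < nsq w by rewrite nsq_gt0 (indep_neq0 ind).
have o0 : 0 < nsq o by rewrite nsq_gt0 indep_orth_neq0.
have p0 := plsq_gt0 ind.
have e1 : nsq w ^+ 2 * plsq (w *m stretch v d) (k *m stretch v d) =
    plsq (w *m stretch v d) (o *m stretch v d).
  have := plsq_tri (w *m stretch v d) (k *m stretch v d) 1 (hdot w w) (- hdot k w).
  have -> : hdot w w *: (k *m stretch v d) + - hdot k w *: (w *m stretch v d) = o *m stretch v d.
    by rewrite /o /orth mulmxBl -!scalemxAl scaleNr.
  rewrite scale1r cabs1 expr1n mul1r hdot_nsq cabs_real (ger0_norm (nsq_ge0 w)) => ->.
  exact: erefl.
have e2 : nsq w ^+ 2 * plsq w k = 2 * (nsq w * nsq o) by exact: plsq_orth.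
have ow : hdot w o = 0 by rewrite hdotC hdot_orth rmorph0.
have e3 : plsq (w *m stretch v d) (o *m stretch v d) = 2 * (nsq w * nsq o +
    (2 * d + d ^+ 2) * (cabs (hdot w v) ^+ 2 * nsq o + cabs (hdot o v) ^+ 2 * nsq w)).
  rewrite plsq_lagrange !nsq_stretch // hdot_stretch // ow add0r !cabsM cabs_real.
  have -> : cabs (hdot v o) = cabs (hdot o v) by rewrite (hdotC o v) /cabs norm_conjC.
  rewrite !exprMn real_normK ?num_real //; ring.
have -> : plsq (w *m stretch v d) (k *m stretch v d) / plsq w k =
    (nsq w ^+ 2 * plsq (w *m stretch v d) (k *m stretch v d)) / (nsq w ^+ 2 * plsq w k).
  by rewrite -mulf_div divff ?mul1r // expf_neq0 // gt_eqF.
rewrite e1 e2 e3; move: (nsq w) (nsq o) w0 o0 => p q p0' q0'.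
by field; rewrite !gt_eqF.
Qed.

Lemma CPpt_form w v : (v *m CPpt w *m v ^t*) 0 0 = (cabs (hdot w v) ^+ 2 / nsq w)%:C.
Proof.
rewrite mul_CPpt -scalemxAl mxE -/(hdot w v).
transitivity ((hdot w v * hdot v w) * (hdot w w)^-1); first by rewrite mulrC mulrA.
by rewrite hdot_mul hdot_nsq -fmorphV -rmorphM.
Qed.

Lemma polarization (D : mat) : (forall v, (v *m D *m v ^t*) 0 0 = 0) -> D = 0.
Proof.
move=> h.
have ent (i j : 'I_n.+1) : ((delta_mx 0 i : vec) *m D *m (delta_mx 0 j : vec) ^t*) 0 0 = D i j.
  rewrite -rowE mxE (bigD1 j) //= big1 => [|k kj].
    by rewrite !mxE !eqxx /= conjC1 mulr1 addr0.
  by rewrite !mxE (negbTE kj) andbF /= conjC0 mulr0.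
have two (i j : 'I_n.+1) (t : C) : t^* * D i j + t * D j i = 0.
  have := h ((delta_mx 0 i : vec) + t *: (delta_mx 0 j : vec)).
  rewrite linearD /= map_mxD linearZ /= map_mxZ !mulmxDl !mulmxDr -!scalemxAl -!scalemxAr.
  have zz (M N P Q : 'M[C]_1) : (M + N + (P + Q)) 0 0 = M 0 0 + N 0 0 + (P 0 0 + Q 0 0).
    by rewrite [LHS]mxE; congr (_ + _); rewrite [LHS]mxE.
  have zs (k : C) (M : 'M[C]_1) : (k *: M) 0 0 = k * M 0 0 by rewrite [LHS]mxE.
  rewrite zz !zs !ent; have := h (delta_mx 0 i); have := h (delta_mx 0 j); rewrite !ent => -> ->.
  by rewrite !mulr0 add0r addr0.
apply/matrixP => i j; rewrite mxE.
have h1 := two i j 1; have h2 := two i j 'i%C.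
rewrite rmorph1 !mul1r in h1.
have ei : ('i%C : C)^* = - 'i%C by exact: conjCi.
have i0 : ('i%C : C) != 0 by exact: neq0Ci.
rewrite ei mulNr -mulrN -mulrDr in h2; move/eqP: h2; rewrite mulf_eq0 (negbTE i0) /= addrC subr_eq0.
move=> /eqP e; move: h1; rewrite e -mulr2n => /eqP; rewrite mulrn_eq0 /= => /eqP.
exact.
Qed.

End RankOne.

(** * Integrals of matrices and their Hermitian forms *)
Section SumIntegral.
Variables (d : measure_display) (T : measurableType d) (R : realType).
Variable mu : {measure set T -> \bar R}.
Hypothesis mufin : (mu [set: T] < +oo)%E.

Lemma integ_sum (I : Type) (r : seq I) (f : I -> T -> R) : (forall i, bmeas (f i)) ->
  bmeas (fun y => \sum_(i <- r) f i y) /\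
  integ mu (fun y => \sum_(i <- r) f i y) = \sum_(i <- r) integ mu (f i).
Proof.
move=> bf; elim: r => [|i r [bs es]].
  rewrite (_ : (fun y => _) = (fun=> 0)); last by apply/funext => y; rewrite big_nil.
  by split; [exact: bmeas_cst|rewrite integ_cst mul0r big_nil].
rewrite (_ : (fun y => _) = (fun y => f i y + \sum_(j <- r) f j y)); last first.
  by apply/funext => y; rewrite big_cons.
by split; [exact: bmeasD|rewrite integD // es big_cons].
Qed.

Variable n : nat.
Local Notation C := (Cx R).
Local Notation mat := 'M[C]_n.+1.
Local Notation vec := 'rV[C]_n.+1.
Variable K : T -> mat.
Hypothesis KRe : forall i j, bmeas (fun y => complex.Re (K y i j)).
Hypothesis KIm : forall i j, bmeas (fun y => complex.Im (K y i j)).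

Let M : mat := \matrix_(i, j)
  (integ mu (fun y => complex.Re (K y i j)) +i* integ mu (fun y => complex.Im (K y i j))).

(** Only real parts are considered; imaginary parts follow by
    multiplying the coefficients by -i. *)
Lemma integ_lin (c : 'I_n.+1 -> 'I_n.+1 -> C) :
  complex.Re (\sum_i \sum_j c i j * M i j) =
  integ mu (fun y => complex.Re (\sum_i \sum_j c i j * K y i j)).
Proof.
have ReS (I : finType) (f : I -> C) : complex.Re (\sum_i f i) = \sum_i complex.Re (f i).
  exact: (big_morph (@complex.Re R : C -> R) (@cxReD R) (erefl _)).
have reE (N : mat) : complex.Re (\sum_i \sum_j c i j * N i j) = \sum_i \sum_j
    (complex.Re (c i j) * complex.Re (N i j) + - complex.Im (c i j) * complex.Im (N i j)).
  rewrite ReS; apply: eq_bigr => i _; rewrite ReS; apply: eq_bigr => j _.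
  by rewrite cxReM mulNr.
have bt i j : bmeas (fun y => complex.Re (c i j) * complex.Re (K y i j) +
    - complex.Im (c i j) * complex.Im (K y i j)).
  by apply: bmeasD; exact: bmeasZ.
rewrite reE (_ : (fun y => _) = (fun y => \sum_i \sum_j
    (complex.Re (c i j) * complex.Re (K y i j) + - complex.Im (c i j) * complex.Im (K y i j)))); last first.
  by apply/funext => y; exact: reE.
have [_ ->] := integ_sum (index_enum _) (fun i => (integ_sum (index_enum _) (bt i)).1).
apply: eq_bigr => i _; have [_ ->] := integ_sum (index_enum _) (bt i).
apply: eq_bigr => j _; rewrite integD ?integZ ?mxE //; exact: bmeasZ.
Qed.

Lemma formE (v : vec) (N : mat) : (v *m N *m v ^t*) 0 0 = \sum_i \sum_j (v 0 i * (v 0 j)^*) * N i j.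
Proof.
rewrite exchange_big mxE; apply: eq_bigr => j _.
rewrite !mxE mulr_suml; apply: eq_bigr => i _; ring.
Qed.

Lemma integ_form (v : vec) (q : T -> R) : (forall y, (v *m K y *m v ^t*) 0 0 = (q y)%:C) ->
  (v *m M *m v ^t*) 0 0 = (integ mu q)%:C.
Proof.
move=> qE; rewrite formE; apply: cx_eqP.
  rewrite integ_lin; congr integ; apply/funext => y; by rewrite -formE qE.
have ImE (z : C) : complex.Im z = complex.Re (- 'i%C * z).
  by rewrite mulNr cxReN cxReM /= mul0r mul1r sub0r opprK.
rewrite ImE mulr_sumr (eq_bigr (fun i => \sum_j (- 'i%C * (v 0 i * (v 0 j)^*)) * M i j)); last first.
  by move=> i _; rewrite mulr_sumr; apply: eq_bigr => j _; rewrite mulrA.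
rewrite integ_lin /= (_ : (fun y => _) = (fun=> 0)) ?integ_cst ?mul0r //.
apply/funext => y; rewrite (eq_bigr (fun i => - 'i%C * \sum_j (v 0 i * (v 0 j)^*) * K y i j)); last first.
  by move=> i _; rewrite mulr_sumr; apply: eq_bigr => j _; ring.
by rewrite -mulr_sumr -formE qE -ImE.
Qed.

End SumIntegral.

Lemma continuous_bmeas (T : ptopologicalType) (R : realType) (f : T -> R) :
  compact [set: T] -> continuous f ->
  bmeas (f : g_sigma_algebraType (@open T) -> R).
Proof.
move=> cT cf; split; first exact: borel_continuous.
have cn : {within [set: T], continuous (fun y => `|f y|)}.
  apply: continuous_subspaceT => y.
  exact: (@continuous_comp _ _ _ f (fun r : R => `|r|) y (cf y) (@norm_continuous _ R _)).
have [|c _ cP] := compact_EVT_max _ cT cn; first by exists point.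
by exists `|f c| => y; apply: cP; exact: mem_set.
Qed.

(** * The Euler-Lagrange inequality *)
Section EulerLagrange.
Variables (R : realType) (T : ptopologicalType) (S : riemann_surface R T) (n : nat).
Local Notation C := (Cx R).
Local Notation vec := 'rV[C]_n.+1.
Local Notation mat := 'M[C]_n.+1.
Local Notation borelT := (g_sigma_algebraType (@open T)).
Implicit Types (G U : mat) (v z h : vec).
Variable F : T -> mat.
Hypotheses (hF : holomorphic_curve S F) (fF : full F) (n2 : (2 <= n)%N).
Hypothesis cT : compact [set: T].
Variables Z H : T -> vec.
Hypothesis ZH : forall y, is_frame S F y (Z y) (H y).
Variable a : R.
Hypothesis a01 : 0 <= a < 2^-1.
Variables (g : conformal_metric S) (mu : {measure set borelT -> \bar R}).
Hypothesis hmu : is_riemannian_measure g mu.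
Variable P : mat.
Hypothesis uP : P \in unitmx.
Hypothesis minP : forall G, G \in unitmx -> scaled_growth Z H a mu P <= scaled_growth Z H a mu G.

Let n0 : (0 < n)%N. Proof. exact: ltn_trans n2. Qed.
Let ind y : indep (Z y) (H y). Proof. exact: is_frame_indep (ZH y). Qed.
Let mufin : (mu [set: T] < +oo)%E. Proof. exact: (mu_finite hmu cT). Qed.

(** A_P + a B_P in terms of a frame of the curve A. *)
Definition moved_proj z h : mat :=
  CPpt (z *m P) + a%:C *: (gdir (z *m P) (h *m P) - CPpt (z *m P)).

(** Up to the factor 2 d + d^2, the first variation of the potential at P under
    the stretch along v. *)
Definition slope v z h : R :=
  (1 - 2 * a) * (cabs (hdot (z *m P) v) ^+ 2 / nsq (z *m P)) +
  a * (cabs (hdot (z *m P) v) ^+ 2 / nsq (z *m P) +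
       cabs (hdot (orth (z *m P) (h *m P)) v) ^+ 2 / nsq (orth (z *m P) (h *m P))).

Lemma form_affine v (A B : mat) (k p q : C) :
  (v *m A *m v ^t*) 0 0 = p -> (v *m B *m v ^t*) 0 0 = q ->
  (v *m (A + k *: (B - A)) *m v ^t*) 0 0 = p + k * (q - p).
Proof.
rewrite mulmxDr mulmxDl -scalemxAr -scalemxAl mulmxBr mulmxBl.
move: (v *m A *m _) (v *m B *m _) => M N <- <-.
by rewrite [LHS]mxE; congr (_ + _); rewrite [LHS]mxE; congr (_ * _); rewrite [LHS]mxE [X in _ + X]mxE.
Qed.

Lemma moved_form v z h : (v *m moved_proj z h *m v ^t*) 0 0 = (slope v z h)%:C.
Proof.
have e1 := CPpt_form (z *m P) v; have e2 := CPpt_form (orth (z *m P) (h *m P)) v.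
apply: etrans (form_affine a%:C e1 e2) _; rewrite /slope.
move: (cabs _ ^+ 2 / _) (cabs _ ^+ 2 / _) => p q.
by rewrite -rmorphB -rmorphM -rmorphD; congr (_%:C); ring.
Qed.

Lemma moved_tri z h (k l m : C) : k != 0 -> l != 0 -> moved_proj (k *: z) (l *: h + m *: z) = moved_proj z h.
Proof.
move=> k0 l0.
have e1 : CPpt ((k *: z) *m P) = CPpt (z *m P) by rewrite -scalemxAl; exact: CPpt_scale.
have e2 : gdir ((k *: z) *m P) ((l *: h + m *: z) *m P) = gdir (z *m P) (h *m P).
  by rewrite mulmxDl -!scalemxAl; exact: gdir_tri.
exact: (congr2 (fun A B => A + a%:C *: (B - A)) e1 e2).
Qed.

Lemma moved_cont (t : T) (z h : T -> vec) i j : vcont t z -> vcont t h -> indep (z t) (h t) ->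
  {for t, continuous (fun s => moved_proj (z s) (h s) i j : C)}.
Proof.
move=> cz ch izh; have ind' := indep_mul uP izh.
have cz' := vcont_mulmx (P := P) cz; have ch' := vcont_mulmx (P := P) ch.
have c1 := CPpt_cont (i := i) (j := j) cz' (indep_neq0 ind').
have c2 := gdir_cont (i := i) (j := j) cz' ch' ind'.
have := contD c1 (contM (@cont_cst _ _ t a%:C) (contB c2 c1)).
by congr continuous_at; apply/funext => s; rewrite /moved_proj !mxE.
Qed.

Lemma moved_bmeas i j :
  bmeas (fun y : borelT => complex.Re (moved_proj (Z y) (H y) i j)) /\
  bmeas (fun y : borelT => complex.Im (moved_proj (Z y) (H y) i j)).
Proof.
split; apply: continuous_bmeas => //.
  apply: (frame_invariant_cont hF fF n0 ZH (f := fun z h => complex.Re (moved_proj z h i j))).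
    by move=> z h k l m k0 l0; rewrite moved_tri.
  move=> t z h cz ch izh.
  exact: (@continuous_comp _ _ _ (fun s => moved_proj (z s) (h s) i j : C) (@complex.Re R : C -> R) t
    (moved_cont cz ch izh) (@continuous_Re R _)).
apply: (frame_invariant_cont hF fF n0 ZH (f := fun z h => complex.Im (moved_proj z h i j))).
  by move=> z h k l m k0 l0; rewrite moved_tri.
move=> t z h cz ch izh.
exact: (@continuous_comp _ _ _ (fun s => moved_proj (z s) (h s) i j : C) (@complex.Im R : C -> R) t
  (moved_cont cz ch izh) (@continuous_Im R _)).
Qed.

Lemma slope_bmeas v : bmeas (fun y : borelT => slope v (Z y) (H y)).
Proof.
have -> : (fun y => slope v (Z y) (H y)) =
    (fun y => \sum_i \sum_j complex.Re ((v 0 i * (v 0 j)^*) * moved_proj (Z y) (H y) i j)).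
  apply/funext => y; transitivity (complex.Re ((slope v (Z y) (H y))%:C)); first exact: erefl.
  have ReS (I : finType) (f : I -> C) : complex.Re (\sum_i f i) = \sum_i complex.Re (f i).
    exact: (big_morph (@complex.Re R : C -> R) (@cxReD R) (erefl _)).
  rewrite -moved_form formE ReS; apply: eq_bigr => i _; exact: ReS.
have bt i j : bmeas (fun y : borelT => complex.Re ((v 0 i * (v 0 j)^*) * moved_proj (Z y) (H y) i j)).
  have [b1 b2] := moved_bmeas i j.
  rewrite (_ : (fun y => _) = (fun y => complex.Re (v 0 i * (v 0 j)^*) * complex.Re (moved_proj (Z y) (H y) i j)
    + - complex.Im (v 0 i * (v 0 j)^*) * complex.Im (moved_proj (Z y) (H y) i j))).
    by apply: bmeasD; exact: bmeasZ.
  by apply/funext => y; rewrite cxReM mulNr.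
exact: (integ_sum mufin (index_enum _) (fun i => (integ_sum mufin (index_enum _) (bt i)).1)).1.
Qed.

Lemma stretch_unit v (d : R) : hdot v v = 1 -> -1 < d -> stretch v d \in unitmx.
Proof.
move=> vv d1; rewrite unitmxE det_stretch // unitfE -cabs_gt0 cabs_real normr_gt0.
by rewrite gt_eqF // -ltrBlDl sub0r.
Qed.

Lemma loggrow_stretch v (d : R) z h : hdot v v = 1 -> -1 < d -> indep z h ->
  loggrow a (P *m stretch v d) z h <= loggrow a P z h + (2 * d + d ^+ 2) * slope v z h.
Proof.
move=> vv d1 izh; have i1 := indep_mul uP izh; have i2 := indep_mul (stretch_unit vv d1) i1.
have pos u k : indep u k -> 0 < @nsq R n u by move=> iuk; rewrite nsq_gt0 (indep_neq0 iuk).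
have step (p q r t : R) : 0 < p -> 0 < q -> 0 < r -> r / q = 1 + t -> ln (r / p) <= ln (q / p) + t.
  move=> p0 q0 r0 e; have t0 : 0 < 1 + t by rewrite -e divr_gt0.
  have -> : r / p = q / p * (1 + t) by rewrite -e; field; rewrite !gt_eqF.
  rewrite lnM ?posrE ?divr_gt0 // lerD2l le_ln1Dx //; move: t0; lra.
have s1 := step _ _ _ _ (pos _ _ izh) (pos _ _ i1) (pos _ _ i2).
have s2 := step _ _ _ _ (plsq_gt0 izh) (plsq_gt0 i1) (plsq_gt0 i2) (plsq_stretch d vv i1).
have {}s1 := s1 ((2 * d + d ^+ 2) * (cabs (hdot (z *m P) v) ^+ 2 / nsq (z *m P))).
have e1 : nsq (z *m P *m stretch v d) / nsq (z *m P) =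
    1 + (2 * d + d ^+ 2) * (cabs (hdot (z *m P) v) ^+ 2 / nsq (z *m P)).
  rewrite nsq_stretch // mulrDl divff ?mulrA // gt_eqF //; exact: pos i1.
have {}s1 := s1 e1; have /andP[a0 a1] := a01.
have a2 : 0 <= 1 - 2 * a by move: a1; lra.
rewrite /loggrow !mulmxA /slope.
have m1 := ler_wpM2l a2 s1; have m2 := ler_wpM2l a0 s2.
apply: le_trans (lerD m1 m2) _; rewrite le_eqVlt; apply/orP; left; apply/eqP; ring.
Qed.

(** The logarithm is concave, so the potential grows by at most
    (2 d + d^2) slope, whereas minimality of P bounds its growth from below by
    the variation of the determinant term. *)
Lemma slope_ineq v (d : R) : hdot v v = 1 -> -1 < d ->
  area mu / n.+1%:R * ln ((1 + d) ^+ 2) <=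
  ((1 + d) ^+ 2 - 1) * integ mu (fun y : borelT => slope v (Z y) (H y)).
Proof.
move=> vv d1; have uT := stretch_unit vv d1.
have uPT : P *m stretch v d \in unitmx by rewrite unitmx_mul uP.
have d0 : 0 < 1 + d by move: d1; lra.
have := minP uPT; rewrite /scaled_growth det_mulmx det_stretch // cabsM cabs_real gtr0_norm // exprMn.
have c0 : 0 < cabs (\det P) ^+ 2 by rewrite exprn_gt0 // cabs_gt0 -unitfE.
have d2 : 0 < (1 + d) ^+ 2 by rewrite exprn_gt0.
have eL : ln (cabs (\det P) ^+ 2 * (1 + d) ^+ 2) = ln (cabs (\det P) ^+ 2) + ln ((1 + d) ^+ 2).
  by move: (cabs (\det P) ^+ 2) ((1 + d) ^+ 2) c0 d2 => c e c0 e0; rewrite lnM ?posrE.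
rewrite eL => h1.
have h2 : growth Z H a mu (P *m stretch v d) <= growth Z H a mu P +
    (2 * d + d ^+ 2) * integ mu (fun y : borelT => slope v (Z y) (H y)).
  rewrite -(integZ mufin _ (slope_bmeas v)) -(integD mufin (loggrow_bmeas hF fF n0 ZH a01 uP) (bmeasZ _ (slope_bmeas v))).
  apply: integ_le => // [||y].
    + exact: (loggrow_bmeas hF fF n0 ZH a01).
    + by apply: bmeasD; [exact: (loggrow_bmeas hF fF n0 ZH a01)|apply: bmeasZ; exact: slope_bmeas].
    + exact: (loggrow_stretch vv d1 (@ind y)).
have -> : (1 + d) ^+ 2 - 1 = 2 * d + d ^+ 2 by ring.
move: h1 h2; rewrite mulrDr; move: (growth _ _ _ _ _) (growth _ _ _ _ _) (_ / _ * ln _) (_ / _ * ln _) (_ * integ _ _).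
by move=> p q r s t h1 h2; lra.
Qed.

End EulerLagrange.

(** From ln r >= 1 - 1/r follows (r - 1)(r q - c) >= 0 for all r > 0.  At the midpoint
    r = (1 + c/q)/2 of the two roots this is -(q - c)^2/(4q). *)
Lemma ln_linear_tight (R : realType) (c q : R) : 0 < c ->
  (forall r, 0 < r -> c * ln r <= (r - 1) * q) -> q = c.
Proof.
move=> c0 h.
have k r : 0 < r -> 0 <= (r - 1) * (r * q - c).
  move=> r0; have l : 1 - r^-1 <= ln r.
    have ri : 0 < r^-1 by rewrite invr_gt0.
    have r1 : -1 < r^-1 - 1 by move: ri; lra.
    have := le_ln1Dx r1; have -> : 1 + (r^-1 - 1) = r^-1 by ring.
    by rewrite lnV ?posrE //; lra.
  have h2 := le_trans (ler_wpM2l (ltW c0) l) (h r r0).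
  have := ler_wpM2l (ltW r0) h2.
  have -> : r * (c * (1 - r^-1)) = c * (r - 1) by field; rewrite gt_eqF.
  by rewrite -subr_ge0; congr (_ <= _); ring.
have q0 : 0 < q by have := k 2 (ltr0Sn _ _); move: c0; lra.
have r0 : 0 < (1 + c / q) / 2 by rewrite divr_gt0 // addr_gt0 // divr_gt0.
have := k _ r0.
have -> : ((1 + c / q) / 2 - 1) * ((1 + c / q) / 2 * q - c) = - ((q - c) ^+ 2 / (4 * q)).
  by field; rewrite gt_eqF.
rewrite oppr_ge0 pmulr_lle0 ?invr_gt0 ?mulr_gt0 // => s0.
have : (q - c) ^+ 2 == 0 by rewrite eq_le s0 sqr_ge0.
by rewrite sqrf_eq0 subr_eq0 => /eqP.
Qed.

(** * The center of mass at the balanced point *)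
Section Conclusion.
Variables (R : realType) (T : ptopologicalType) (S : riemann_surface R T) (n : nat).
Local Notation C := (Cx R).
Local Notation vec := 'rV[C]_n.+1.
Local Notation mat := 'M[C]_n.+1.
Local Notation borelT := (g_sigma_algebraType (@open T)).
Variable F : T -> mat.
Hypotheses (hF : holomorphic_curve S F) (fF : full F) (n2 : (2 <= n)%N).
Hypothesis cT : compact [set: T].
Variables Z H : T -> vec.
Hypothesis ZH : forall y, is_frame S F y (Z y) (H y).
Variable a : R.
Hypothesis a01 : 0 <= a < 2^-1.
Variables (g : conformal_metric S) (mu : {measure set borelT -> \bar R}).
Hypothesis hmu : is_riemannian_measure g mu.
Variable P : mat.
Hypothesis uP : P \in unitmx.
Hypothesis minP : forall G, G \in unitmx -> scaled_growth Z H a mu P <= scaled_growth Z H a mu G.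

Let mufin : (mu [set: T] < +oo)%E. Proof. exact: (mu_finite hmu cT). Qed.

Lemma slope_integ (v : vec) : hdot v v = 1 ->
  integ mu (fun y : borelT => slope a P v (Z y) (H y)) = area mu / n.+1%:R.
Proof.
move=> vv; have A0 : 0 < area mu by exact: (area_gt0 cT hmu).
apply: ln_linear_tight => [|r r0]; first by rewrite divr_gt0.
have s0 : 0 < Num.sqrt r by rewrite sqrtr_gt0.
have d1 : -1 < Num.sqrt r - 1 by move: s0; lra.
have := slope_ineq hF fF n2 cT ZH a01 hmu uP minP vv d1.
by rewrite addrC subrK sqr_sqrtr // ltW.
Qed.

Let M : mat := mx_integral mu (fun y => moved_proj a P (Z y) (H y)).

Lemma total_form (v : vec) : hdot v v = 1 -> (v *m M *m v ^t*) 0 0 = (area mu / n.+1%:R)%:C.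
Proof.
move=> vv; rewrite -(slope_integ vv).
apply: (integ_form mufin) => [i j|i j|y].
- by have [] := moved_bmeas hF fF n2 cT ZH a uP i j.
- by have [] := moved_bmeas hF fF n2 cT ZH a uP i j.
- exact: moved_form.
Qed.

Lemma form_sub_scalar (u : vec) (A : mat) (k : C) :
  (u *m (A - k%:M) *m u ^t*) 0 0 = (u *m A *m u ^t*) 0 0 - k * hdot u u.
Proof.
rewrite mulmxBr mulmxBl mul_mx_scalar -scalemxAl /hdot; move: (u *m A *m u ^t*) (u *m u ^t*) => X Y.
by rewrite [LHS]mxE; congr (_ + _); rewrite [LHS]mxE; congr (- _); rewrite [LHS]mxE.
Qed.

Lemma form_scale (k : C) (D : mat) (w : vec) : ((k *: w) *m D *m (k *: w) ^t*) 0 0 =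
  k * (k^* * (w *m D *m w ^t*) 0 0).
Proof.
rewrite linearZ /= map_mxZ -!scalemxAl -!scalemxAr.
by rewrite [LHS]mxE; congr (_ * _); rewrite [LHS]mxE.
Qed.

Lemma total_scalar : M = (area mu / n.+1%:R)%:C%:M.
Proof.
apply/eqP; rewrite -subr_eq0; apply/eqP; apply: polarization => v.
have [->|v0] := eqVneq v 0; first by rewrite !mul0mx mxE.
have q0 : 0 < nsq v by rewrite nsq_gt0.
pose r := Num.sqrt (nsq v); have r0 : 0 < r by rewrite sqrtr_gt0.
pose u : vec := (r^-1)%:C *: v.
have rc : r%:C != 0 :> C by rewrite -cabs_gt0 cabs_real normr_gt0 gt_eqF.
have vu : v = r%:C *: u by rewrite /u scalerA -rmorphM divff ?gt_eqF // rmorph1 scale1r.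
have uu : hdot u u = 1.
  rewrite hdot_nsq /u nsqZ cabs_real gtr0_norm ?invr_gt0 // exprVn sqr_sqrtr ?(ltW q0) //.
  by rewrite mulVf ?gt_eqF // rmorph1.
have form0 : (u *m (M - (area mu / n.+1%:R)%:C%:M) *m u ^t*) 0 0 = 0.
  by apply: etrans (form_sub_scalar _ _ _) _; rewrite (total_form uu) uu mulr1 subrr.
by rewrite vu form_scale form0 !mulr0.
Qed.

Lemma balanced_center : center_of_mass S mu F a P = (n.+1%:R^-1)%:M.
Proof.
have A0 : area mu != 0 by rewrite gt_eqF //; exact: (area_gt0 cT hmu).
rewrite /center_of_mass.
rewrite (_ : (fun x => _) = (fun y => moved_proj a P (Z y) (H y))); last first.
  apply/funext => y; have [e1 e2] := frame_proj uP (ZH y).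
  exact: (congr2 (fun A B => A + a%:C *: B) e2 e1).
rewrite -[mx_integral _ _]/M total_scalar -[fine _]/(area mu) scale_scalar_mx -rmorphM.
rewrite mulrA mulVf // mul1r; congr (_%:M).
by rewrite fmorphV rmorph_nat.
Qed.

End Conclusion.

Theorem proposition6 (R : realType) (T : ptopologicalType)
    (S : riemann_surface R T) (hT : compact [set: T])
    (g : conformal_metric S)
    (mu : {measure set (g_sigma_algebraType (@open T)) -> \bar R})
    (hmu : is_riemannian_measure g mu)
    (n : nat) (hn : (2 <= n)%N)
    (A : T -> 'M[Cx R]_n.+1) (hA : complex_curve S A) (hfull : full A)
    (a : R) (ha : 0 <= a < 2^-1) :
  exists P : 'M[Cx R]_n.+1,
    intH P /\ center_of_mass S mu A a P = (n.+1%:R^-1)%:M.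
Proof.
have [hol _] := hA.
have [Z [H ZH]] := frames_exist hol hfull (ltnW hn).
have [P [iP uP minP]] := balanced hol hfull hn hT ZH ha hmu.
exists P; split; first exact: iP.
exact: (balanced_center hol hfull hn hT ZH ha hmu uP minP).
Qed.
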